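(* Let $\Omega\subset\mathbb R^n$ be a bounded smooth uniformly convex domain, let $f\in C^\infty(\overline\Omega)$ be positive, and let $u\in C^\infty(\overline\Omega)$ be strictly convex with $\det D^2u=f$ in $\Omega$ and $u|_{\partial\Omega}=\varphi$. Set $L_uh=\operatorname{cof}(D^2u):D^2h$, and for $x\in\Omega$ let $\omega_u^x$ be the harmonic measure for $L_u$ at $x$, i.e. the measure on $\partial\Omega$ with $h(x)=\int_{\partial\Omega}g\,d\omega_u^x$ whenever $L_uh=0$ in $\Omega$ and $h|_{\partial\Omega}=g$. Then $\omega_u^x\in J_x^\partial$ and $$B_f(x,\omega_u^x)=\int_{\partial\Omega}\varphi\,d\omega_u^x-u(x).$$ Consequently $u(x)=P_f\varphi(x)$, and $\omega_u^x$ attains the infimum in $$P_f\varphi(x)=\inf_{\mu\in J_x^\partial}\left(\int_{\partial\Omega}\varphi\,d\mu-B_f(x,\mu)\right).$$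
   Context: $A:B=\operatorname{tr}(AB)$ for symmetric matrices, and $\operatorname{cof}$ is the cofactor matrix. $\operatorname{Conv}(\Omega)$ is the set of convex functions on $\Omega$, and $\mathrm{MA}_{\mathbb R}(w)$ is the Alexandrov Monge--Amp\`ere measure of a convex function $w$ (the Lebesgue measure of the subgradient image). $$\mathcal A_f=\{w\in C(\overline\Omega)\cap\operatorname{Conv}(\Omega):\ \mathrm{MA}_{\mathbb R}(w)\ge f\,dx\},$$ $$P_f\varphi(x)=\sup\{w(x):w\in\mathcal A_f,\ w|_{\partial\Omega}\le\varphi\},\qquad B_f(x,\mu)=\inf_{w\in\mathcal A_f}\Big(\int_{\partial\Omega}w\,d\mu-w(x)\Big),$$ $$J_x^\partial=\Big\{\mu\in\mathcal P(\partial\Omega):\int_{\partial\Omega}y\,d\mu(y)=x\Big\},$$ where $\mathcal P(\partial\Omega)$ is the set of Borel probability measures on $\partial\Omega$. *)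

(* Defs.v *)
From HB Require Import structures.
From mathcomp Require Import all_boot all_order all_algebra.
From mathcomp Require Import all_classical all_reals all_analysis.

Set Implicit Arguments.
Unset Strict Implicit.
Unset Printing Implicit Defensive.

Import Order.TTheory GRing.Theory Num.Theory.
Import numFieldNormedType.Exports.

Local Open Scope classical_set_scope.
Local Open Scope ring_scope.

Section lebesgue_Rn.
Context (R : realType) (n : nat).

(* [(a, b)] stands for the half-open box [prod_i ]a_i, b_i]]. *)
Definition box (ab : 'rV[R]_n.+1 * 'rV[R]_n.+1) : set 'rV[R]_n.+1 :=
  [set y | forall i, ab.1 0 i < y 0 i <= ab.2 0 i].

Definition box_volume (ab : 'rV[R]_n.+1 * 'rV[R]_n.+1) : R :=
  \prod_(i < n.+1) Num.max 0 (ab.2 0 i - ab.1 0 i).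

Definition box_cover (A : set 'rV[R]_n.+1) :
    set (nat -> 'rV[R]_n.+1 * 'rV[R]_n.+1) :=
  [set I | A `<=` \bigcup_k box (I k)].

(* Lebesgue outer measure; restricted to its Caratheodory sigma-algebra (the
   Lebesgue measurable sets) it is the n-dimensional Lebesgue measure. *)
Definition lebesgueRn (A : set 'rV[R]_n.+1) : \bar R :=
  ereal_inf [set (\sum_(k <oo) (box_volume (I k))%:E)%E | I in box_cover A].

Local Open Scope ereal_scope.

Lemma box_volume_ge0 ab : 0 <= (box_volume ab)%:E.
Proof. by rewrite lee_fin prodr_ge0// => i _; rewrite le_max lexx. Qed.

Lemma lebesgueRn_ge0 A : 0 <= lebesgueRn A.
Proof.
apply: le_ereal_inf_tmp => _ [I _ <-].
by apply: nneseries_ge0 => k _ _; exact: box_volume_ge0.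
Qed.

Lemma lebesgueRn0 : lebesgueRn set0 = 0.
Proof.
apply/eqP; rewrite eq_le lebesgueRn_ge0 andbT.
apply: ereal_inf_lbound; exists (fun=> (0%R, 0%R)); first by [].
rewrite eseries0// => k _ _.
by rewrite /box_volume big_ord_recl subrr maxxx mul0r.
Qed.

Lemma le_lebesgueRn : {homo lebesgueRn : A B / A `<=` B >-> A <= B}.
Proof.
move=> A B AB; apply/ereal_inf_le_tmp => x [I BI <-].
by exists I => //; exact: subset_trans AB BI.
Qed.

Lemma lebesgueRn_sigma_subadditive : sigma_subadditive lebesgueRn.
Proof.
move=> A; have [[i ioo]|] := pselect (exists i, lebesgueRn (A i) = +oo).
  by rewrite (eseries_pinfty _ _ ioo) ?leey// => k _;
    rewrite -ltNye (lt_le_trans _ (lebesgueRn_ge0 _)).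
rewrite -forallNE => Aoo.
suff add2e (e : {posnum R}) :
    lebesgueRn (\bigcup_k A k) <= \sum_(i <oo) lebesgueRn (A i) + e%:num%:E.
  by apply/lee_addgt0Pr => _/posnumP[].
rewrite (le_trans _ (epsilon_trick _ _ _))//; last first.
  by move=> k; exact: lebesgueRn_ge0.
pose P k I := box_cover (A k) I /\
  \sum_(j <oo) (box_volume (I j))%:E
    <= lebesgueRn (A k) + (e%:num / (2 ^ k.+1)%:R)%:E.
have [G PG] : {G & forall k, P k (G k)}.
  apply: (@choice _ _ P) => k; rewrite /P /lebesgueRn.
  set S := (X in ereal_inf X); move infS : (ereal_inf S) => iS.
  case: iS infS => [r Sr|Soo|Soo].
  - have en1 : (0 < e%:num / (2 ^ k.+1)%:R)%R by [].
    have /(lb_ereal_inf_adherent en1) : ereal_inf S \is a fin_num by rewrite Sr.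
    by move=> [x [I AI IS] xS]; exists I; split => //; rewrite IS -Sr; exact/ltW.
  - by have := Aoo k; rewrite /lebesgueRn Soo.
  - by have := lebesgueRn_ge0 (A k); rewrite /lebesgueRn -/S Soo.
pose mu (ij : nat * nat) := (box_volume (G ij.1 ij.2))%:E.
have mu_ge0 ij : 0 <= mu ij by exact: box_volume_ge0.
apply: (@le_trans _ _ (\esum_(ij in setT) mu ij)).
  have /card_esym/ppcard_eqP[f] := card_nat2.
  apply: ereal_inf_lbound; exists (fun k => G (f k).1 (f k).2).
    move=> t [i _ /(PG i).1[j _ Gt]]; exists (f^-1%FUN (i, j)) => //=.
    by rewrite invK ?inE.
  rewrite -(esum_pred_image mu f xpredT) ?[fun=> _]set_true//.
  by rewrite image_eq.
rewrite (_ : esum _ _ = \sum_(i <oo) \sum_(j <oo) mu (i, j)); last first.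
  pose J : nat -> set (nat * nat) := fun i => [set (i, j) | j in setT].
  rewrite (_ : setT = \bigcup_k J k); last first.
    by rewrite predeqE => -[a b]; split => // _; exists a => //; exists b.
  rewrite esum_bigcupT //=; last first.
    - apply/trivIsetP => i j _ _ ij.
      rewrite predeqE => -[k m] /=; split => //= -[] [_] _ [<-{k} _].
      by move=> [m' _] [] /esym/eqP; rewrite (negbTE ij).
  rewrite -(image_id [set: nat]) -fun_true esum_pred_image//; last first.
    by move=> k _; exact: esum_ge0.
  apply: eq_eseriesr => /= j _.
  rewrite -(esum_pred_image mu (pair j) predT)//=; last first.
    by move=> ? ? _ _; exact: (@can_inj _ _ _ snd).
  by congr esum; rewrite predeqE => -[a b]; split; move=> [i _ <-]; exists i.
apply: lee_nneseries => [i _ _|i _]; first exact: nneseries_ge0.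
exact: (PG i).2.
Qed.

HB.instance Definition _ := isOuterMeasure.Build R _ lebesgueRn
  lebesgueRn0 lebesgueRn_ge0 le_lebesgueRn lebesgueRn_sigma_subadditive.

End lebesgue_Rn.

Notation leb_type R n := (caratheodory_type (@lebesgueRn R n)).
Notation lebesgue_measureRn R n :=
  (@lebesgueRn R n : set (leb_type R n) -> \bar R).

Notation borelRn R n := (g_sigma_algebraType (@open 'rV[R]_n.+1)).

Section calculus.
Context (R : realType) (n : nat).
Implicit Types (U Omega : set 'rV[R]_n.+1) (u h : 'rV[R]_n.+1 -> R).

Definition dot (p q : 'rV[R]_n.+1) : R := \sum_i p 0 i * q 0 i.

Definition pderiv (s : seq 'I_n.+1) u : 'rV[R]_n.+1 -> R :=
  foldr (fun i g => 'D_(delta_mx 0 i) g) u s.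

(* To be used with U open only: 'D_v g y depends on the germ of g at y. *)
Definition Ck_on k U u :=
  (forall s y, (size s <= k)%N -> U y -> {for y, continuous (pderiv s u)}) /\
  (forall s i y, (size s < k)%N -> U y ->
     derivable (pderiv s u) y (delta_mx 0 i)).

Definition smooth_on U u := forall k, Ck_on k U u.

(* C^oo up to the boundary: every partial derivative in Omega extends
   continuously to the closure, the extension of u being u itself. *)
Definition smooth_closure Omega u :=
  [/\ smooth_on Omega u,
      {within closure Omega, continuous u} &
      forall s, exists2 g : 'rV[R]_n.+1 -> R,
        {within closure Omega, continuous g} &
        forall y, Omega y -> g y = pderiv s u y].

Definition grad u (y : 'rV[R]_n.+1) : 'rV[R]_n.+1 := \row_i pderiv [:: i] u y.

Definition hess u (y : 'rV[R]_n.+1) : 'M[R]_n.+1 :=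
  \matrix_(i, j) pderiv [:: i; j] u y.

Definition cofmx (A : 'M[R]_n.+1) : 'M[R]_n.+1 := \matrix_(i, j) cofactor A i j.

Definition linMA u h (y : 'rV[R]_n.+1) : R := \tr (cofmx (hess u y) *m hess h y).

End calculus.

Section domains.
Context (R : realType) (n : nat).
Implicit Types (Omega : set 'rV[R]_n.+1) (u rho : 'rV[R]_n.+1 -> R).

Definition bdry Omega : set 'rV[R]_n.+1 := closure Omega `\` Omega°.

(* Second fundamental form, with respect to the inner normal, of the level set
   of rho through y, where the domain lies on the side where rho is smaller. *)
Definition second_form rho (y tau : 'rV[R]_n.+1) : R :=
  dot (tau *m hess rho y) tau / Num.sqrt (dot (grad rho y) (grad rho y)).

(* Uniform convexity: the principal curvatures of the boundary are bounded
   below by some kappa > 0; the boundary is described near each of its points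
   by a smooth local defining function. *)
Definition smooth_uniformly_convex_domain Omega :=
  [/\ open Omega, Omega !=set0,
      convex_set (Omega : set (convex_lmodType 'rV[R]_n.+1)) &
      exists2 kappa : R, 0 < kappa &
        forall y, bdry Omega y ->
          exists U : set 'rV[R]_n.+1, exists rho : 'rV[R]_n.+1 -> R,
          [/\ open_nbhs y U, smooth_on U rho, grad rho y != 0,
              Omega `&` U = [set z | rho z < 0] `&` U &
              forall tau, dot (grad rho y) tau = 0 ->
                kappa * dot tau tau <= second_form rho y tau]].

Definition strictly_convex_on Omega u :=
  forall y z (t : R), Omega y -> Omega z -> y != z -> 0 < t < 1 ->
    u (t *: y + (1 - t) *: z) < t * u y + (1 - t) * u z.

End domains.

Section monge_ampere.
Context (R : realType) (n : nat) (Omega : set 'rV[R]_n.+1).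
Implicit Types (w f phi : 'rV[R]_n.+1 -> R) (x : 'rV[R]_n.+1).
Implicit Types (mu : {measure set (borelRn R n) -> \bar R}).
Local Open Scope ereal_scope.

Definition subgradient w x : set 'rV[R]_n.+1 :=
  [set p | forall z, Omega z -> (w x + dot p (z - x) <= w z)%R].

(* The image of a Borel subset of Omega is Lebesgue measurable when w is
   convex. *)
Definition MA w (E : set 'rV[R]_n.+1) : \bar R :=
  lebesgueRn (\bigcup_(y in E) subgradient w y).

Definition Aclass f : set ('rV[R]_n.+1 -> R) :=
  [set w | [/\ {within closure Omega, continuous w},
      convex_function (Omega : set (convex_lmodType 'rV[R]_n.+1)) w &
      forall E : set (borelRn R n), measurable E -> E `<=` Omega ->
        \int[lebesgue_measureRn R n]_(y in E) (f y)%:E <= MA w E]].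

Definition Penv f phi x : \bar R :=
  ereal_sup [set (w x)%:E | w in
    Aclass f `&` [set w | forall y, bdry Omega y -> (w y <= phi y)%R]].

Definition Bf f x mu : \bar R :=
  ereal_inf [set \int[mu]_(y in bdry Omega) (w y)%:E - (w x)%:E
            | w in Aclass f].

(* Measures on the boundary are encoded as Borel measures on R^n for which the
   complement of the boundary is null. *)
Definition Jbd x : set {measure set (borelRn R n) -> \bar R} :=
  [set mu : {measure set (borelRn R n) -> \bar R} |
    [/\ mu (~` bdry Omega) = 0, mu (bdry Omega) = 1 &
      forall i, \int[mu]_(y in bdry Omega) ((y : 'rV[R]_n.+1) 0%R i)%:E
                = (x 0%R i)%:E]].

Definition represents_linMA u x mu :=
  mu (~` bdry Omega) = 0 /\
  forall g h : 'rV[R]_n.+1 -> R,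
    Ck_on 2 Omega h -> {within closure Omega, continuous h} ->
    (forall y, Omega y -> linMA u h y = 0%R) ->
    (forall y, bdry Omega y -> h y = g y) ->
    (h x)%:E = \int[mu]_(y in bdry Omega) (g y)%:E.

(* "The" measure on the boundary with the representation property: it has the
   property, and it is the only measure that does. *)
Definition is_harmonic_measure u x mu :=
  represents_linMA u x mu /\
  forall nu : {measure set (borelRn R n) -> \bar R}, represents_linMA u x nu ->
    forall E : set (borelRn R n), measurable E -> nu E = mu E.

End monge_ampere.

(* Main.v *)
(* Comparison: let [h] solve [L_u h = 0], put [k = u + h], and let [w] be in
   [A_f] with [w <= k] on the boundary. If [w > k] somewhere, compare [w] with
   [v = (1 - d) k + d max k] for a small [d > 0]: every subgradient of [w] on the
   open set [D] where [w > v] is the gradient of [v] at a point of [D] at which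
   [D^2 k] is positive semidefinite. There [cof (D^2 u) : D^2 k = (n + 1) f], so
   [det D^2 k <= f] by the inequality of arithmetic and geometric means, and the
   area formula gives
   [int_D f <= MA(w)(D) <= (1 - d)^(n+1) int_D f], which is absurd.

   Hence [w x - u x <= h x] whenever [L_u h = 0] and [w - u <= h] on the
   boundary. The infimum of these [h x] is the integral of [w - u] against the
   harmonic measure, by Hahn-Banach, Riesz representation and the uniqueness of
   the harmonic measure. So [w x - u x <= int (w - u) d omega], with equality for
   [w = u], which is the formula for [B_f]; the duality follows because
   [B_f(x, mu) <= int u d mu - u x] for every [mu]. *)

Require Import Defs.
From mathcomp Require Import all_boot all_order all_algebra.
From mathcomp Require Import all_classical all_reals all_analysis.
From mathcomp Require Import perm measurable_realfun ring lra.

Import Order.TTheory GRing.Theory Num.Theory.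
Import numFieldNormedType.Exports.

Local Open Scope classical_set_scope.
Local Open Scope ring_scope.

Set Implicit Arguments.
Unset Strict Implicit.
Unset Printing Implicit Defensive.

(** * Positive semidefinite matrices *)

(** The obstacle is that a competitor [w] is merely continuous and convex. The comparison therefore
    differentiates only [k = u + h]: subgradients of [w] are transported to points where [k] has a
    supporting hyperplane, and an upper bound for the outer measure of a gradient image suffices
    there. The combination with [max k] lies above [k], so the boundary inequality survives, and it
    multiplies gradients by [1 - d], which is the source of the factor [(1 - d)^(n+1)]. The
    contradiction requires the integral of [f] over [D] to be positive and finite: [D] is open and
    nonempty, [f] positive and bounded. That [u] itself lies in the class takes the reverse area
    inequality, for the injective map [grad u]. Both area inequalities rest on one estimate: a map
    close enough to a matrix [A] expands Lebesgue outer measure by at most any prescribed factor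
    larger than [|det A|]. Hahn-Banach is carried out on all bounded functions, continuous or not,
    so that the functional obtained can be evaluated on the indicators from which its representing
    measure is built. *)

Section psd.
Context (R : realType).

Definition psdmx n (A : 'M[R]_n) := forall x : 'rV_n, 0 <= (x *m A *m x^T) 0 0.

Lemma block_quadratic_form n (a t : R) (b y : 'rV[R]_n) (S : 'M[R]_n) :
  (row_mx t%:M y *m block_mx a%:M b b^T S *m (row_mx t%:M y)^T) 0 0 =
    a * t ^+ 2 + (y *m b^T) 0 0 * t *+ 2 + (y *m S *m y^T) 0 0.
Proof.
rewrite mul_row_block tr_row_mx mul_row_col !mulmxDl tr_scalar_mx.
rewrite !mul_scalar_mx !mul_mx_scalar -scalemxAl.
have -> : b *m y^T = (y *m b^T)^T by rewrite trmx_mul trmxK.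
rewrite !mxE eqxx mulr1n; ring.
Qed.

(** Schur complement with respect to the corner [a]. Since [0^-1 = 0], the second conclusion says
    that [b] vanishes when [a] does, and the formula for the complement covers this degenerate case
    too. *)
Lemma psdmx_drsub n (a : R) (b : 'rV[R]_n) (S : 'M[R]_n) :
  psdmx (block_mx a%:M b b^T S) ->
  [/\ 0 <= a, a * a^-1 *: b = b & psdmx (S - a^-1 *: (b^T *m b))].
Proof.
move=> A0; have q t y := A0 (row_mx t%:M y).
have {}q t (y : 'rV_n) : 0 <= a * t ^+ 2 + (y *m b^T) 0 0 * t *+ 2 + (y *m S *m y^T) 0 0.
  by rewrite -block_quadratic_form.
have a0 : 0 <= a.
  by have := q 1 0; rewrite !mul0mx !mxE mul0r mul0rn !addr0 expr1n mulr1.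
have ab : a * a^-1 *: b = b.
  have [a_0|a_neq0] := eqVneq a 0; last by rewrite divff// scale1r.
  rewrite a_0 mul0r scale0r; apply/esym.
  have bb0 : (b *m b^T) 0 0 <= 0.
    rewrite leNgt; apply/negP => bb_gt0.
    (* When [a = 0] the form is affine in [t]; this [t] gives it the value -1. *)
    have := q (- (1 + (b *m S *m b^T) 0 0) / (b *m b^T) 0 0 / 2) b.
    rewrite a_0 mul0r add0r; apply/negP; rewrite -ltNge.
    by rewrite [ltLHS](_ : _ = -1) ?ltrN10//; field; rewrite gt_eqF.
  apply/rowP => i; apply/eqP; rewrite mxE -sqrf_eq0 eq_le sqr_ge0 andbT.
  apply: le_trans bb0; rewrite mxE (bigD1 i)//= !mxE -expr2 lerDl.
  by apply: sumr_ge0 => j _; rewrite mxE -expr2 sqr_ge0.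
split=> // y.
have yb : (y *m (b^T *m b) *m y^T) 0 0 = (y *m b^T) 0 0 ^+ 2.
  rewrite mulmxA -mulmxA.
  have -> : b *m y^T = (y *m b^T)^T by rewrite trmx_mul trmxK.
  by rewrite mxE big_ord1 !mxE.
rewrite mulmxBr mulmxBl -scalemxAr -scalemxAl mxE [X in _ + X]mxE [X in - X]mxE.
rewrite yb.
have [a_0|a_neq0] := eqVneq a 0.
  by have := q 0 y; rewrite a_0 invr0 !mul0r !mulr0 mul0rn !add0r subr0.
(* The minimiser in [t] of the quadratic polynomial. *)
have := q (- (y *m b^T) 0 0 / a) y.
by rewrite [leRHS](_ : _ = (y *m S *m y^T) 0 0 - a^-1 * (y *m b^T) 0 0 ^+ 2)//; field.
Qed.

(** Induction on the size through Schur complements. This factorisation takes no square roots and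
    keeps zero pivots as zeros of [d]. Of the triangular shape of [C] only the unit determinant and
    diagonal are recorded. *)
Lemma psdmx_ldl n (A : 'M[R]_n) : A^T = A -> psdmx A ->
  exists (C : 'M[R]_n) (d : 'rV[R]_n),
  [/\ \det C = 1, forall i, C i i = 1, forall i, 0 <= d 0 i &
      A = C *m diag_mx d *m C^T].
Proof.
elim: n A => [|n IH] A Asym Apsd.
  exists 1%:M, 0; rewrite det1; split=> // [[]//|[]//|].
  by apply/matrixP => -[].
have [a [b [S AE]]] : exists a (b : 'rV[R]_n) S, A = block_mx a%:M b b^T S.
  exists (A 0 0); exists (@ursubmx _ 1 n 1 n A); exists (@drsubmx _ 1 n 1 n A).
  apply: etrans (esym (@submxK _ 1 n 1 n A)) _; congr (@block_mx _ 1 n 1 n _ _ _ _).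
    rewrite [LHS]mx11_scalar !mxE; congr (A _ _)%:M; exact/val_inj.
  by rewrite -[in LHS]Asym; apply/matrixP => i j; rewrite !mxE.
have := Apsd; rewrite AE => /psdmx_drsub[a0 ab S'psd].
have SS : S^T = S.
  have := Asym; rewrite AE (@tr_block_mx _ 1 n 1 n) => /(@eq_block_mx _ 1 n 1 n).
  by case.
have [|C' [d' [detC' C'1 d'0 S'E]]] := IH _ _ S'psd.
  by rewrite linearB linearZ/= trmx_mul trmxK SS.
exists (block_mx 1%:M 0 (a^-1 *: b^T) C'), (row_mx a%:M d'); split.
- by rewrite (@det_lblock _ 1 n) det1 mul1r.
- move=> i; rewrite -[i](@splitK 1 n); case: (fintype.split _) => k /=.
    by rewrite (@block_mxEul _ 1 n 1 n) mxE eqxx.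
  by rewrite (@block_mxEdr _ 1 n 1 n) C'1.
- move=> i; rewrite -[i](@splitK 1 n); case: (fintype.split _) => k /=.
    by rewrite (@row_mxEl _ 1 1 n) mxE ord1 eqxx.
  by rewrite (@row_mxEr _ 1 1 n).
- rewrite (_ : diag_mx (row_mx a%:M d') =
    @block_mx _ 1 n 1 n (diag_mx a%:M) 0 0 (diag_mx d')); last exact: diag_mx_row.
  rewrite (@tr_block_mx _ 1 n 1 n) !(@mulmx_block _ 1 n 1 n 1 n).
  rewrite !mulmx0 !mul0mx !addr0 !add0r mul1mx trmx1 mulmx1 trmx0 mulmx0.
  rewrite mulmx1 mulmx0 !addr0.
  have -> : diag_mx (a%:M : 'rV_1) = a%:M.
    by apply/matrixP => i j; rewrite !mxE !ord1 eqxx.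
  have trb : (a^-1 *: b^T)^T = a^-1 *: b by rewrite linearZ/= trmxK.
  have abT : (a / a) *: b^T = b^T by rewrite -linearZ/= ab.
  rewrite trb mul0mx addr0 mul_scalar_mx scalerA ab mul_mx_scalar scalerA abT.
  by rewrite -scalemxAr -S'E addrC subrK.
Qed.

(** Hadamard's inequality: [A i i] is the sum over [j] of [C i j ^ 2 * d j], whose term [j = i] is
    already [d i]. *)
Lemma psdmx_det n (A : 'M[R]_n) : A^T = A -> psdmx A ->
  0 <= \det A <= \prod_i A i i.
Proof.
move=> Asym Apsd; have [C [d [detC C1 d0 ->]]] := psdmx_ldl Asym Apsd.
rewrite !det_mulmx det_tr detC mul1r mulr1 det_diag prodr_ge0//=.
apply: ler_prod => i _; rewrite d0/= mxE (bigD1 i)//= mul_mx_diag !mxE C1.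
rewrite mul1r mulr1 lerDl sumr_ge0// => j _.
by rewrite !mxE mulrAC mulr_ge0// -expr2 sqr_ge0.
Qed.

Lemma cofmx_adj n (A : 'M[R]_n.+1) : cofmx A = (\adj A)^T.
Proof. by apply/matrixP => i j; rewrite !mxE. Qed.

(* Simultaneous diagonalisation reduces this to the inequality of arithmetic
   and geometric means together with Hadamard's inequality. *)
Lemma psdmx_det_le n (A M : 'M[R]_n.+1) :
  A^T = A -> psdmx A -> 0 < \det A -> M^T = M -> psdmx M ->
  \tr (cofmx A *m M) = n.+1%:R * \det A -> 0 <= \det M <= \det A.
Proof.
move=> Asym Apsd detA Msym Mpsd trAM.
rewrite (andP (psdmx_det Msym Mpsd)).1/=.
have [C [d [detC C1 d0 AE]]] := psdmx_ldl Asym Apsd.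
have detAE : \det A = \prod_i d 0 i.
  by rewrite AE !det_mulmx det_tr detC mul1r mulr1 det_diag.
have d_gt0 i : 0 < d 0 i.
  rewrite lt0r d0 andbT; apply: contraTneq detA => di0.
  by rewrite detAE (bigD1 i)//= di0 mul0r ltxx.
have Cu : C \in unitmx by rewrite unitmxE detC unitr1.
pose K := invmx C; have CK : C *m K = 1%:M by rewrite mulmxV.
have KC : K *m C = 1%:M by rewrite mulVmx.
have detK : \det K = 1.
  by have := congr1 determinant CK; rewrite det_mulmx detC mul1r det1.
pose A' := K^T *m diag_mx (\row_i (d 0 i)^-1) *m K.
have AA' : A *m A' = 1%:M.
  rewrite AE /A' !mulmxA -(mulmxA _ C^T) -trmx_mul KC trmx1 mulmx1.
  rewrite -(mulmxA C) mulmx_diag (_ : diag_mx _ = 1%:M) ?mulmx1//.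
  apply/matrixP => i j; rewrite !mxE; congr (_ *+ _).
  by rewrite divff// gt_eqF.
have adjA : \adj A = \det A *: A'.
  by rewrite -[LHS]mulmx1 -AA' mulmxA mul_adj_mx mul_scalar_mx.
pose B := K *m M *m K^T.
have Bsym : B^T = B by rewrite /B !trmx_mul trmxK Msym mulmxA.
have Bpsd : psdmx B.
  by move=> x; have := Mpsd (x *m K); rewrite /B trmx_mul !mulmxA.
have detB : \det B = \det M by rewrite !det_mulmx det_tr detK mul1r mulr1.
(* As [\adj A] is [\det A] times the inverse [A'], the trace hypothesis says that the ratios
   [B i i / d i] have mean 1; their product is then at most 1. *)
have trB : \sum_i B i i / d 0 i = n.+1%:R.
  apply: (mulIf (lt0r_neq0 detA)); rewrite -trAM cofmx_adj adjA.
  rewrite (_ : (\det A *: A')^T = \det A *: A'); last first.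
    by rewrite linearZ/= /A' !trmx_mul trmxK tr_diag_mx mulmxA.
  rewrite -scalemxAl mxtraceZ mulrC; congr (_ * _).
  rewrite /A' -!mulmxA mxtrace_mulC !mulmxA -!mulmxA (mulmxA K).
  by apply: eq_bigr => i _; rewrite mul_diag_mx !mxE mulrC.
rewrite -detB (le_trans (andP (psdmx_det Bsym Bpsd)).2)// detAE.
have Bd0 i : 0 <= B i i / d 0 i.
  rewrite divr_ge0//; have := Bpsd (delta_mx 0 i).
  by rewrite -rowE trmx_delta -colE !mxE.
have := (leif_AGM (A := 'I_n.+1) (E := fun i => B i i / d 0 i) (fun i _ => Bd0 i)).1.
rewrite (eq_bigl predT)// [X in (X / _) ^+ _](eq_bigl predT)// trB card_ord divff//.
rewrite expr1n big_split/= => BdE.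
rewrite -[leRHS]mul1r -ler_pdivrMr -?detAE//.
by rewrite detAE -prodfV.
Qed.

End psd.

(** * Lebesgue measure on row vectors *)

Section row_vectors.
Context (R : realType) (n : nat).
Implicit Types (x y z : 'rV[R]_n.+1).

Lemma rV_norm_leP x (e : R) : reflect (forall i, `|x 0 i| <= e) (`|x| <= e).
Proof.
apply: (iffP idP) => [xe i|xe].
  apply: le_trans xe; rewrite [leRHS]mx_normrE.
  exact: (le_bigmax _ (fun ij : 'I_1 * 'I_n.+1 => `|x ij.1 ij.2|) (0, i)).
rewrite [leLHS]mx_normrE; apply/bigmax_leP; split=> [|[i j] _].
  by rewrite (le_trans _ (xe 0)).
by rewrite ord1.
Qed.

Lemma rV_norm_ltP x (e : R) : reflect (forall i, `|x 0 i| < e) (`|x| < e).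
Proof.
apply: (iffP idP) => [xe i|xe].
  by apply: le_lt_trans xe; apply/rV_norm_leP: i.
have e0 : 0 < e by rewrite (le_lt_trans _ (xe 0)).
by rewrite [ltLHS]mx_normrE; apply/bigmax_ltP; split=> [//|[i j] _]; rewrite ord1.
Qed.

Lemma rV_norm_coord x i : `|x 0 i| <= `|x|.
Proof. by apply/rV_norm_leP: i. Qed.

Lemma nbhs_rVP x (U : set 'rV[R]_n.+1) :
  nbhs x U <-> exists2 e : R, 0 < e & forall y, `|x - y| < e -> U y.
Proof.
rewrite nbhs_ballP; split=> -[e e0 xU]; exists e => // y.
  by move=> xy; apply: xU; rewrite mx_norm_ball.
by rewrite mx_norm_ball; exact: xU.
Qed.

End row_vectors.

Section lebesgueRn_box.
Context (R : realType) (n : nat).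
Implicit Types (ab : 'rV[R]_n.+1 * 'rV[R]_n.+1).

Lemma integral_indic_itvoc (c a b : R) : 0 <= c ->
  (\int[lebesgue_measure]_(t in setT) (c * (a < t <= b)%R%:R)%:E =
   (c * Num.max 0 (b - a))%:E)%E.
Proof.
move=> c0; under eq_integral do rewrite EFinM.
rewrite ge0_integralZl_EFin//; last first.
  apply/measurable_EFinP; rewrite (_ : (fun _ => _) = \1_(`]a, b]))//.
  by apply/funext => t; rewrite indicE mem_setE in_itv.
rewrite (_ : (fun t => _) = fun t => (\1_(`]a, b]) t)%:E); last first.
  by apply/funext => t; rewrite indicE mem_setE in_itv.
have -> : (\int[lebesgue_measure]_t (\1_`]a, b] t)%:E)%E =
    lebesgue_measure (`]a, b]%classic : set R) by rewrite integral_indic// setIT.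
rewrite lebesgue_measure_itv/= lte_fin EFinM.
congr (_ * _)%E; case: ltP => ab; first by rewrite max_r ?subr_ge0 ?ltW.
by rewrite max_l// subr_le0.
Qed.

(* Integrating the hypothesis in the last coordinate turns the length of the
   last sides into weights, which is why the weights [c0] and [c] are there. *)
Lemma box_volume_induction m (c0 : R) (c : nat -> R) (a b : nat -> R)
    (a' b' : nat -> nat -> R) :
  0 <= c0 -> (forall k, 0 <= c k) ->
  (forall x : nat -> R,
    ((c0 * \prod_(i < m) (a i < x i <= b i)%R%:R)%:E <=
     \sum_(k <oo) (c k * \prod_(i < m) (a' k i < x i <= b' k i)%R%:R)%:E)%E) ->
  ((c0 * \prod_(i < m) Num.max 0 (b i - a i))%:E <=
   \sum_(k <oo) (c k * \prod_(i < m) Num.max 0 (b' k i - a' k i))%:E)%E.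
Proof.
elim: m c0 c => [|m IH] c0 c c0_ge0 c_ge0 H.
  have := H (fun=> 0); rewrite !big_ord0.
  by under eq_eseriesr do rewrite big_ord0; under [in X in _ -> X]eq_eseriesr do rewrite big_ord0.
have prod_ge0 (x y z : nat -> R) : 0 <= \prod_(i < m) (x i < y i <= z i)%R%:R :> R.
  by apply: prodr_ge0 => i _; rewrite ler0n.
have max_ge0 (r : R) : 0 <= Num.max 0 r by rewrite le_max lexx.
have mind (x y : R) : measurable_fun setT (fun t : R => (x < t <= y)%R%:R : R).
  rewrite (_ : (fun _ => _) = \1_(`]x, y]))//.
  by apply/funext => t; rewrite indicE mem_setE in_itv.
have mindM (r x y : R) : measurable_fun setT (fun t : R => r * (x < t <= y)%R%:R : R).
  by apply: measurable_funM => //; exact: mind.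
rewrite big_ord_recr/= mulrCA mulrC.
under eq_eseriesr do rewrite big_ord_recr/= mulrCA mulrC.
apply: IH => [|k|x]; first by rewrite mulr_ge0.
  by rewrite mulr_ge0.
pose x' t i := if i == m then t else x i.
have x'E t (y z : nat -> R) : \prod_(i < m.+1) (y i < x' t i <= z i)%R%:R =
    \prod_(i < m) (y i < x i <= z i)%R%:R * (y m < t <= z m)%R%:R :> R.
  rewrite big_ord_recr/= /x' eqxx; congr (_ * _).
  by apply: eq_bigr => i _; rewrite ltn_eqF.
rewrite mulrAC -integral_indic_itvoc; last by rewrite mulr_ge0.
under eq_eseriesr => k _.
  rewrite mulrAC -integral_indic_itvoc; last by rewrite mulr_ge0.
  over.
rewrite -integral_nneseries//; last 2 first.
- by move=> k; apply/measurable_EFinP; exact: mindM.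
- by move=> k t _; rewrite lee_fin !mulr_ge0.
apply: ge0_le_integral => //.
- by move=> t _; rewrite lee_fin !mulr_ge0.
- by apply/measurable_EFinP; exact: mindM.
- apply: ge0_emeasurable_sum => [k t _ _|k _].
    by rewrite lee_fin !mulr_ge0.
  by apply/measurable_EFinP; exact: mindM.
- move=> t _; have := H (x' t); rewrite x'E mulrA.
  by under eq_eseriesr do rewrite x'E mulrA.
Qed.

(** A cover is an inequality between indicator functions; integrating it one coordinate at a time
    yields the volumes, without extracting a finite subcover. *)
Lemma lebesgueRn_box_ge ab : ((box_volume ab)%:E <= lebesgueRn (box ab))%E.
Proof.
apply: le_ereal_inf_tmp => _ [I abI <-].
pose s (y : 'rV[R]_n.+1) (i : nat) : R := y 0 (inord i).
have sE (y : 'rV[R]_n.+1) (i : 'I_n.+1) : s y i = y 0 i by rewrite /s inord_val.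
have boxE (ab' : 'rV[R]_n.+1 * 'rV[R]_n.+1) (x : nat -> R) :
    \prod_(i < n.+1) (s ab'.1 i < x i <= s ab'.2 i)%R%:R =
    (`[< box ab' (\row_i x i) >])%:R :> R.
  case: asboolP => [xab|xab].
    by rewrite big1// => i _; have := xab i; rewrite mxE !sE => ->.
  have [i xi] : exists i : 'I_n.+1, ~~ (ab'.1 0 i < x i <= ab'.2 0 i).
    apply/existsP; rewrite -negb_forall; apply/negP => /forallP xi; apply: xab => i.
    by rewrite mxE.
  by rewrite (bigD1 i)//= !sE (negbTE xi) mul0r.
have := @box_volume_induction n.+1 1 (fun=> 1) (s ab.1) (s ab.2)
  (fun k => s (I k).1) (fun k => s (I k).2) ler01 (fun=> ler01).
rewrite mul1r /box_volume => H.
have {H} := H _; under eq_bigr do rewrite !sE.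
under eq_eseriesr => k _ do (rewrite mul1r; under eq_bigr do rewrite !sE).
apply=> x; rewrite mul1r boxE.
under eq_eseriesr => k _ do rewrite mul1r boxE.
have s0 : (0 <= \sum_(0 <= k <oo) ((`[< box (I k) (\row_i x i) >])%:R : R)%:E)%E.
  by apply: nneseries_ge0 => k _ _; rewrite lee_fin ler0n.
case: asboolP => [/abI[k _ xk]|//].
apply: le_trans (nneseries_lim_ge k.+1 _).
rewrite big_nat_recr//= asboolT// leeDr// sume_ge0//.
by move=> j _ _; rewrite lee_fin ler0n.
Qed.

End lebesgueRn_box.

(** * Borel sets are Lebesgue measurable *)

Section lebesgueRn_borel.
Context (R : realType) (n : nat).
Implicit Types (x y z a b : 'rV[R]_n.+1).

Let set_coord x (i : 'I_n.+1) (v : R) : 'rV[R]_n.+1 :=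
  \row_j if j == i then v else x 0 j.

(** The hyperplane at height [c] in direction [i] splits the box. Clipping with [min] and [max]
    keeps the identity valid when it misses the box or the box is empty. *)
Let box_volume_cut a b i (c : R) :
  box_volume (a, set_coord b i (Num.min (b 0 i) c)) +
  box_volume (set_coord a i (Num.max (a 0 i) c), b) = box_volume (a, b).
Proof.
rewrite /box_volume/= (bigD1 i)//= [in X in _ + X](bigD1 i)//=.
rewrite [in RHS](bigD1 i)//= !mxE eqxx.
rewrite [in X in X + _](eq_bigr (fun j => Num.max 0 (b 0 j - a 0 j))); last first.
  by move=> j /negbTE ji; rewrite mxE ji.
rewrite [in X in _ + X](eq_bigr (fun j => Num.max 0 (b 0 j - a 0 j))); last first.
  by move=> j /negbTE ji; rewrite mxE ji.
rewrite -mulrDl; congr (_ * _); rewrite /Num.max /Num.min.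
case: (ltP (b 0 i) c) => ?; case: (ltP (a 0 i) c) => ?;
  by do 3?[case: ltP => ?]; lra.
Qed.

(** Every box of a cover is cut along the hyperplane: the lower pieces cover the part of [X] in the
    half-space, the upper pieces the rest, and the total volume is unchanged. *)
Lemma caratheodory_halfspace i (c : R) :
  (@lebesgueRn R n).-caratheodory [set y | y 0 i <= c].
Proof.
apply: le_caratheodory_measurable => X.
apply: le_ereal_inf_tmp => _ [I XI <-].
under eq_eseriesr => k _.
  rewrite (surjective_pairing (I k)) -(box_volume_cut _ _ i c) EFinD; over.
rewrite nneseriesD; try by move=> *; exact: box_volume_ge0.
apply: leeD; apply: ereal_inf_lbound.
- exists (fun k => ((I k).1, set_coord (I k).2 i (Num.min ((I k).2 0 i) c))) => //.
  move=> y [/XI[k _ Iy] yc]; exists k => // j; rewrite mxE.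
  by have := Iy j; case: eqP => [->/andP[-> ?]|//]; rewrite le_min yc andbT.
- exists (fun k => (set_coord (I k).1 i (Num.max ((I k).1 0 i) c), (I k).2)) => //.
  move=> y [/XI[k _ Iy] /negP]; rewrite -ltNge => yc; exists k => // j; rewrite mxE.
  by have := Iy j; case: eqP => [->/andP[? ->]|//]; rewrite gt_max yc !andbT.
Qed.

Lemma boxE a b : box (a, b) =
  \bigcap_(i in [set: 'I_n.+1])
    ([set y | y 0 i <= b 0 i] `\` [set y | y 0 i <= a 0 i]).
Proof.
apply/seteqP; split=> [y ab i _|y ab i].
  by have /andP[ay yb] := ab i; split=> //=; apply/negP; rewrite -ltNge.
by have [yb /negP] := ab i I; rewrite -ltNge => -> /=.
Qed.

Lemma lebesgue_measurable_box ab :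
  measurable (box ab : set (leb_type R n)).
Proof.
rewrite (surjective_pairing ab) boxE.
apply: fin_bigcap_measurable => [|i _]; first exact: finite_finset.
by apply: measurableD; exact: caratheodory_halfspace.
Qed.

Lemma borel_open (U : set 'rV[R]_n.+1) : open U -> measurable (U : set (borelRn R n)).
Proof. by move=> oU; exact: sub_sigma_algebra. Qed.

Lemma borel_closed (U : set 'rV[R]_n.+1) :
  closed U -> measurable (U : set (borelRn R n)).
Proof.
move=> cU; rewrite -(setCK U); apply: measurableC; apply: borel_open.
by rewrite openC.
Qed.

Lemma borel_measurable_coord i (D : set (borelRn R n)) :
  measurable_fun D (fun y : borelRn R n => (y : 'rV[R]_n.+1) 0 i).
Proof.
move=> mD; apply: (measurability _ (RGenOpens.measurableE R)) (mD).
move=> _ [_ [a [b ->] <-]]; apply: measurableI; first exact: mD.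
apply: borel_open.
by apply: open_comp; [move=> ? _; exact: coord_continuous|exact: interval_open].
Qed.

Lemma borel_measurable_box ab : measurable (box ab : set (borelRn R n)).
Proof.
rewrite (surjective_pairing ab) boxE.
apply: fin_bigcap_measurable => [|i _]; first exact: finite_finset.
have half (c : R) : measurable ([set y : borelRn R n | (y : 'rV[R]_n.+1) 0 i <= c]).
  have := borel_measurable_coord i measurableT (measurable_itv `]-oo, c]).
  by rewrite setTI; congr (measurable _).
exact: measurableD (half _) (half _).
Qed.

(** Every open set is a union of these half-open boxes with rational corners. Numbers that decode to
    nothing give the empty set. *)
Definition rational_box (k : nat) : set 'rV[R]_n.+1 :=
  if @unpickle ('rV[rat]_n.+1 * 'rV[rat]_n.+1)%type k is Some pq
  then box (map_mx ratr pq.1, map_mx ratr pq.2) else set0.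

Lemma rational_box_nbhs z (U : set 'rV[R]_n.+1) : nbhs z U ->
  exists k, rational_box k z /\ rational_box k `<=` U.
Proof.
move/nbhs_rVP => [e e0 zU].
have [p pP] : exists p : 'rV[rat]_n.+1,
    forall i, z 0 i - e < ratr (p 0 i) < z 0 i.
  have /choice[p pP] : forall i, exists q : rat, z 0 i - e < ratr q < z 0 i.
    move=> i; have [|q] := @rat_in_itvoo R (z 0 i - e) (z 0 i).
      by rewrite ltrBlDr ltrDl.
    by rewrite in_itv; exists q.
  by exists (\row_i p i) => i; rewrite mxE.
have [q qP] : exists q : 'rV[rat]_n.+1,
    forall i, z 0 i < ratr (q 0 i) < z 0 i + e.
  have /choice[q qP] : forall i, exists q : rat, z 0 i < ratr q < z 0 i + e.
    move=> i; have [|q] := @rat_in_itvoo R (z 0 i) (z 0 i + e).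
      by rewrite ltrDl.
    by rewrite in_itv; exists q.
  by exists (\row_i q i) => i; rewrite mxE.
exists (pickle (p, q)); rewrite /rational_box pickleK; split=> [i|y py].
  by rewrite !mxE; have /andP[_ ->] := pP i; have /andP[/ltW -> _] := qP i.
apply: zU; apply/rV_norm_ltP => i; rewrite !mxE.
have := py i; rewrite !mxE => /andP[py1 yq1].
have /andP[p1 _] := pP i; have /andP[_ q1] := qP i.
by rewrite ltr_norml; apply/andP; split; lra.
Qed.

Lemma borel_measurable_rational_box k :
  measurable (rational_box k : set (borelRn R n)).
Proof.
by rewrite /rational_box; case: unpickle => // pq; exact: borel_measurable_box.
Qed.

Lemma openE_rational_box (U : set 'rV[R]_n.+1) : open U ->
  U = \bigcup_(k in [set k | rational_box k `<=` U]) rational_box k.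
Proof.
move=> oU; apply/seteqP; split=> [z Uz|z [k /= kU kz]]; last exact: kU.
have [k [kz kU]] := rational_box_nbhs (open_nbhs_nbhs (conj oU Uz)).
by exists k.
Qed.

Lemma borel_lebesgue (E : set (borelRn R n)) :
  measurable E -> measurable (E : set (leb_type R n)).
Proof.
apply: (@smallest_sub _ _ _ (@measurable _ (leb_type R n))).
  exact: sigma_algebra_measurable.
move=> U oU; rewrite (openE_rational_box oU).
apply: bigcup_measurable => k _; rewrite /rational_box.
by case: unpickle => // pq; exact: lebesgue_measurable_box.
Qed.

Lemma lebesgueRn_box_le (ab : 'rV[R]_n.+1 * 'rV[R]_n.+1) :
  (lebesgueRn (box ab) <= (box_volume ab)%:E)%E.
Proof.
apply: ereal_inf_lbound; exists (fun k => if k == 0%N then ab else (0, 0)).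
  by move=> y yab; exists 0%N.
rewrite (nneseriesD1 (n := 0%N))//=; last by move=> *; exact: box_volume_ge0.
rewrite eseries0 ?adde0// => k _ /=; case: eqP => // _ _.
by rewrite /box_volume big_ord_recl/= subrr maxxx mul0r.
Qed.

Lemma lebesgueRn_bounded (A : set 'rV[R]_n.+1) :
  bounded_set A -> (lebesgueRn A < +oo)%E.
Proof.
move=> [M [_ /(_ (M + 1))]]; rewrite ltrDl ltr01 => /(_ isT) AM.
apply: (@le_lt_trans _ _ (lebesgueRn
    (box (const_mx (- (M + 1) - 1), const_mx (M + 1)) : set 'rV[R]_n.+1))).
  apply: le_lebesgueRn => y /AM yM i; rewrite !mxE.
  have := rV_norm_coord y i => /le_trans/(_ yM); rewrite ler_norml => /andP[yl ->].
  by rewrite andbT (lt_le_trans _ yl)// ltrBlDr ltrDl.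
by rewrite (le_lt_trans (lebesgueRn_box_le _))// ltry.
Qed.

Lemma lebesgueRn_open_gt0 (U : set 'rV[R]_n.+1) z : nbhs z U ->
  (0 < lebesgueRn U)%E.
Proof.
move/nbhs_rVP => [e e0 zU].
apply: (@lt_le_trans _ _ (lebesgueRn (box (z - const_mx (e / 2), z)))).
  apply: lt_le_trans (lebesgueRn_box_ge _).
  rewrite lte_fin /box_volume/= prodr_gt0// => i _.
  by rewrite !mxE lt_max opprB addrC subrK divr_gt0 ?orbT.
apply: le_lebesgueRn => y zy; apply: zU; apply/rV_norm_ltP => i; rewrite !mxE.
by have := zy i; rewrite /= !mxE => /andP[? ?]; rewrite ltr_norml; apply/andP; split; lra.
Qed.

End lebesgueRn_borel.

(** * Area inequalities *)

Section lipschitz_image.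
Context (R : realType).

(** Lets a slack tend to zero when the bound is a product of factors that depend on it. *)
Lemma lee_horner0 (X : \bar R) (p : {poly R}) :
  (forall t : R, 0 < t -> (X <= (p.[t])%:E)%E) -> (X <= (p.[0])%:E)%E.
Proof.
move=> Xp; apply/lee_addgt0Pr => e e0.
have /cvgrPdist_lt/(_ e e0)[d /= d0 dp] := @continuous_horner R p 0.
have d2 : 0 < d / 2 by rewrite divr_gt0.
apply: le_trans (Xp _ d2) _; rewrite -EFinD lee_fin.
have : `|p.[0] - p.[d / 2]| < e.
  by apply: dp; rewrite /ball_ /= sub0r normrN gtr0_norm// gtr_pMr// invf_lt1// ltr1n.
by rewrite ltr_norml => /andP[? ?]; lra.
Qed.

Lemma outer_measure_bigsetU (T : Type) (mu : {outer_measure set T -> \bar R})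
    (I : finType) (P : pred I) (F : I -> set T) :
  (mu (\big[setU/set0]_(i | P i) F i) <= \sum_(i | P i) mu (F i))%E.
Proof.
apply: (big_rec2 (fun A x => (mu A <= x)%E)) => [|i A x _ Ax].
  by rewrite outer_measure0.
by rewrite (le_trans (outer_measureU2 _ _ _))// leeD2l.
Qed.

Context (n : nat).
Implicit Types (S T : set 'rV[R]_n.+1) (h : 'rV[R]_n.+1 -> 'rV[R]_n.+1) (a b : 'rV[R]_n.+1).

Lemma lebesgueRn_diam T (r : 'I_n.+1 -> R) : (forall i, 0 < r i) ->
  (forall x y i, T x -> T y -> `|x 0 i - y 0 i| <= r i) ->
  (lebesgueRn T <= (\prod_i r i)%:E)%E.
Proof.
move=> r0 Tr; have [->|/set0P[x0 Tx0]] := eqVneq T set0.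
  by rewrite outer_measure0 lee_fin prodr_ge0// => i _; rewrite ltW.
pose m i := inf [set y 0 i | y in T].
have mP i y : T y -> m i <= y 0 i <= m i + r i.
  move=> Ty; apply/andP; split.
    apply: ge_inf; last by exists y.
    exists (y 0 i - r i) => _ [z Tz <-].
    by have := Tr _ _ i Ty Tz; rewrite ler_norml => /andP[_]; lra.
  rewrite -lerBlDr; apply: lb_le_inf; first by exists (y 0 i), y.
  by move=> _ [z Tz <-]; have := Tr _ _ i Ty Tz; rewrite ler_norml => /andP[_]; lra.
(* Boxes are open on the left, so the box is pushed out by [t] to contain the points whose
   coordinate equals the infimum; then [t] tends to 0. *)
suff : (lebesgueRn T <= ((\prod_i ((r i)%:P + 'X)).[0])%:E)%E.
  by rewrite horner_prod; under eq_bigr do rewrite hornerD hornerC hornerX addr0.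
apply: lee_horner0 => t t0.
apply: (@le_trans _ _ (lebesgueRn
    (box (\row_i (m i - t), \row_i (m i + r i)) : set 'rV[R]_n.+1))).
  apply: le_lebesgueRn => y Ty i; rewrite !mxE; have /andP[my ->] := mP i y Ty.
  by rewrite andbT (lt_le_trans _ my)// ltrBlDr ltrDl.
apply: le_trans (lebesgueRn_box_le _) _; rewrite lee_fin horner_prod.
apply: ler_prod => i _; rewrite le_max lexx/= !mxE hornerD hornerC hornerX.
by rewrite ge_max; have := r0 i; move=> ?; apply/andP; split; lra.
Qed.

(** A closed cell of the grid of mesh [s] based at [a]. The bound [M], common to all directions,
    makes the indices [f] a finite type. *)
Let cube (a : 'rV[R]_n.+1) (s : R) M (f : {ffun 'I_n.+1 -> 'I_M}) :
    set 'rV[R]_n.+1 :=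
  [set y | forall i, a 0 i + s * (f i)%:R <= y 0 i <= a 0 i + s * (f i).+1%:R].

(** At most [(b i - a i) / s + 1] cells are needed in direction [i], and the image of each has
    extent at most [K i * s] in coordinate [i]; the factors are the products of these two
    numbers. *)
Let lipschitz_box S h (K : 'I_n.+1 -> R) (s : R) a b :
  (forall i, 0 < K i) ->
  (forall x y i, S x -> S y -> `|h x 0 i - h y 0 i| <= K i * `|x - y|) ->
  0 < s -> (forall i, a 0 i < b 0 i) ->
  (lebesgueRn (h @` (S `&` box (a, b))) <=
   (\prod_i (K i * (b 0 i - a 0 i + s)))%:E)%E.
Proof.
move=> K0 hK s0 ab.
pose m i := (Num.truncn ((b 0 i - a 0 i) / s)).+1.
pose M := \max_i m i.
have mM i : (m i <= M)%N by exact: leq_bigmax.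
pose Q i := [pred k : 'I_M | (k < m i)%N].
apply: (@le_trans _ _ (lebesgueRn (\big[setU/set0]_(f in family Q)
    (h @` (S `&` cube a s f) : set 'rV[R]_n.+1)))).
  apply: le_lebesgueRn => _ [y [Sy aby] <-].
  pose k i := Num.truncn ((y 0 i - a 0 i) / s).
  have kP i : ((k i)%:R <= (y 0 i - a 0 i) / s < (k i).+1%:R).
    apply: truncn_itv; rewrite divr_ge0 ?(ltW s0)// subr_ge0.
    by have /andP[/ltW] := aby i.
  have km i : (k i < m i)%N.
    rewrite ltnS; apply: le_truncn; rewrite ler_pM2r ?invr_gt0//.
    by rewrite lerD2r; have /andP[] := aby i.
  pose f := [ffun i => Ordinal (leq_trans (km i) (mM i))].
  rewrite -bigcup_seq_cond/=; exists f.
    by rewrite /= mem_index_enum; apply/familyP => i; rewrite ffunE inE /=.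
  exists y => //; split=> // i; rewrite ffunE/=; have /andP[k1 /ltW k2] := kP i.
  rewrite -lerBrDl -[_ <= a 0 i + _]lerBlDl mulrC -ler_pdivlMr// k1.
  by rewrite mulrC -ler_pdivrMr.
apply: le_trans (outer_measure_bigsetU _ _ _) _.
apply: (@le_trans _ _ (\sum_(f in family Q) (\prod_i (K i * s))%:E)%E).
  apply: lee_sum => f _; apply: lebesgueRn_diam => [i|_ _ i [x [Sx fx] <-] [y [Sy fy] <-]].
    by rewrite mulr_gt0.
  apply: le_trans (hK _ _ _ Sx Sy) _; rewrite ler_pM2l//.
  apply/rV_norm_leP => j; rewrite !mxE ler_norml.
  have /andP[] := fx j; have /andP[] := fy j; rewrite -(addn1 (f j)) natrD mulrDr mulr1.
  by move=> *; apply/andP; split; lra.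
rewrite sumEFin lee_fin.
have -> : \sum_(f in family Q) \prod_i (K i * s) =
    \prod_i \sum_(k < M | (k < m i)%N) (K i * s).
  by rewrite (bigA_distr_big_dep (fun i (k : 'I_M) => (k < m i)%N) (fun i _ => K i * s)).
apply: ler_prod => i _; rewrite -(big_ord_widen M (fun=> K i * s) (mM i)).
rewrite sumr_const card_ord mulrn_wge0 ?mulr_ge0 ?(ltW (K0 i)) ?(ltW s0)//=.
rewrite -mulrnAr ler_pM2l// -mulr_natr /m -addn1 natrD mulrDr mulr1 lerD2r.
rewrite mulrC -ler_pdivlMr//.
have : 0 <= (b 0 i - a 0 i) / s by rewrite divr_ge0 ?(ltW s0)// subr_ge0 ltW.
by move=> /truncn_itv/andP[].
Qed.

(* Cutting a cover of [S] into small cubes makes the sup-norm Lipschitz bound,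
   which may differ from one coordinate to the next, sharp. *)
Lemma lebesgueRn_lipschitz S h (K : 'I_n.+1 -> R) : (forall i, 0 < K i) ->
  (forall x y i, S x -> S y -> `|h x 0 i - h y 0 i| <= K i * `|x - y|) ->
  (lebesgueRn (h @` S) <= (\prod_i K i)%:E * lebesgueRn S)%E.
Proof.
move=> K0 hK; have PK0 : 0 < \prod_i K i by rewrite prodr_gt0.
have hbox ab : (lebesgueRn (h @` (S `&` box ab)) <=
    (\prod_i K i)%:E * (box_volume ab)%:E)%E.
  case: ab => a b; have [/forallP ab|/forallPn[i]] := boolP [forall i, a 0 i < b 0 i].
    rewrite -EFinM -big_split/=.
    rewrite (eq_bigr (fun i => K i * (b 0 i - a 0 i))); last first.
      by move=> i _; rewrite max_r// subr_ge0 ltW.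
    suff : (lebesgueRn (h @` (S `&` box (a, b))) <=
        ((\prod_i ((K i)%:P * ((b 0 i - a 0 i)%:P + 'X))).[0])%:E)%E.
      rewrite horner_prod.
      by under eq_bigr do rewrite hornerM !hornerD !hornerC hornerX addr0.
    apply: lee_horner0 => s s0; rewrite horner_prod.
    under [in leRHS]eq_bigr do rewrite hornerM !hornerD !hornerC hornerX.
    exact: lipschitz_box.
  rewrite -leNgt => ba; rewrite (_ : S `&` _ = set0).
    by rewrite image_set0 outer_measure0 mule_ge0 ?box_volume_ge0// lee_fin ltW.
  apply/seteqP; split=> // y [_ /(_ i)/andP[/= ay /(lt_le_trans ay)]].
  by rewrite ltNge ba.
rewrite -lee_pdivrMl//; apply: le_ereal_inf_tmp => _ [I SI <-].
rewrite lee_pdivrMl// -nneseriesZl; last by move=> *; exact: box_volume_ge0.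
apply: (@le_trans _ _ (\sum_(k <oo) lebesgueRn (h @` (S `&` box (I k))))%E).
  apply: le_trans (outer_measure_sigma_subadditive _ _).
  apply: le_lebesgueRn => _ [y Sy <-]; have [k _ Iy] := SI y Sy.
  by exists k => //; exists y.
by apply: lee_nneseries => k _; rewrite ?outer_measure_ge0//; exact: hbox.
Qed.

End lipschitz_image.

(** * Determinants and the expansion of outer measure *)

Section near_linear_image.
Context (R : realType) (n : nat).
Implicit Types (S : set 'rV[R]_n.+1) (h : 'rV[R]_n.+1 -> 'rV[R]_n.+1).
Implicit Types (A B C M T : 'M[R]_n.+1).

(** Row vectors are used, so [A] acts on the right. Equivalently, [h] minus the linear map is
    [e]-Lipschitz on [S]. *)
Definition near_linear S h A (e : R) := forall x y, S x -> S y ->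
  `|h x - h y - (x - y) *m A| <= e * `|x - y|.

(** The set [S] is arbitrary: outer measure makes sense of its image without any measurability. *)
Definition expansion A (e c : R) := forall S h, near_linear S h A e ->
  (lebesgueRn (h @` S) <= c%:E * lebesgueRn S)%E.

Lemma near_linear_mulmx S A e : 0 <= e -> near_linear S (mulmxr A) A e.
Proof. by move=> e0 x y _ _; rewrite /= mulmxBl subrr normr0 mulr_ge0. Qed.

Lemma mulmx_bounded A :
  exists2 c : R, 0 < c & forall x : 'rV_n.+1, `|x *m A| <= c * `|x|.
Proof.
exists (1 + \sum_i \sum_j `|A i j|) => [|x].
  rewrite ltr_pwDl// sumr_ge0// => i _; rewrite sumr_ge0//.
apply/rV_norm_leP => j; rewrite mxE (le_trans (ler_norm_sum _ _ _))//.
rewrite mulrDl mul1r ler_wpDl// mulr_suml ler_sum// => i _.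
rewrite normrM mulrC ler_pM//; last exact: rV_norm_coord.
by rewrite (bigD1 j)//= lerDl sumr_ge0.
Qed.

Lemma horner_near0 (p : {poly R}) c : p.[0] < c -> exists2 t, 0 < t & p.[t] < c.
Proof.
move=> pc; have /cvgrPdist_lt/(_ (c - p.[0]))[|d /= d0 dp] := @continuous_horner R p 0.
  by rewrite subr_gt0.
exists (d / 2); first by rewrite divr_gt0.
have : `|p.[0] - p.[d / 2]| < c - p.[0].
  apply: dp; rewrite /ball_ /= sub0r normrN gtr0_norm ?divr_gt0//.
  by rewrite gtr_pMr// invf_lt1// ltr1n.
by rewrite ltr_norml => /andP[? ?]; lra.
Qed.

Lemma expansion_mulmx A e c S : 0 <= e -> expansion A e c ->
  (lebesgueRn (mulmxr A @` S) <= c%:E * lebesgueRn S)%E.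
Proof. by move=> e0; apply; exact: near_linear_mulmx. Qed.

(** Undoing [B] before [h] and [C] after it turns a map near [B *m M *m C] into one near [M]; the
    tolerance shrinks by the bounds [kB] and [kC] for the two inverses. *)
Lemma expansion_conj B C M e (b c m : R) : B \in unitmx -> C \in unitmx ->
  0 < e -> 0 <= c -> 0 <= m ->
  (forall S, lebesgueRn (mulmxr B @` S) <= b%:E * lebesgueRn S)%E ->
  (forall S, lebesgueRn (mulmxr C @` S) <= c%:E * lebesgueRn S)%E ->
  expansion M e m ->
  exists2 e', 0 < e' & expansion (B *m M *m C) e' (c * m * b).
Proof.
move=> Bu Cu e0 c0 m0 hB hC hM.
have [kB kB0 hkB] := mulmx_bounded (invmx B).
have [kC kC0 hkC] := mulmx_bounded (invmx C).
exists (e / kB / kC) => [|S h hS]; first by rewrite !divr_gt0.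
pose h' := fun y => h (y *m invmx B) *m invmx C.
have -> : h @` S = mulmxr C @` (h' @` (mulmxr B @` S)).
  apply/seteqP; split=> [_ [x Sx <-]|_ [_ [_ [x Sx <-] <-] <-]].
    exists (h x *m invmx C); last by rewrite /= mulmxKV.
    by exists (x *m B); [exists x|rewrite /h' mulmxK].
  by exists x => //; rewrite /h' /= mulmxKV// mulmxK.
apply: le_trans (hC _) _; rewrite -mulrA EFinM -muleA.
apply: lee_wpmul2l; first by rewrite lee_fin.
apply: le_trans (_ : _ <= m%:E * lebesgueRn (mulmxr B @` S))%E _; last first.
  by rewrite EFinM -muleA lee_wpmul2l// lee_fin.
apply: hM => _ _ [x Sx <-] [y Sy <-]; rewrite /h' /= !mulmxK//.
rewrite -mulmxBl -mulmxBl -[X in _ - X](mulmxK Cu) -mulmxBl.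
apply: le_trans (hkC _) _; rewrite -ler_pdivlMl//.
have := hS _ _ Sx Sy; rewrite !mulmxA => /le_trans; apply.
have xy : `|x - y| <= kB * `|(x - y) *m B| by rewrite -{1}[x - y](mulmxK Bu).
rewrite (_ : _ * `|x - y| = kC^-1 * (e * (kB^-1 * `|x - y|))); last by ring.
by rewrite !ler_pM2l ?invr_gt0// ler_pdivrMl.
Qed.

(** The strict bound on [c] leaves room for a tolerance, and includes singular matrices, for which
    any positive factor is reached. *)
Definition expansion_det A := forall c, `|\det A| < c ->
  exists2 e, 0 < e & expansion A e c.

(** The left factor is the one that gets inverted, so a singular matrix is treated by putting its
    singular factor last. *)
Lemma expansion_det_mul B M : B \in unitmx -> expansion_det B ->
  expansion_det M -> expansion_det (B *m M).
Proof.
move=> Bu hB hM c; rewrite det_mulmx normrM => BMc.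
pose p : {poly R} := (`|\det M|%:P + 'X) * (`|\det B|%:P + 'X).
have [|t t0 pt] := @horner_near0 p c.
  by rewrite hornerM !hornerD !hornerC !hornerX !addr0 mulrC.
have [|eB eB0 heB] := hB (`|\det B| + t); first by rewrite ltrDl.
have [|eM eM0 heM] := hM (`|\det M| + t); first by rewrite ltrDl.
have linB S : (lebesgueRn (mulmxr B @` S) <= (`|\det B| + t)%:E * lebesgueRn S)%E.
  exact: expansion_mulmx (ltW eB0) heB.
have lin1 S : (lebesgueRn (mulmxr 1%:M @` S) <= 1%:E * lebesgueRn S)%E.
  rewrite mul1e; apply: le_lebesgueRn => _ [x Sx <-] /=.
  by rewrite mulmx1.
have M0 : 0 <= `|\det M| + t by rewrite addr_ge0// ltW.
have [e e0 he] := expansion_conj Bu (unitmx1 _ _) eM0 ler01 M0 linB lin1 heM.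
exists e => // S h hS; have := he S h; rewrite mulmx1 mul1r => /(_ hS)/le_trans; apply.
apply: lee_wpmul2r; first exact: outer_measure_ge0.
rewrite lee_fin; move: pt; rewrite hornerM !hornerD !hornerC !hornerX.
exact: ltW.
Qed.

(** For the sup norm, coordinate [i] has its own Lipschitz constant [|d i| + e]; this is why
    [lebesgueRn_lipschitz] lets the constants differ. *)
Lemma expansion_diag (d : 'rV[R]_n.+1) e : 0 < e ->
  expansion (diag_mx d) e (\prod_i (`|d 0 i| + e)).
Proof.
move=> e0 S h hS; apply: lebesgueRn_lipschitz => [i|x y i Sx Sy].
  by rewrite ltr_wpDl.
have := hS _ _ Sx Sy => /rV_norm_leP/(_ i).
rewrite mul_mx_diag !mxE => he.
rewrite mulrDl -[h x 0 i - _](subrK ((x 0 i - y 0 i) * d 0 i)).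
rewrite addrC (le_trans (ler_normD _ _))// lerD//.
rewrite normrM mulrC ler_wpM2l//.
by have := rV_norm_coord (x - y) i; rewrite !mxE.
Qed.

Lemma expansion_near A A' e c : 0 <= e ->
  (forall x : 'rV_n.+1, `|x *m (A' - A)| <= e * `|x|) ->
  expansion A (e *+ 2) c -> expansion A' e c.
Proof.
move=> e0 AA' hA S h hS; apply: hA => x y Sx Sy.
rewrite -[h x - h y](subrK ((x - y) *m A')) -addrA -mulmxBr.
rewrite (le_trans (ler_normD _ _))// mulr2n mulrDl lerD//; exact: hS.
Qed.

(** Each coordinate of a permuted vector is a coordinate of the vector, hence 1-Lipschitz for the
    sup norm. *)
Lemma expansion_det_perm (s : {perm 'I_n.+1}) : expansion_det (perm_mx s).
Proof.
move=> c; rewrite det_perm normrX normrN1 expr1n => c1.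
have [|t t0 pt] := @horner_near0 ((1%:P + 'X) ^+ n.+1) c.
  by rewrite horner_exp hornerD hornerC hornerX addr0 expr1n.
exists t => // S h hS; apply: le_trans (_ : _ <= ((1 + t) ^+ n.+1)%:E * _)%E _; last first.
  apply: lee_wpmul2r; first exact: outer_measure_ge0.
  by move: pt; rewrite lee_fin horner_exp hornerD hornerC hornerX => /ltW.
rewrite (_ : (1 + t) ^+ n.+1 = \prod_(i < n.+1) (1 + t)); last first.
  by rewrite prodr_const card_ord.
apply: lebesgueRn_lipschitz => [i|x y i Sx Sy]; first by rewrite addr_gt0.
have := hS _ _ Sx Sy => /rV_norm_leP/(_ i); rewrite -[s]invgK -col_permE !mxE => he.
rewrite mulrDl mul1r -[h x 0 i - _](subrK (x 0 (s^-1%g i) - y 0 (s^-1%g i))).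
rewrite addrC (le_trans (ler_normD _ _))// lerD//.
by have := rV_norm_coord (x - y) (s^-1%g i); rewrite !mxE.
Qed.

(* Conjugating by [diag (t ^ w i)] with t small makes the off-diagonal part of
   [T] as small as desired without changing the determinant. *)
Lemma expansion_det_triangular T (w : 'I_n.+1 -> nat) :
  (forall i j, i != j -> T i j != 0 -> (w i < w j)%N) ->
  \det T = \prod_i T i i -> expansion_det T.
Proof.
move=> Tw detT c Tc.
pose d := \row_i T i i.
have [|e e0 pe] := @horner_near0 (\prod_i (`|T i i|%:P + 'X)) c.
  rewrite horner_prod; under eq_bigr do rewrite hornerD hornerC hornerX addr0.
  by rewrite -normr_prod -detT.
pose e2 := e / 2; have e20 : 0 < e2 by rewrite divr_gt0.
pose k := 1 + \sum_i \sum_j `|T i j|.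
have k0 : 0 < k.
  by rewrite ltr_pwDl// sumr_ge0// => i _; rewrite sumr_ge0.
(* Off the diagonal, conjugation multiplies [T i j] by [t ^ (w j - w i)], which is at most [t]
   because [t <= 1] and the exponent is positive; [t * k <= e2] bounds the total. *)
pose t := Num.min 1 (e2 / k).
have t0 : 0 < t by rewrite lt_min ltr01 divr_gt0.
have tu : t \is a GRing.unit by rewrite unitfE gt_eqF.
pose D := diag_mx (\row_i t ^+ w i) : 'M[R]_n.+1.
pose D' := diag_mx (\row_i t ^- w i) : 'M[R]_n.+1.
have D'D : D' *m D = 1%:M.
  rewrite mulmx_diag; apply/matrixP => i j; rewrite !mxE; congr (_ *+ _).
  by rewrite mulVr// unitrX.
have [D'u Du] := mulmx1_unit D'D.
have DD' : D *m D' = 1%:M by apply: mulmx1C.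
pose T' := D' *m T *m D.
have TE : T = D *m T' *m D'.
  by rewrite /T' !mulmxA DD' mul1mx -mulmxA DD' mulmx1.
have T'd (x : 'rV_n.+1) : `|x *m (T' - diag_mx d)| <= e2 * `|x|.
  apply/rV_norm_leP => j; rewrite mxE (le_trans (ler_norm_sum _ _ _))//.
  apply: (@le_trans _ _ (\sum_i `|x| * (t * `|T i j|))).
    apply: ler_sum => i _; rewrite normrM ler_pM ?rV_norm_coord//.
    have T'E : T' i j = t ^- w i * T i j * t ^+ w j.
      by rewrite /T' /D mul_mx_diag mxE /D' mul_diag_mx !mxE.
    rewrite mxE T'E [(- diag_mx d) i j]mxE [diag_mx d i j]mxE [d _ _]mxE.
    have [ij|ij] := eqVneq i j.
      rewrite -ij mulrAC mulVr ?unitrX// mul1r mulr1n subrr normr0.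
      by rewrite mulr_ge0// ltW.
    rewrite mulr0n subr0 mulrAC normrM.
    have [->|Tij] := eqVneq (T i j) 0; first by rewrite normr0 !mulr0.
    rewrite ler_wpM2r// ger0_norm ?mulr_ge0 ?invr_ge0 ?exprn_ge0 ?(ltW t0)//.
    rewrite mulrC -expfB ?Tw// -[leRHS]expr1 ler_wiXn2l ?(ltW t0) ?ge_min ?lexx//.
    by rewrite subn_gt0 Tw.
  rewrite -mulr_sumr -mulr_sumr mulrC ler_wpM2r//.
  apply: (@le_trans _ _ (t * k)).
    rewrite ler_pM2l// ler_wpDl// ler_sum// => i _.
    by rewrite (bigD1 j)//= lerDl sumr_ge0.
  by rewrite -ler_pdivlMr// ge_min lexx orbT.
have hT' : expansion T' e2 (\prod_i (`|T i i| + e)).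
  apply: expansion_near (ltW e20) T'd _.
  rewrite (_ : e2 *+ 2 = e); last by rewrite -mulr_natr divfK.
  have := @expansion_diag d e e0; under eq_bigr do rewrite mxE.
  by [].
have lin (v : 'rV[R]_n.+1) S : (forall i, v 0 i != 0) ->
    (lebesgueRn (mulmxr (diag_mx v) @` S) <= (\prod_i `|v 0 i|)%:E * lebesgueRn S)%E.
  move=> v0; apply: lebesgueRn_lipschitz => [i|x y i _ _].
    by rewrite normr_gt0.
  rewrite /= !mul_mx_diag !mxE -mulrBl normrM mulrC ler_wpM2l//.
  by have := rV_norm_coord (x - y) i; rewrite !mxE.
have linD S : (lebesgueRn (mulmxr D @` S) <=
    (\prod_i `|(\row_i t ^+ w i) 0 i|)%:E * lebesgueRn S)%E.
  by apply: lin => i; rewrite mxE -unitfE unitrX.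
have linD' S : (lebesgueRn (mulmxr D' @` S) <=
    (\prod_i `|(\row_i t ^- w i) 0 i|)%:E * lebesgueRn S)%E.
  by apply: lin => i; rewrite mxE -unitfE unitrV unitrX.
have p0 : 0 <= \prod_i (`|T i i| + e).
  by rewrite prodr_ge0// => i _; rewrite addr_ge0// ltW.
have d0 : 0 <= \prod_i `|(\row_i t ^- w i) 0 i : R| by exact: prodr_ge0.
have [e' e'0 he'] := expansion_conj Du D'u e20 d0 p0 linD linD' hT'.
exists e' => // S h; rewrite TE => /he'/le_trans; apply.
apply: lee_wpmul2r; first exact: outer_measure_ge0.
rewrite lee_fin mulrAC -big_split/= big1 ?mul1r => [|i _]; last first.
  by rewrite !mxE -normrM mulVr ?normr1// unitrX.
move: pe; rewrite horner_prod => /ltW; apply: le_trans.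
by under [leRHS]eq_bigr do rewrite hornerD hornerC hornerX.
Qed.

(** LUP decomposition: the permutation and [L] are invertible, so only the last factor [U] can be
    singular. The weights [n - i] for [L] and [i] for [U] increase from row to column at every
    nonzero off-diagonal entry. *)
Lemma expansion_detP A : expansion_det A.
Proof.
have := cormen_lup_correct A; have := cormen_lup_perm A.
have := cormen_lup_lower A; have := cormen_lup_upper A; have := cormen_lup_detL A.
case: (cormen_lup A) => [[P L] U] /= detL upU lowL /is_perm_mxP[s ->] PA.
have -> : A = perm_mx s^-1 *m (L *m U).
  by rewrite -[L *m U]PA mulmxA -perm_mxM mulVg perm_mx1 mul1mx.
apply: expansion_det_mul; [exact: unitmx_perm|exact: expansion_det_perm|].
apply: expansion_det_mul; first by rewrite unitmxE detL unitr1.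
  apply: (@expansion_det_triangular L (fun i => n - i)%N) => [i j ij Lij|].
    have ltji : (j < i)%N.
      rewrite ltnNge; apply: contra Lij => leij.
      by rewrite lowL// (negbTE ij).
    by rewrite ltn_sub2l// (leq_trans ltji)// -ltnS.
  rewrite detL big1// => i _; by rewrite lowL// eqxx.
apply: (@expansion_det_triangular U (fun i => i)) => [i j ij Uij|].
  rewrite ltn_neqAle ij/= leqNgt; apply: contra Uij => ?; exact/eqP/upU.
rewrite -det_tr det_trig; last by apply/is_trig_mxP => i j ij; rewrite mxE upU.
by apply: eq_bigr => i _; rewrite mxE.
Qed.

End near_linear_image.

(** * Area inequalities for nonlinear maps *)

Section area.
Context (R : realType) (n : nat).
Implicit Types (S E D : set 'rV[R]_n.+1) (G : 'rV[R]_n.+1 -> 'rV[R]_n.+1).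
Implicit Types (f : 'rV[R]_n.+1 -> R).

Definition leb_measure : {measure set (leb_type R n) -> \bar R} :=
  ((@lebesgueRn R n : {outer_measure set 'rV[R]_n.+1 -> \bar R}) :
   set (caratheodory_type (@lebesgueRn R n : {outer_measure set 'rV[R]_n.+1 -> \bar R})) -> \bar R).
Local Notation leb := leb_measure.

Lemma integral_leb_cst (D : set (leb_type R n)) (c : R) : measurable D ->
  (\int[leb]_(y in D) c%:E = c%:E * lebesgueRn D)%E.
Proof. by move=> mD; exact: (@integral_cst _ _ _ leb D mD c%:E). Qed.

Lemma cst_le_integral_leb (D : set (leb_type R n)) c f : measurable D -> 0 <= c ->
  measurable_fun D (fun y : leb_type R n => (f y)%:E) -> (forall y, D y -> c <= f y) ->
  (c%:E * lebesgueRn D <= \int[leb]_(y in D) (f y)%:E)%E.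
Proof.
move=> mD c0 mf cf; rewrite -integral_leb_cst//.
apply: (@ge0_le_integral _ _ _ leb _ mD) mf _ => [y _||y Dy]; rewrite ?lee_fin//.
exact: cf.
Qed.

Lemma integral_leb_le_cst (D : set (leb_type R n)) c f : measurable D ->
  measurable_fun D (fun y : leb_type R n => (f y)%:E) ->
  (forall y, D y -> 0 <= f y <= c) ->
  (\int[leb]_(y in D) (f y)%:E <= c%:E * lebesgueRn D)%E.
Proof.
move=> mD mf fc; rewrite -integral_leb_cst//.
apply: (@ge0_le_integral _ _ _ leb _ mD) mf _ _ => [y /fc/andP[]||y /fc/andP[]].
- by rewrite lee_fin.
- exact: measurable_cst.
- by rewrite lee_fin.
Qed.

(** Strict differentiability: both points vary, so [G] is near linear on a whole small ball. *)
Definition strict_diff G (A : 'M[R]_n.+1) z := forall e, 0 < e ->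
  exists2 r : R, 0 < r & near_linear [set x | `|z - x| < r] G A e.

Lemma near_linearS S S' G A (e : R) : S `<=` S' ->
  near_linear S' G A e -> near_linear S G A e.
Proof. by move=> SS' h x y /SS' Sx /SS' Sy; exact: h. Qed.

Lemma borel_lebesgue_fun (D : set (borelRn R n)) f :
  measurable D -> measurable_fun D (f : borelRn R n -> R) ->
  measurable_fun (D : set (leb_type R n)) (f : leb_type R n -> R).
Proof. by move=> mD mf _ Y mY; apply: borel_lebesgue; exact: mf. Qed.

Lemma lee_mul1Dt (X Y : \bar R) : (0 <= Y)%E ->
  (forall t : R, 0 < t -> (X <= (1 + t)%:E * Y)%E) -> (X <= Y)%E.
Proof.
case: Y => [y| |]//; rewrite ?leey// => y0 H.
have := @lee_horner0 R X ((1%:P + 'X) * y%:P); rewrite hornerM hornerD !hornerC.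
rewrite hornerX addr0 mul1r; apply => t t0.
by rewrite hornerM hornerD !hornerC hornerX EFinM; exact: H.
Qed.

Lemma nbhs_rV_ball (z : 'rV[R]_n.+1) (r : R) : 0 < r ->
  nbhs z [set x | `|z - x| < r].
Proof. by move=> r0; apply/nbhs_rVP; exists r. Qed.

(* Passing from local to global estimates through a countable base. *)
Lemma rational_partition (P : set 'rV[R]_n.+1 -> Prop) S :
  (forall U V, V `<=` U -> P U -> P V) ->
  (forall z, S z -> exists2 U, nbhs z U & P U) ->
  exists F : nat -> set (borelRn R n),
    [/\ forall k, measurable (F k), trivIset setT F,
        S `<=` \bigcup_k F k & forall k, P (F k) \/ F k = set0].
Proof.
move=> PS SP.
pose B k : set (borelRn R n) := if `[< P (@rational_box R n k) >] then @rational_box R n k else set0.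
exists (seqDU B); split.
- apply: seqDU_measurable => k; rewrite /B; case: ifP => // _.
  exact: borel_measurable_rational_box.
- exact: trivIset_seqDU.
- move=> z /SP[U zU PU]; rewrite -seqDU_bigcup_eq.
  have [k [kz kU]] := rational_box_nbhs zU; exists k => //.
  by rewrite /B asboolT//; exact: PS PU.
- move=> k; have := @subset_seqDU _ B k; rewrite /B; case: asboolP => Pk sub.
    by left; exact: PS Pk.
  by right; apply/seteqP; split.
Qed.

Lemma continuous_near_lt f z (a b : R) : {for z, continuous f} -> a < f z < b ->
  exists2 U, nbhs z U & forall y, U y -> a < f y < b.
Proof.
move=> fz /andP[az zb]; exists (f @^-1` `]a, b[%classic).
  by apply: fz; apply: open_nbhs_nbhs; split; [exact: interval_open|rewrite /= in_itv/= az].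
by move=> y; rewrite /= in_itv.
Qed.

(** Near [z] outer measure expands by at most [f z * (1 + t / 2)], which continuity of [f] compares
    with [(1 + t) * f]; positivity of [f] gives the strict gap above [|\det (A z)|]. Countable
    subadditivity adds up the pieces, whatever the overlaps of their images. *)
Lemma area_upper S (D : set (borelRn R n)) G (A : 'rV[R]_n.+1 -> 'M[R]_n.+1) f :
  measurable D -> S `<=` D -> measurable_fun D f ->
  (forall z, D z -> 0 <= f z) ->
  (forall z, S z -> [/\ strict_diff G (A z) z, {for z, continuous f},
    0 < f z & `|\det (A z)| <= f z]) ->
  (lebesgueRn (G @` S) <= \int[leb]_(y in D) (f y)%:E)%E.
Proof.
move=> mD SD mf f0 Sf.
have mDl : measurable (D : set (leb_type R n)) by exact: borel_lebesgue.
have mfl : measurable_fun (D : set (leb_type R n)) (fun y => (f y)%:E).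
  by apply/measurable_EFinP; exact: borel_lebesgue_fun.
apply: lee_mul1Dt => [|t t0]; first by apply: integral_ge0 => y Dy; rewrite lee_fin f0.
pose P U := forall S' (E : set (borelRn R n)), measurable E ->
  S' `<=` S `&` E -> E `<=` D `&` U ->
  (lebesgueRn (G @` S') <= (1 + t)%:E * \int[leb]_(y in E) (f y)%:E)%E.
have [U V VU PU S' E mE S'E EDV|z Sz|F [mF tF SF PF]] := @rational_partition P S.
- by apply: PU => //; apply: subset_trans EDV _; exact: setIS.
- have [Gz fz fz0 detA] := Sf z Sz.
  pose c := f z * (1 + t / 2).
  have [|e e0 he] := @expansion_detP _ _ (A z) c.
    by rewrite (le_lt_trans detA)// ltr_pMr// ltrDl divr_gt0.
  have [r r0 hr] := Gz e e0.
  have t10 : 0 < 1 + t by rewrite addr_gt0.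
  have [|U zU fU] := @continuous_near_lt f z (c / (1 + t)) (f z + 1) fz.
    by rewrite ltrDl ltr01 andbT ltr_pdivrMr// ltr_pM2l// ltrD2l gtr_pMr// invf_lt1// ltr1n.
  exists (U `&` [set x | `|z - x| < r]); first exact: filterI zU (nbhs_rV_ball z r0).
  move=> S' E mE S'E EDU.
  have mEl : measurable (E : set (leb_type R n)) by exact: borel_lebesgue.
  have ED : E `<=` D by move=> y /EDU[].
  apply: le_trans (he S' G _) _.
    by apply: near_linearS hr => y /S'E[_ /EDU[_ []]].
  apply: (@le_trans _ _ (c%:E * lebesgueRn E)%E).
    apply: lee_wpmul2l; first by rewrite lee_fin mulr_ge0 ?(ltW fz0)// addr_ge0// divr_ge0 ?(ltW t0).
    by apply: le_lebesgueRn => y /S'E[].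
  rewrite (_ : c = (1 + t) * (c / (1 + t))); last by rewrite mulrC divfK// gt_eqF.
  rewrite EFinM -muleA lee_wpmul2l// ?lee_fin ?(ltW t10)//.
  apply: (cst_le_integral_leb mEl) => [||y /EDU[_ [/fU/andP[/ltW + _] _]]].
  + rewrite divr_ge0 ?(ltW t10)// /c mulr_ge0 ?(ltW fz0)//.
    by rewrite addr_ge0// divr_ge0 ?(ltW t0).
  + exact: measurable_funS mDl ED mfl.
  + exact.
apply: (@le_trans _ _ (\sum_(k <oo) lebesgueRn (G @` (S `&` F k)))%E).
  apply: le_trans (outer_measure_sigma_subadditive _ _).
  apply: le_lebesgueRn => _ [y Sy <-]; have [k _ Fy] := SF y Sy.
  by exists k => //; exists y.
have mDF k : measurable (D `&` F k : set (leb_type R n)).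
  by apply: borel_lebesgue; exact: measurableI.
have DFD : \bigcup_k (D `&` F k) `<=` D by move=> y [k _ []].
apply: (@le_trans _ _ (\sum_(k <oo) ((1 + t)%:E * \int[leb]_(y in D `&` F k) (f y)%:E))%E).
  apply: lee_nneseries => [k _ _|k _]; first exact: outer_measure_ge0.
  have [PFk|Fk0] := PF k.
    apply: PFk => //; first exact: measurableI.
    by move=> y [Sy Fy]; split=> //; split=> //; exact: SD.
  rewrite Fk0 !setI0 image_set0 outer_measure0 integral_set0 mule0//.
rewrite nneseriesZl; last by move=> k _; apply: integral_ge0 => y [Dy _]; rewrite lee_fin f0.
apply: lee_wpmul2l; first by rewrite lee_fin addr_ge0// ltW.
have mU : measurable (\bigcup_k (D `&` F k) : set (leb_type R n)) by exact: bigcup_measurable.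
have mfU := measurable_funS mDl DFD mfl.
rewrite -(@ge0_integral_bigcup _ _ _ leb _ _ mDF mfU); last 2 first.
- by move=> y /DFD Dy; rewrite lee_fin f0.
- exact: trivIset_setIl.
apply: (@ge0_subset_integral _ _ _ leb _ _ mU mDl _ mfl) DFD.
by move=> y Dy; rewrite lee_fin f0.
Qed.

(** The expansion estimate is applied to the local inverse of [G], whose matrix is [invmx (A z)].
    Injectivity makes the images of the pieces disjoint, and their measurability makes the measures
    add up. *)
Lemma area_lower (E : set (borelRn R n)) G (A : 'rV[R]_n.+1 -> 'M[R]_n.+1) f :
  measurable E -> measurable_fun E f ->
  (forall x y, E x -> E y -> G x = G y -> x = y) ->
  (forall E' : set (borelRn R n), measurable E' -> E' `<=` E ->
    measurable (G @` E' : set (leb_type R n))) ->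
  (forall z, E z -> [/\ strict_diff G (A z) z, {for z, continuous f},
    0 < f z & f z <= `|\det (A z)|]) ->
  (\int[leb]_(y in E) (f y)%:E <= lebesgueRn (G @` E))%E.
Proof.
move=> mE mf Ginj mG Ef.
have f0 z : E z -> 0 <= f z by move=> /Ef[_ _ /ltW].
have mEl : measurable (E : set (leb_type R n)) by exact: borel_lebesgue.
have mfl : measurable_fun (E : set (leb_type R n)) (fun y => (f y)%:E).
  by apply/measurable_EFinP; exact: borel_lebesgue_fun.
apply: lee_mul1Dt => [|t t0]; first exact: outer_measure_ge0.
pose P U := forall E' : set (borelRn R n), measurable E' -> E' `<=` E `&` U ->
  (\int[leb]_(y in E') (f y)%:E <= (1 + t)%:E * lebesgueRn (G @` E'))%E.
have [U V VU PU E' mE' E'EV|z Ez|F [mF tF EF PF]] := @rational_partition P E.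
- by apply: PU => //; apply: subset_trans E'EV _; exact: setIS.
- have [Gz fz fz0 detA] := Ef z Ez.
  (* Two factors [1 + s] are lost, one to [f] and one to the determinant; for [s <= 1] their product
     is at most [1 + 3 * s]. *)
  pose s := Num.min 1 (t / 3).
  have s0 : 0 < s by rewrite lt_min ltr01 divr_gt0.
  have s2 : (1 + s) * (1 + s) <= 1 + t.
    have s1 : s <= 1 by rewrite ge_min lexx.
    have st : s <= t / 3 by rewrite ge_min lexx orbT.
    have := ler_wpM2l (ltW s0) s1; lra.
  have detA0 : 0 < `|\det (A z)| by exact: lt_le_trans fz0 detA.
  have Au : A z \in unitmx by rewrite unitmxE unitfE -normr_gt0.
  pose B := invmx (A z); pose c := (1 + s) / `|\det (A z)|.
  have [|eB eB0 heB] := @expansion_detP _ _ B c.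
    by rewrite /B det_inv normfV /c ltr_pMl ?invr_gt0// ltrDl.
  have [kB kB0 hkB] := mulmx_bounded B.
  (* The first bound ensures [|x - y| <= 2 * kB * |G x - G y|]; the second then turns the error of
     [G] into an error at most [eB] for the inverse. *)
  pose e := Num.min (2^-1 / kB) (eB / 2 / kB / kB).
  have e0 : 0 < e by rewrite lt_min !divr_gt0.
  have ekB : e * kB <= 2^-1 by rewrite -ler_pdivlMr// ge_min lexx.
  have eeB : e * kB * kB * 2 <= eB.
    by rewrite -!ler_pdivlMr// ge_min; apply/orP; right; lra.
  have [r r0 hr] := Gz e e0.
  have [|U zU fU] := @continuous_near_lt f z (f z - 1) (f z * (1 + s)) fz.
    by rewrite ltr_pMr// ltrDl s0 andbT ltrBlDr ltrDl.
  exists (U `&` [set x | `|z - x| < r]); first exact: filterI zU (nbhs_rV_ball z r0).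
  move=> E' mE' E'EU.
  have mE'l : measurable (E' : set (leb_type R n)) by exact: borel_lebesgue.
  have E'E : E' `<=` E by move=> y /E'EU[].
  (* The inverse of [G] on the image of [E'], with default value 0 elsewhere. *)
  pose g y := xget 0 [set x | E' x /\ G x = y].
  have gG x : E' x -> g (G x) = x.
    move=> E'x; rewrite /g; case: xgetP => [x' _ [E'x' Gx'x]|/(_ x)[]//].
    by apply: Ginj => //; exact: E'E.
  have gL : near_linear (G @` E') g B eB.
    move=> _ _ [x E'x <-] [y E'y <-]; rewrite !gG//.
    have Bxy : x - y - (G x - G y) *m B = - ((G x - G y - (x - y) *m A z) *m B).
      by rewrite [in RHS]mulmxBl mulmxK// opprB.
    have xyr : `|G x - G y - (x - y) *m A z| <= e * `|x - y|.
      by apply: hr; [have [_ []] := E'EU x E'x|have [_ []] := E'EU y E'y].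
    have dxy : `|x - y - (G x - G y) *m B| <= e * kB * `|x - y|.
      rewrite Bxy normrN (le_trans (hkB _))// [e * _]mulrC -mulrA.
      by rewrite ler_pM2l.
    have xyG : `|x - y| <= 2 * (kB * `|G x - G y|).
      have := ler_normD (x - y - (G x - G y) *m B) ((G x - G y) *m B).
      rewrite subrK => xy.
      have := ler_wpM2r (normr_ge0 (x - y)) ekB.
      have := hkB (G x - G y); lra.
    apply: (le_trans dxy); apply: (@le_trans _ _ (e * kB * (2 * (kB * `|G x - G y|)))).
      by rewrite ler_wpM2l// mulr_ge0 ?ltW.
    by have := ler_wpM2r (normr_ge0 (G x - G y)) eeB; lra.
  have gGE : g @` (G @` E') = E'.
    apply/seteqP; split=> [_ [_ [x E'x <-] <-]|x E'x]; first by rewrite gG.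
    by exists (G x); [exists x|rewrite gG].
  have := heB _ _ gL; rewrite gGE => E'G.
  apply: (@le_trans _ _ ((f z * (1 + s))%:E * lebesgueRn E')%E).
    apply: (integral_leb_le_cst mE'l) => [|y E'y].
      exact: measurable_funS mEl E'E mfl.
    have [Ey [/fU/andP[_ /ltW yf] _]] := E'EU y E'y.
    by rewrite yf andbT; exact: f0.
  have fs0 : 0 <= f z * (1 + s) by rewrite mulr_ge0 ?(ltW fz0)// addr_ge0// ltW.
  apply: le_trans (lee_wpmul2l _ E'G) _; first by rewrite lee_fin.
  rewrite muleA -EFinM; apply: lee_wpmul2r; first exact: outer_measure_ge0.
  rewrite lee_fin /c (le_trans _ s2)//.
  rewrite [leLHS](_ : _ = (1 + s) * (1 + s) * (f z / `|\det (A z)|)); last by ring.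
  rewrite ler_piMr ?mulr_ge0 ?addr_ge0 ?(ltW s0)//.
  by rewrite ler_pdivrMr// mul1r.
have EU : E = \bigcup_k (E `&` F k).
  by rewrite -setI_bigcupr; apply/seteqP; split=> [y Ey|y []//]; split=> //; exact: EF.
have mEF k : measurable (E `&` F k : set (borelRn R n)) by exact: measurableI.
have mEFl k : measurable (E `&` F k : set (leb_type R n)) by exact: borel_lebesgue.
have tEF : trivIset setT (fun k => E `&` F k) by exact: trivIset_setIl.
have mfU : measurable_fun (\bigcup_k (E `&` F k) : set (leb_type R n)) (fun y => (f y)%:E).
  by rewrite -EU.
rewrite [in X in (X <= _)%E]EU (@ge0_integral_bigcup _ _ _ leb _ _ mEFl mfU _ tEF); last first.
  by move=> y; rewrite -EU => Ey; rewrite lee_fin f0.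
apply: (@le_trans _ _ (\sum_(k <oo) ((1 + t)%:E * lebesgueRn (G @` (E `&` F k))))%E).
  apply: lee_nneseries => [k _ _|k _].
    by apply: integral_ge0 => y [Ey _]; rewrite lee_fin f0.
  have [PFk|Fk0] := PF k; first by apply: PFk.
  by rewrite Fk0 !setI0 image_set0 outer_measure0 integral_set0 mule0.
rewrite nneseriesZl; last by move=> k _; exact: outer_measure_ge0.
apply: lee_wpmul2l; first by rewrite lee_fin addr_ge0// ltW.
rewrite [in leRHS]EU image_bigcup.
have -> : (\sum_(k <oo) lebesgueRn (G @` (E `&` F k)))%E =
    leb (\bigcup_k (G @` (E `&` F k))).
  rewrite (@measure_bigcup _ _ _ leb).
  - by apply: eq_eseriesl => k; rewrite in_setT.
  - by move=> k _; apply: mG => // y [].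
  - apply/trivIsetP => i j _ _ ij; apply/seteqP; split=> // _ [[x [Ex Fx] <-] [y [Ey Fy]]].
    move=> /(Ginj _ _ Ey Ex) yx; have /trivIsetP/(_ i j I I ij) := tF.
    by move=> /seteqP[/(_ x) + _]; apply; split=> //; rewrite -yx.
exact: lexx.
Qed.

End area.

(** * Second-order calculus *)

Section dot.
Context (R : realType) (n : nat).
Implicit Types (a b c : 'rV[R]_n.+1).

Lemma dotE a b : dot a b = (a *m b^T) 0 0.
Proof. by rewrite mxE; apply: eq_bigr => i _; rewrite mxE. Qed.

Lemma dotDr a b c : dot a (b + c) = dot a b + dot a c.
Proof. by rewrite !dotE linearD/= mulmxDr mxE. Qed.

Lemma dotDl a b c : dot (a + b) c = dot a c + dot b c.
Proof. by rewrite !dotE mulmxDl mxE. Qed.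

Lemma dotZr m a b : dot a (m *: b) = m * dot a b.
Proof. by rewrite !dotE linearZ/= -scalemxAr mxE. Qed.

Lemma dotZl m a b : dot (m *: a) b = m * dot a b.
Proof. by rewrite !dotE -scalemxAl mxE. Qed.

Lemma dotBr a b c : dot a (b - c) = dot a b - dot a c.
Proof. by rewrite dotDr -scaleN1r dotZr mulN1r. Qed.

Lemma dot0r a : dot a 0 = 0.
Proof. by rewrite dotE trmx0 mulmx0 mxE. Qed.

Lemma dot0l a : dot 0 a = 0.
Proof. by rewrite dotE mul0mx mxE. Qed.

End dot.

Section second_order_calculus.
Context (R : realType) (n : nat).
Implicit Types (psi u h : 'rV[R]_n.+1 -> R) (v x y z q : 'rV[R]_n.+1).
Implicit Types (Omega : set 'rV[R]_n.+1).

Lemma derive_quotient_line psi q v (t : R) :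
  (fun s : R => s^-1 *: (((fun t => psi (q + t *: v)) \o shift t) (s *: (1 : R)) -
     psi (q + t *: v))) =
  (fun s : R => s^-1 *: ((psi \o shift (q + t *: v)) (s *: v) - psi (q + t *: v))).
Proof.
apply/funext => s; congr (_ *: (psi _ - _)).
by rewrite /= -[s *: 1]/(s * 1) mulr1 scalerDl addrCA.
Qed.

Lemma is_derive_line psi q v (t : R) : derivable psi (q + t *: v) v ->
  is_derive t 1 (fun t => psi (q + t *: v)) ('D_v psi (q + t *: v)).
Proof.
move=> dpsi; split; first by rewrite /derivable derive_quotient_line.
by rewrite /derive derive_quotient_line.
Qed.

(** The parameter [s] in [[0, 1]] treats both signs of [d] at once. *)
Lemma MVT_neq (phi dphi : R -> R) (d : R) : d != 0 ->
  (forall s, 0 <= s <= 1 -> is_derive (s * d) 1 phi (dphi (s * d))) ->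
  exists2 s, 0 < s < 1 & phi d - phi 0 = dphi (s * d) * d.
Proof.
move=> d0 dP.
have dP' (a b : R) : (forall x : R, x \in `[a, b] -> 0 <= x / d <= 1) ->
    (forall x : R, x \in `[a, b] -> is_derive x 1 phi (dphi x)).
  by move=> ab x /ab xd; have := dP _ xd; rewrite divfK.
have cP (a b : R) : (forall x : R, x \in `[a, b] -> is_derive x 1 phi (dphi x)) ->
    {within `[a, b], continuous phi}.
  by move=> H; apply: derivable_within_continuous => x /H[].
have oc (a b x : R) : x \in `]a, b[ -> x \in `[a, b].
  by rewrite !in_itv/= => /andP[/ltW -> /ltW ->].
have [d_gt0|d_lt0|/eqP] := ltgtP d 0; last by rewrite (negbTE d0).
- have H : forall x : R, x \in `[d, 0] -> is_derive x 1 phi (dphi x).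
    apply: dP' => x; rewrite in_itv/= => /andP[dx x0].
    by rewrite ler_ndivrMr// ler_ndivlMr// mul1r mul0r dx x0.
  have [c] := MVT d_gt0 (fun (x : R) xab => H x (oc _ _ _ xab)) (cP _ _ H).
  rewrite in_itv/= => /andP[dc c0] E; exists (c / d).
    by rewrite ltr_ndivrMr// ltr_ndivlMr// mul1r mul0r dc c0.
  by rewrite divfK// -[LHS]opprB E sub0r mulrN opprK.
- have H : forall x : R, x \in `[0, d] -> is_derive x 1 phi (dphi x).
    apply: dP' => x; rewrite in_itv/= => /andP[x0 dx].
    by rewrite ler_pdivrMr// ler_pdivlMr// mul1r mul0r dx x0.
  have [c] := MVT d_lt0 (fun (x : R) xab => H x (oc _ _ _ xab)) (cP _ _ H).
  rewrite in_itv/= => /andP[c0 dc] E; exists (c / d).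
    by rewrite ltr_pdivrMr// ltr_pdivlMr// mul1r mul0r dc c0.
  by rewrite divfK// E subr0.
Qed.

Lemma MVT_line psi q v (d : R) : d != 0 ->
  (forall s, 0 <= s <= 1 -> derivable psi (q + (s * d) *: v) v) ->
  exists2 s, 0 < s < 1 &
    psi (q + d *: v) - psi q = 'D_v psi (q + (s * d) *: v) * d.
Proof.
move=> d0 dP.
have [s s1 E] := @MVT_neq (fun t => psi (q + t *: v))
  (fun t => 'D_v psi (q + t *: v)) d d0 (fun s s1 => is_derive_line (dP s s1)).
by exists s => //; rewrite -E scale0r addr0.
Qed.

(** From [y] to [x] one coordinate at a time, with the mean value theorem on each segment; the
    intermediate points stay in the ball because the norm is the sup norm. *)
Lemma near_linear_scalar psi (a : 'I_n.+1 -> R) z (r e : R) :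
  (forall y i, `|z - y| < r -> derivable psi y (delta_mx 0 i)) ->
  (forall y i, `|z - y| < r -> `|'D_(delta_mx 0 i) psi y - a i| <= e) ->
  forall x y, `|z - x| < r -> `|z - y| < r ->
    `|psi x - psi y - \sum_i (x - y) 0 i * a i| <= n.+1%:R * e * `|x - y|.
Proof.
move=> dP aP x y zx zy.
pose p k : 'rV[R]_n.+1 := \row_j if (j < k)%N then x 0 j else y 0 j.
have p0 : p 0%N = y by apply/rowP => j; rewrite mxE.
have pn : p n.+1 = x by apply/rowP => j; rewrite mxE ltn_ord.
have xpsi : psi x - psi y = \sum_(k < n.+1) (psi (p k.+1) - psi (p k)).
  rewrite -(big_mkord xpredT (fun k => psi (p k.+1) - psi (p k))).
  by rewrite telescope_sumr// p0 pn.
have pS (k : 'I_n.+1) : p k.+1 = p k + (x - y) 0 k *: delta_mx 0 k.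
  apply/rowP => j; rewrite !mxE ltnS leq_eqVlt eqxx /=.
  have [->|jk] := eqVneq j k; first by rewrite eqxx ltnn mulr1 addrC subrK.
  by rewrite mulr0 addr0 (_ : _ == _ = false)//; apply/negbTE.
rewrite xpsi -sumrB (le_trans (ler_norm_sum _ _ _))//.
rewrite -mulrA mulr_natl -[X in _ *+ X]card_ord -sumr_const ler_sum// => k _.
have [xy0|xy0] := eqVneq ((x - y) 0 k) 0.
  rewrite pS xy0 scale0r addr0 mul0r !subrr normr0 mulr_ge0//.
  by rewrite (le_trans _ (aP y k zy)).
have pr s : 0 <= s <= 1 -> `|z - (p k + (s * (x - y) 0 k) *: delta_mx 0 k)| < r.
  move=> /andP[s0 s1]; apply/rV_norm_ltP => j; rewrite !mxE.
  have := rV_norm_coord (z - x) j; have := rV_norm_coord (z - y) j; rewrite !mxE.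
  have [->|jk] := eqVneq j k.
    rewrite ltnn eqxx mulr1 => zyk zxk.
    rewrite (_ : z 0 k - _ = s * (z 0 k - x 0 k) + (1 - s) * (z 0 k - y 0 k)); last by ring.
    rewrite (le_lt_trans (ler_normD _ _))// !normrM (ger0_norm s0) (@ger0_norm _ (1 - s)) ?subr_ge0//.
    have zx' := le_lt_trans zxk zx; have zy' := le_lt_trans zyk zy.
    have [->|sn0] := eqVneq s 0; first by rewrite mul0r add0r subr0 mul1r.
    rewrite [ltRHS](_ : r = s * r + (1 - s) * r); last by ring.
    by rewrite ltr_leD ?ltr_pM2l ?lt0r ?sn0// ler_wpM2l ?subr_ge0// ltW.
  rewrite andbF mulr0 addr0 => zyj zxj.
  by case: ifP => _; [exact: le_lt_trans zxj zx|exact: le_lt_trans zyj zy].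
have [s /andP[s0 s1] E] := MVT_line xy0 (fun s s1 => dP _ k (pr s s1)).
rewrite pS E mulrC -mulrBr normrM mulrC ler_pM ?rV_norm_coord//.
by apply: aP; apply: pr; rewrite !ltW.
Qed.

Lemma C1_strict_diff psi z U : nbhs z U ->
  (forall y i, U y -> derivable psi y (delta_mx 0 i)) ->
  (forall i, {for z, continuous ('D_(delta_mx 0 i) psi)}) ->
  forall e, 0 < e -> exists2 r : R, 0 < r &
    forall x y, `|z - x| < r -> `|z - y| < r ->
    `|psi x - psi y - \sum_i (x - y) 0 i * 'D_(delta_mx 0 i) psi z| <= e * `|x - y|.
Proof.
move=> zU dP cP e e0; pose e' := e / n.+1%:R.
have e'0 : 0 < e' by rewrite divr_gt0.
have H : \forall y \near z, U y /\
    (forall i, `|'D_(delta_mx 0 i) psi y - 'D_(delta_mx 0 i) psi z| <= e').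
  apply: filterI => //.
  apply: (@filter_forall _ _ (fun i y =>
    `|'D_(delta_mx 0 i) psi y - 'D_(delta_mx 0 i) psi z| <= e') (nbhs z) _) => i.
  have /cvgrPdist_le/(_ e' e'0) := cP i; apply: filterS => y.
  by rewrite distrC.
have /nbhs_rVP[r r0 rP] := H; exists r => // x y zx zy.
have -> : e = n.+1%:R * e' by rewrite mulrC divfK.
apply: (near_linear_scalar (r := r) (z := z)) => // [w i /rP[/dP]//|w i /rP[_]//].
Qed.

Lemma Ck_derivable k Omega u s i y : Ck_on k.+1 Omega u -> (size s <= k)%N ->
  Omega y -> derivable (pderiv s u) y (delta_mx 0 i).
Proof. by move=> [_ H] sk Oy; apply: H. Qed.

Lemma strict_diff_pderiv Omega k u s z : open Omega -> Omega z ->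
  Ck_on k.+1 Omega u -> (size s <= k)%N ->
  forall e, 0 < e -> exists2 r : R, 0 < r &
    forall x y, `|z - x| < r -> `|z - y| < r ->
    `|pderiv s u x - pderiv s u y -
      \sum_i (x - y) 0 i * pderiv (i :: s) u z| <= e * `|x - y|.
Proof.
move=> oO Oz Cu sk; apply: (@C1_strict_diff _ _ Omega).
- exact: open_nbhs_nbhs.
- by move=> y i Oy; exact: Ck_derivable Cu sk Oy.
- by move=> i; exact: Cu.1 (i :: s) z _ Oz.
Qed.

(** Row [i] of [hess u z] is the derivative of the gradient along axis [i], so the matrix acts on
    the correct side before symmetry is known. *)
Lemma strict_diff_grad Omega u z : open Omega -> Omega z -> Ck_on 2 Omega u ->
  strict_diff (grad u) (hess u z) z.
Proof.
move=> oO Oz Cu e e0.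
have /choice[r rP] : forall j : 'I_n.+1, exists r : R, 0 < r /\
    forall x y, `|z - x| < r -> `|z - y| < r ->
    `|pderiv [:: j] u x - pderiv [:: j] u y -
      \sum_i (x - y) 0 i * pderiv [:: i; j] u z| <= e * `|x - y|.
  move=> j.
  have [//|r r0 rP] := strict_diff_pderiv oO Oz Cu (s := [:: j]) _ e0.
  by exists r.
pose r0 := \big[Num.min/1]_j r j.
have r0r j : r0 <= r j by apply: (bigmin_inf j).
exists r0.
  rewrite /r0; elim/big_ind: _ => //; first by move=> a b a0 b0; rewrite lt_min a0.
  by move=> j _; have [] := rP j.
move=> x y /= zx zy; apply/rV_norm_leP => j; rewrite !mxE.
have := (rP j).2 x y (lt_le_trans zx (r0r j)) (lt_le_trans zy (r0r j)).
rewrite (_ : \sum_i (x - y) 0 i * pderiv [:: i; j] u z =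
  \sum_(i < n.+1) (x - y) 0 i * hess u z i j)//.
by apply: eq_bigr => i _; rewrite [hess _ _ _ _]mxE.
Qed.

Lemma dot_norm x y : `|dot x y| <= n.+1%:R * `|x| * `|y|.
Proof.
rewrite (le_trans (ler_norm_sum _ _ _))// -mulrA mulr_natl -[X in _ *+ X]card_ord.
rewrite -sumr_const ler_sum// => i _; rewrite normrM ler_pM ?rV_norm_coord//.
Qed.

Lemma C1_derive Omega u z v : open Omega -> Omega z -> Ck_on 1 Omega u ->
  is_derive z v u (dot (grad u z) v).
Proof.
move=> oO Oz Cu.
suff H : (fun t : R => t^-1 *: ((u \o shift z) (t *: v) - u z)) @ 0^' -->
    dot (grad u z) v.
  by split; [apply/cvg_ex; exists (dot (grad u z) v)|exact: cvg_lim H].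
apply/cvgrPdist_le => e e0.
have v1 : 0 < `|v| + 1 by rewrite ltr_wpDl.
have [//|r r0 rP] := strict_diff_pderiv oO Oz Cu (s := [::]) _ (divr_gt0 e0 v1).
have tr : 0 < r / (`|v| + 1) by rewrite divr_gt0.
near=> t; have t0 : t != 0 by near: t; exact: nbhs_dnbhs_neq.
have tvr : `|t *: v| < r.
  have : `|t| < r / (`|v| + 1) by near: t; exact: dnbhs0_lt.
  rewrite ltr_pdivlMr// => tv; apply: le_lt_trans tv; rewrite normrZ.
  by rewrite ler_wpM2l// lerDl.
have := rP (t *: v + z) z; rewrite subrr normr0 opprD addrCA subrr addr0 normrN.
move=> /(_ tvr r0); rewrite addrK normrZ => H.
rewrite /= -[_ *: _]/(_ * _) -(ler_pM2l (_ : 0 < `|t|)) ?normr_gt0// -normrM mulrBr.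
rewrite mulrA mulfV// mul1r distrC.
rewrite (_ : t * dot _ _ = \sum_i (t *: v) 0 i * pderiv [:: i] u z); last first.
  rewrite mulr_sumr; apply: eq_bigr => i _.
  by rewrite [grad _ _ _ _]mxE [(t *: v) _ _]mxE; ring.
apply: (le_trans H); rewrite -mulrA mulrCA mulrC mulrA mulrAC ler_pdivrMr//.
rewrite [leLHS](_ : _ = `|t| * e * `|v|); last by ring.
by rewrite ler_wpM2l ?mulr_ge0 ?(ltW e0)// lerDl.
Unshelve. all: by end_near. Qed.

Lemma Ck_on_leq j k Omega u : (j <= k)%N -> Ck_on k Omega u -> Ck_on j Omega u.
Proof.
move=> jk [c d]; split=> [s y sj Oy|s i y sj Oy].
  by apply: c => //; exact: leq_trans jk.
by apply: d => //; exact: leq_trans jk.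
Qed.

(** Testing the supporting inequality at [z + s *: delta_mx 0 i] for [s = t] and [s = - t] pins the
    partial derivative to [v 0 i] within [e]. *)
Lemma grad_min Omega u z v : open Omega -> Omega z -> Ck_on 1 Omega u ->
  (forall y, Omega y -> u z + dot v (y - z) <= u y) -> grad u z = v.
Proof.
move=> oO Oz Cu minz; apply/rowP => i; rewrite mxE; apply/eqP.
have H e : 0 < e -> `|pderiv [:: i] u z - v 0 i| <= e.
  move=> e0; have [//|r r0 rP] := strict_diff_pderiv oO Oz Cu (s := [::]) _ e0.
  have /nbhs_rVP[r' r'0 r'P] := open_nbhs_nbhs (conj oO Oz).
  pose t := Num.min r r' / 2.
  have t0 : 0 < t by rewrite divr_gt0// lt_min r0.
  have tr : t < r by rewrite ltr_pdivrMr// gt_min; apply/orP; left; lra.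
  have tr' : t < r' by rewrite ltr_pdivrMr// gt_min; apply/orP; right; lra.
  have norm_delta : `|delta_mx 0 i : 'rV[R]_n.+1| <= 1.
    by apply/rV_norm_leP => j; rewrite mxE; case: (_ && _); rewrite ?normr1 ?normr0.
  have key s : `|s| = t -> s * v 0 i - s * pderiv [:: i] u z <= e * t.
    move=> st.
    have dz : `|z - (z + s *: delta_mx 0 i)| <= t.
      by rewrite opprD addrA subrr sub0r normrN normrZ st ler_piMr// ltW.
    have := rP _ z (le_lt_trans dz tr); rewrite subrr normr0 => /(_ r0).
    have := minz _ (r'P _ (le_lt_trans dz tr')).
    rewrite addrAC subrr add0r.
    have -> : dot v (s *: delta_mx 0 i) = s * v 0 i.
      rewrite /dot (bigD1 i)//= big1 => [|j /negbTE ji]; rewrite !mxE ?ji ?eqxx /=.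
        by rewrite mulr1 addr0 mulrC.
      by rewrite !mulr0.
    have -> : \sum_j (s *: delta_mx 0 i : 'rV_n.+1) 0 j * pderiv [:: j] u z =
        s * pderiv [:: i] u z.
      rewrite (bigD1 i)//= big1 => [|j /negbTE ji]; rewrite !mxE ?ji ?eqxx /=.
        by rewrite mulr1 addr0.
      by rewrite mulr0 mul0r.
    rewrite /= => umin; rewrite ler_norml => /andP[_].
    have : e * `|s *: delta_mx 0 i : 'rV[R]_n.+1| <= e * t.
      by rewrite ler_wpM2l ?(ltW e0)// normrZ st ler_piMr// ltW.
    by move=> ? ?; lra.
  have k1 := key t (gtr0_norm t0).
  have := key (- t); rewrite normrN gtr0_norm// => /(_ erefl) k2.
  rewrite ler_norml; apply/andP; split; rewrite -(ler_pM2l t0); lra.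
rewrite -subr_eq0 -normr_le0; apply/ler_addgt0Pr => e e0.
by rewrite add0r H.
Qed.

(** The mean value theorem produces a gradient at an intermediate point, which strict
    differentiability of the gradient turns into a Hessian term, so no second-order Taylor formula
    is involved. The first-order terms cancel against the supporting inequality. *)
Lemma hess_min_psd Omega u z : open Omega -> Omega z -> Ck_on 2 Omega u ->
  (forall y, Omega y -> u z + dot (grad u z) (y - z) <= u y) -> psdmx (hess u z).
Proof.
move=> oO Oz Cu minz a; rewrite -dotE.
have C1u : Ck_on 1 Omega u by exact: Ck_on_leq Cu.
have /nbhs_rVP[r' r'0 r'P] := open_nbhs_nbhs (conj oO Oz).
apply/ler_addgt0Pr => e0 e0_gt0.
(* The factor by which [dot_norm] and the size of [a] enlarge the tolerance; dividing [e0] by it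
   leaves an error of at most [s * t * e0]. *)
pose k := n.+1%:R * (`|a| + 1) * (`|a| + 1).
have k0 : 0 < k by rewrite !mulr_gt0// ltr_wpDl.
have e_gt0 : 0 < e0 / k by rewrite divr_gt0.
have [r r0 rP] := strict_diff_grad oO Oz Cu e_gt0.
pose t := Num.min r r' / (`|a| + 1) / 2.
have a1 : 0 < `|a| + 1 by rewrite ltr_wpDl.
have t0 : 0 < t by rewrite !divr_gt0// lt_min r0.
have tar s : 0 <= s <= 1 -> `|z - (z + (s * t) *: a)| < Num.min r r'.
  move=> /andP[s0 s1]; rewrite opprD addrA subrr sub0r normrN normrZ.
  apply: (@le_lt_trans _ _ (t * (`|a| + 1))).
    rewrite ler_pM//; last by rewrite lerDl.
    by rewrite normrM (ger0_norm s0) (gtr0_norm t0) ler_piMl// ltW.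
  have m0 : 0 < Num.min r r' by rewrite lt_min r0.
  by rewrite /t mulrAC divfK ?gt_eqF// gtr_pMr// invf_lt1// ltr1n.
have Oa s : 0 <= s <= 1 -> Omega (z + (s * t) *: a).
  by move=> /tar ts; apply: r'P; apply: lt_le_trans ts _; rewrite ge_min lexx orbT.
clearbody t.
have [s /andP[s0 s1] E] := MVT_line (lt0r_neq0 t0)
  (fun s s1 => @ex_derive _ _ _ _ _ _ _ (C1_derive a oO (Oa s s1) C1u)).
have s01 : 0 <= s <= 1 by rewrite !ltW.
have := minz _ (Oa 1 _); rewrite ler01 lexx mul1r => /(_ isT).
rewrite addrAC subrr add0r -lerBrDl E.
have -> := @derive_val _ _ _ _ _ _ _ (C1_derive a oO (Oa s s01) C1u).
pose w := grad u (z + (s * t) *: a) - grad u z - (z + (s * t) *: a - z) *m hess u z.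
have zb (b : 'rV[R]_n.+1) : z + b - z = b by rewrite addrC addKr.
have wE : grad u (z + (s * t) *: a) = grad u z + (s * t) *: (a *m hess u z) + w.
  by rewrite /w zb -scalemxAl -[_ - _ - _]addrA -opprD [RHS]addrC subrK.
have wle : `|w| <= e0 / k * (s * t * `|a|).
  have := rP (z + (s * t) *: a) z (lt_le_trans (tar _ s01) _).
  rewrite ge_min lexx /= subrr normr0 => /(_ isT r0)/le_trans; apply.
  by rewrite addrAC subrr add0r normrZ ger0_norm// mulr_ge0// ltW.
clearbody w; rewrite wE !dotDl dotZl dotZr => H.
have st0 : 0 < s * t by rewrite mulr_gt0.
have waE : dot w a <= s * t * e0.
  have := dot_norm w a; rewrite ler_norml => /andP[_ /le_trans]; apply.
  apply: (@le_trans _ _ (n.+1%:R * (e0 / k * (s * t * (`|a| + 1))) * (`|a| + 1))).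
    rewrite -!mulrA ler_wpM2l// !mulrA ler_pM//; last by rewrite lerDl.
    apply: (le_trans wle); rewrite !mulrA ler_wpM2l ?lerDl//.
    by rewrite !mulr_ge0 ?invr_ge0 ?(ltW k0) ?(ltW e0_gt0) ?(ltW s0) ?(ltW t0).
  rewrite [leLHS](_ : _ = s * t * e0 * (n.+1%:R * (`|a| + 1) * (`|a| + 1) / k)).
    by rewrite -/k divff ?gt_eqF// mulr1.
  by ring.
rewrite -(ler_pM2l st0) mulr0 mulrDr.
rewrite -(ler_pM2l t0) mulr0.
have : t * dot w a <= t * (s * t * e0) by rewrite ler_pM2l.
by move=> ?; lra.
Qed.

Lemma hess_sym Omega u z : open Omega -> Omega z -> Ck_on 2 Omega u ->
  (hess u z)^T = hess u z.
Proof.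
move=> oO Oz Cu; apply/matrixP => j i; rewrite !mxE.
have C1u : Ck_on 1 Omega u by exact: Ck_on_leq Cu.
have /nbhs_rVP[r' r'0 r'P] := open_nbhs_nbhs (conj oO Oz).
pose d i : 'rV[R]_n.+1 := delta_mx 0 i.
have d1 k : `|d k| <= 1.
  by apply/rV_norm_leP => l; rewrite mxE; case: (_ && _); rewrite ?normr1 ?normr0.
(* The second difference of u over a small square of side t equals
   t ^ 2 * D_i D_j u, up to an error e * t ^ 2, for both orders. *)
have key e : 0 < e -> exists2 r, 0 < r & forall t i j, 0 < t < r ->
    `|u (z + t *: d j + t *: d i) - u (z + t *: d j) - (u (z + t *: d i) - u z) -
      t * (t * pderiv [:: j; i] u z)| <= t * (e * t).
  move=> e0; have [r r0 rP] := strict_diff_grad oO Oz Cu e0.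
  have m0 : 0 < Num.min r r' by rewrite lt_min r0.
  exists (Num.min r r' / 2) => [|t {}i {}j /andP[t0]]; first by rewrite divr_gt0.
  rewrite ltr_pdivlMr// => tm.
  have zst (s s' : R) : 0 <= s <= t -> 0 <= s' <= t ->
      `|z - (z + s' *: d j + s *: d i)| < Num.min r r'.
    move=> /andP[s0 st] /andP[s'0 s't].
    rewrite -addrA opprD addrA subrr sub0r normrN.
    apply: le_lt_trans tm; rewrite (le_trans (ler_normD _ _))// mulr_natr mulr2n.
    have le_t (q : R) k : 0 <= q -> q <= t -> `|q *: d k| <= t.
      move=> q0; apply: le_trans; rewrite normrZ ger0_norm// ler_piMr//.
    by rewrite lerD ?le_t.
  have zr' s s' : 0 <= s <= t -> 0 <= s' <= t -> Omega (z + s' *: d j + s *: d i).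
    move=> st s't; apply: r'P; apply: (lt_le_trans (zst s s' st s't)).
    by rewrite ge_min lexx orbT.
  have st s : 0 <= s <= 1 -> 0 <= s * t <= t.
    by move=> /andP[s0 s1]; rewrite mulr_ge0 ?(ltW t0)//= ler_piMl// ltW.
  have tt : 0 <= t <= t by rewrite (ltW t0) lexx.
  have z0 : 0 <= (0 : R) <= t by rewrite lexx (ltW t0).
  pose phi s := u (z + t *: d j + s *: d i) - u (z + s *: d i).
  pose dphi s := pderiv [:: i] u (z + t *: d j + s *: d i) -
                 pderiv [:: i] u (z + s *: d i).
  have dP s : 0 <= s <= 1 -> is_derive (s * t) 1 phi (dphi (s * t)).
    move=> /st s1; apply: is_deriveB.
    - by apply: is_derive_line; exact: (@Ck_derivable 1 Omega u [::] i _ Cu isT (zr' _ _ s1 tt)).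
    - apply: is_derive_line; apply: (@Ck_derivable 1 Omega u [::] i _ Cu isT).
      by have := zr' _ _ s1 z0; rewrite scale0r addr0.
  have [s /andP[s0 s1] E] := MVT_neq (lt0r_neq0 t0) dP.
  have s01 : 0 <= s * t <= t by apply: st; rewrite !ltW.
  have -> : u (z + t *: d j + t *: d i) - u (z + t *: d j) - (u (z + t *: d i) - u z) =
      phi t - phi 0.
    by rewrite /phi scale0r !addr0; ring.
  rewrite E mulrC -mulrBr normrM gtr0_norm// ler_pM2l// /dphi.
  have := rP (z + t *: d j + (s * t) *: d i) (z + (s * t) *: d i).
  move=> /(_ (lt_le_trans (zst _ _ s01 tt) _)); rewrite ge_min lexx => /(_ isT).
  have := zst _ _ s01 z0; rewrite scale0r addr0 => zs.
  move=> /(_ (lt_le_trans zs _)); rewrite ge_min lexx => /(_ isT).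
  rewrite (_ : _ - (z + _ *: d i) = t *: d j); last first.
    by rewrite (addrAC z) [LHS]addrC addKr.
  move=> /rV_norm_leP/(_ i); rewrite -scalemxAl -rowE !mxE => /le_trans; apply.
  by rewrite ler_wpM2l ?(ltW e0)// normrZ gtr0_norm// ler_piMr// ltW.
have gen (D p q t e : R) : 0 < t -> `|D - t * (t * p)| <= t * (e * t) ->
    `|D - t * (t * q)| <= t * (e * t) -> `|p - q| <= e *+ 2.
  move=> t0; rewrite !ler_norml => /andP[a1 a2] /andP[b1 b2].
  by apply/andP; split; rewrite -(ler_pM2l t0) -(ler_pM2l t0); lra.
have H e : 0 < e -> `|pderiv [:: i; j] u z - pderiv [:: j; i] u z| <= e *+ 2.
  move=> e0; have [r r0 rP] := key e e0.
  have t0 : 0 < r / 2 by rewrite divr_gt0.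
  have tr : 0 < r / 2 < r by rewrite t0 gtr_pMr// invf_lt1// ltr1n.
  set t := r / 2 in t0 tr.
  have := rP t i j tr; have := rP t j i tr.
  rewrite [z + t *: d i + t *: d j]addrAC.
  rewrite (_ : u (z + t *: d j + t *: d i) - u (z + t *: d i) - _ =
   u (z + t *: d j + t *: d i) - u (z + t *: d j) - (u (z + t *: d i) - u z)); last by ring.
  exact: gen.
apply/eqP; rewrite -subr_eq0 -normr_le0; apply/ler_addgt0Pr => e e0.
have e2 : e = (e / 2) *+ 2 by rewrite -mulr_natr divfK.
by rewrite add0r [leRHS]e2 H// divr_gt0.
Qed.

Lemma pderivD k Omega u h s y : open Omega -> Ck_on k Omega u -> Ck_on k Omega h ->
  (size s <= k)%N -> Omega y ->
  pderiv s (fun y => u y + h y) y = pderiv s u y + pderiv s h y.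
Proof.
move=> oO Cu Ch; elim: s y => [//|i s IH] y sk Oy.
have E : \near y, pderiv s (fun y => u y + h y) y = (pderiv s u + pderiv s h) y.
  have := open_nbhs_nbhs (conj oO Oy); apply: filterS => x Ox.
  by rewrite IH// ltnW.
rewrite /= (near_eq_derive _ E) deriveD//; first exact: Cu.2.
exact: Ch.2.
Qed.

Lemma pderivZ k Omega u (c : R) s y : open Omega -> Ck_on k Omega u ->
  (size s <= k)%N -> Omega y ->
  pderiv s (fun y => c * u y) y = c * pderiv s u y.
Proof.
move=> oO Cu; elim: s y => [//|i s IH] y sk Oy.
have E : \near y, pderiv s (fun y => c * u y) y = (c *: pderiv s u) y.
  have := open_nbhs_nbhs (conj oO Oy); apply: filterS => x Ox.
  by rewrite IH// ltnW.
by rewrite /= (near_eq_derive _ E) deriveZ//; exact: Cu.2.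
Qed.

Lemma Ck_onD k Omega u h : open Omega -> Ck_on k Omega u -> Ck_on k Omega h ->
  Ck_on k Omega (fun y => u y + h y).
Proof.
move=> oO Cu Ch.
have E s y : (size s <= k)%N -> Omega y ->
    \near y, (pderiv s u + pderiv s h) y = pderiv s (fun y => u y + h y) y.
  move=> sk Oy; have := open_nbhs_nbhs (conj oO Oy); apply: filterS => x Ox.
  by rewrite (pderivD oO Cu Ch).
split=> [s y sk Oy|s i y sk Oy].
  have H : (pderiv s u + pderiv s h) @ y --> pderiv s u y + pderiv s h y.
    exact: continuousD (Cu.1 s y sk Oy) (Ch.1 s y sk Oy).
  rewrite /prop_for /continuous_at (pderivD oO Cu Ch)//.
  by move=> A /H HA; apply: filterS2 (E s y sk Oy) HA => x /= <-.
apply: near_eq_derivable (E s y (ltnW sk) Oy) _.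
by apply: derivableD; [exact: Cu.2|exact: Ch.2].
Qed.

Lemma Ck_onZ k Omega u (c : R) : open Omega -> Ck_on k Omega u ->
  Ck_on k Omega (fun y => c * u y).
Proof.
move=> oO Cu.
have E s y : (size s <= k)%N -> Omega y ->
    \near y, (c *: pderiv s u) y = pderiv s (fun y => c * u y) y.
  move=> sk Oy; have := open_nbhs_nbhs (conj oO Oy); apply: filterS => x Ox.
  by rewrite (pderivZ _ oO Cu).
split=> [s y sk Oy|s i y sk Oy].
  have H : (c *: pderiv s u) @ y --> c * pderiv s u y.
    by apply: continuousM (Cu.1 s y sk Oy); exact: cst_continuous.
  rewrite /prop_for /continuous_at (pderivZ _ oO Cu)//.
  by move=> A /H HA; apply: filterS2 (E s y sk Oy) HA => x /= <-.
apply: near_eq_derivable (E s y (ltnW sk) Oy) _.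
by apply: derivableZ; exact: Cu.2.
Qed.

End second_order_calculus.

(** * Continuity up to the boundary and Borel measurability *)

Section within_closure.
Context (R : realType) (n : nat).
Implicit Types (Omega U K D : set 'rV[R]_n.+1) (f g w h : 'rV[R]_n.+1 -> R).

Lemma within_continuous_interior D g y : {within D, continuous g} -> nbhs y D ->
  {for y, continuous g}.
Proof.
move=> /subspace_continuousP gD yD A gA.
have := gD y (nbhs_singleton yD) A gA; rewrite /within /= => H.
by apply: filterS2 yD H => z Dz /(_ Dz).
Qed.

Lemma within_closure_ge0 Omega g : {within closure Omega, continuous g} ->
  (forall y, Omega y -> 0 <= g y) -> forall y, closure Omega y -> 0 <= g y.
Proof.
move=> /subspace_continuousP gO g0 y Oy; rewrite leNgt; apply/negP => gy.
have /(gO y Oy) : nbhs (g y) [set t | t < 0].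
  by apply: open_nbhs_nbhs; split=> //; exact: open_lt.
rewrite /within /= => /Oy[z [Oz]] /(_ (subset_closure Oz)).
by rewrite /= ltNge g0.
Qed.

Lemma borel_measurable_within K g : closed K -> {within K, continuous g} ->
  measurable_fun (K : set (borelRn R n)) (g : borelRn R n -> R).
Proof.
move=> cK /continuousP gK mK.
apply: (measurability _ (RGenOpens.measurableE R)) (mK).
move=> _ [_ [a [b ->] <-]].
have oab : open (`]a, b[%classic : set R) by exact: interval_open.
have /open_subspaceP[V oV VK] := gK _ oab.
rewrite setIC -VK; apply: measurableI; last exact: borel_closed.
exact: borel_open.
Qed.

Lemma open_setI_preimage U g (V : set R) : open U ->
  (forall y, U y -> {for y, continuous g}) -> open V -> open (U `&` g @^-1` V).
Proof.
move=> oU gU oV; rewrite openE => y [Uy Vgy].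
apply: filterI; first exact: open_nbhs_nbhs.
by apply: gU => //; exact: open_nbhs_nbhs.
Qed.

Lemma borel_measurable_continuous U g : open U ->
  (forall y, U y -> {for y, continuous g}) ->
  measurable_fun (U : set (borelRn R n)) (g : borelRn R n -> R).
Proof.
move=> oU gU mU; apply: (measurability _ (RGenOpens.measurableE R)) (mU).
move=> _ [_ [a [b ->] <-]]; apply: borel_open.
by apply: open_setI_preimage => //; exact: interval_open.
Qed.

Lemma continuous_dot (v : 'rV[R]_n.+1) : continuous (fun y => dot v y).
Proof.
move=> y B /nbhs_ballP[e /= e0 eB].
have c0 : 0 < n.+1%:R * `|v| + 1 by rewrite ltr_wpDl// mulr_ge0.
have := @nbhs_rV_ball R n y _ (divr_gt0 e0 c0); apply: filterS => z /= yz.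
apply: eB; rewrite /ball /=.
have -> : dot v y - dot v z = dot v (y - z).
  by rewrite !dotE linearB/= mulmxBr !mxE.
apply: le_lt_trans (dot_norm _ _) _.
rewrite ltr_pdivlMr// mulrC in yz; apply: le_lt_trans yz.
by rewrite ler_wpM2r// lerDl.
Qed.

Lemma strict_diff_continuous (G : 'rV[R]_n.+1 -> 'rV[R]_n.+1) A z :
  strict_diff G A z -> {for z, continuous G}.
Proof.
move=> Gz; have [r r0 rP] := Gz 1 ltr01; have [c c0 cP] := mulmx_bounded A.
move=> B /nbhs_rVP[e e0 eB].
have c10 : 0 < 1 + c by rewrite addr_gt0.
have m0 : 0 < Num.min r (e / (1 + c)) by rewrite lt_min r0 divr_gt0.
have := @nbhs_rV_ball R n z _ m0; apply: filterS => y /=.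
rewrite lt_min => /andP[zyr zye]; apply: eB.
have zz : `|z - z| < r by rewrite subrr normr0.
have := rP z y zz zyr; rewrite mul1r => H.
rewrite ltr_pdivlMr// mulrC in zye; apply: le_lt_trans zye.
rewrite -[G z - G y](subrK ((z - y) *m A)) (le_trans (ler_normD _ _))//.
by rewrite mulrDl mul1r lerD.
Qed.

Lemma bounded_closure Omega : bounded_set Omega -> bounded_set (closure Omega).
Proof.
move=> [M [Mr MO]]; exists M; split=> // M' MM' y Oy.
have MO' := MO _ MM'; apply/ler_addgt0Pr => e e0.
have /Oy[z [/MO'/= zM /= yz]] := @nbhs_rV_ball R n y e e0.
by rewrite -[y](subrK z) (le_trans (ler_normD _ _))// addrC lerD// ltW.
Qed.

Lemma compact_closure_bounded Omega : bounded_set Omega -> compact (closure Omega).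
Proof.
move=> bO; apply: bounded_closed_compact; first exact: bounded_closure.
exact: closed_closure.
Qed.

Lemma bdryE Omega : open Omega -> bdry Omega = closure Omega `\` Omega.
Proof. by rewrite /bdry => oO; rewrite (interior_id Omega).1. Qed.

Lemma bdry_closed Omega : open Omega -> closed (bdry Omega).
Proof.
move=> oO; rewrite bdryE// setDE; apply: closedI; first exact: closed_closure.
exact: open_closedC.
Qed.

Lemma within_continuousD K g h : {within K, continuous g} ->
  {within K, continuous h} -> {within K, continuous (fun y => g y + h y)}.
Proof. by move=> cg ch y; apply: continuousD; [exact: cg|exact: ch]. Qed.

Lemma within_continuousB K g h : {within K, continuous g} ->
  {within K, continuous h} -> {within K, continuous (fun y => g y - h y)}.
Proof. by move=> cg ch y; apply: continuousB; [exact: cg|exact: ch]. Qed.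

Lemma within_continuousZ K g (c : R) : {within K, continuous g} ->
  {within K, continuous (fun y => c * g y)}.
Proof. by move=> cg y; apply: continuousM; [exact: cst_continuous|exact: cg]. Qed.

Lemma within_continuous_cst K (c : R) : {within K, continuous (fun=> c)}.
Proof. by move=> y; exact: cst_continuous. Qed.

Lemma within_continuous_dot K (p y : 'rV[R]_n.+1) :
  {within K, continuous (fun z => dot p (z - y))}.
Proof.
have -> : (fun z => dot p (z - y)) = (fun z => dot p z - dot p y).
  by apply/funext => t; rewrite dotBr.
apply: within_continuousB; last exact: within_continuous_cst.
by apply: continuous_subspaceT; exact: continuous_dot.
Qed.

End within_closure.

(** * Borel images under injective continuous maps *)

Section image_measurable.
Context (R : realType) (n : nat).
Implicit Types (Omega U : set 'rV[R]_n.+1) (G : 'rV[R]_n.+1 -> 'rV[R]_n.+1).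

(** An open set is a countable union of compact closures of rational boxes, and a continuous image
    of a compact set is closed. *)
Lemma image_open_measurable Omega G U : open Omega ->
  (forall y, Omega y -> {for y, continuous G}) -> open U ->
  measurable (G @` (Omega `&` U) : set (borelRn R n)).
Proof.
move=> oO cG oU.
have oOU : open (Omega `&` U) by exact: openI.
pose I := [set k | bounded_set (@rational_box R n k) /\
                   closure (@rational_box R n k) `<=` Omega `&` U].
have -> : G @` (Omega `&` U) = \bigcup_(k in I) (G @` closure (@rational_box R n k)).
  rewrite -image_bigcup; congr image; apply/seteqP; split=> [z OUz|z [k [_ kOU] kz]]; last exact: kOU.
  have /nbhs_rVP[e e0 eP] := open_nbhs_nbhs (conj oOU OUz).
  have e20 : 0 < e / 2 by rewrite divr_gt0.
  have [k [kz ke]] := rational_box_nbhs (@nbhs_rV_ball R n z _ e20).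
  exists k; last exact: subset_closure.
  split.
    exists (`|z| + e); split; first exact: num_real.
    move=> M zM y /ke /= zy; rewrite -[y](subrK z).
    apply: le_trans (ler_normD _ _) _; rewrite distrC; apply: le_trans (ltW zM).
    by rewrite addrC lerD2l ltW// (lt_trans zy)// gtr_pMr// invf_lt1// ltr1n.
  move=> y ky; apply: eP.
  have /ky[y' [/ke /= zy' /= yy']] := @nbhs_rV_ball R n y _ e20.
  rewrite -[z](subrK y') -addrA (le_lt_trans (ler_normD _ _))// (splitr e) ltrD//.
  by rewrite distrC.
apply: bigcup_measurable => k [bk kOU]; apply: borel_closed.
apply: compact_closed; first exact: norm_hausdorff.
apply: continuous_compact; last exact: compact_closure_bounded.
by apply: continuous_in_subspaceT => y /set_mem/kOU[Oy _]; exact: cG.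
Qed.

(* The sets whose image is measurable form a sigma-algebra on Omega because
   injectivity makes the image of a complement a difference of images. *)
Lemma image_borel_measurable Omega G (E : set (borelRn R n)) : open Omega ->
  (forall y, Omega y -> {for y, continuous G}) ->
  (forall y z, Omega y -> Omega z -> G y = G z -> y = z) ->
  measurable E -> E `<=` Omega -> measurable (G @` E : set (borelRn R n)).
Proof.
move=> oO cG Ginj mE EO.
pose M := [set E : set (borelRn R n) | measurable (G @` (Omega `&` E) : set (borelRn R n))].
suff : M E by rewrite /M/= setIidr.
have mO : measurable (G @` Omega : set (borelRn R n)).
  by have := image_open_measurable oO cG openT; rewrite setIT.
apply: (smallest_sub _ _ mE); last by move=> U oU; exact: image_open_measurable.
split.
- by rewrite /M /= setI0 image_set0.
- move=> A MA; rewrite /M /= (_ : G @` _ = G @` Omega `\` G @` (Omega `&` A)).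
    exact: measurableD.
  apply/seteqP; split=> [_ [y [Oy [_ Ay]] <-]|_ [[y Oy <-] nA]].
    by split; [exists y|move=> [z [Oz Az] /(Ginj _ _ Oz Oy) zy]; apply: Ay; rewrite -zy].
  by exists y => //; split=> //; split=> // Ay; apply: nA; exists y.
- move=> F MF; rewrite /M /= setI_bigcupr image_bigcup.
  by apply: bigcup_measurable => k _; exact: MF.
Qed.

End image_measurable.

(** * The comparison principle *)

Section comparison_principle.
Context (R : realType) (n : nat) (Omega : set 'rV[R]_n.+1).
Context (f u : 'rV[R]_n.+1 -> R).
Hypotheses (oO : open Omega) (bO : bounded_set Omega).
Hypothesis cvxO : forall y z (t : R), Omega y -> Omega z -> 0 <= t <= 1 ->
  Omega (t *: y + (1 - t) *: z).
Hypotheses (cf : forall y, Omega y -> {for y, continuous f})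
  (f0 : forall y, Omega y -> 0 < f y)
  (fM : exists M, forall y, Omega y -> f y <= M).
Hypotheses (C2u : Ck_on 2 Omega u) (cu : {within closure Omega, continuous u}).
Hypothesis scu : strictly_convex_on Omega u.
Hypothesis detu : forall y, Omega y -> \det (hess u y) = f y.

Let C1u : Ck_on 1 Omega u. Proof. exact: Ck_on_leq C2u. Qed.

(** Convexity bounds the increment of [u] from [y] to [y + t *: (z - y)] by [t * (u z - u y)];
    dividing by a small [t] leaves the directional derivative up to [e]. *)
Lemma grad_subgradient y : Omega y -> subgradient Omega u y (grad u y).
Proof.
move=> Oy z Oz.
have [->|yz] := eqVneq z y; first by rewrite subrr dot0r addr0.
apply/ler_addgt0Pr => e e0.
have c0 : 0 < `|z - y| + 1 by rewrite ltr_wpDl.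
have [//|r r0 rP] := strict_diff_pderiv oO Oy C1u (s := [::]) _ (divr_gt0 e0 c0).
pose t := Num.min (1 / 2) (r / (`|z - y| + 1) / 2).
have t0 : 0 < t by rewrite lt_min !divr_gt0.
have t1 : t < 1 by rewrite gt_min ltr_pdivrMr// mul1r ltr1n.
have tr : t * `|z - y| < r.
  have tr : t <= r / (`|z - y| + 1) / 2 by rewrite ge_min lexx orbT.
  apply: (@le_lt_trans _ _ (t * (`|z - y| + 1))); first by rewrite ler_pM2l// lerDl.
  rewrite -ltr_pdivlMr//; apply: le_lt_trans tr _.
  by rewrite gtr_pMr ?divr_gt0// invf_lt1// ltr1n.
have := scu Oz Oy yz (t := t); rewrite t0 t1 => /(_ isT)/ltW ut.
have zt : t *: z + (1 - t) *: y = y + t *: (z - y).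
  by rewrite scalerBl scale1r scalerBr addrCA addrA addrAC.
have := rP (y + t *: (z - y)) y.
rewrite opprD addrA subrr sub0r normrN normr0 normrZ gtr0_norm// => /(_ tr r0).
have zb (b : 'rV[R]_n.+1) : y + b - y = b by rewrite addrC addKr.
rewrite !zb (_ : \sum_i _ = t * dot (grad u y) (z - y)); last first.
  rewrite mulr_sumr; apply: eq_bigr => i _.
  by rewrite [grad _ _ _ _]mxE [(t *: (z - y)) 0 i]mxE; ring.
rewrite normrZ gtr0_norm// ler_norml => /andP[H _]; move: H; rewrite /= -zt.
have : e / (`|z - y| + 1) * (t * `|z - y|) <= t * e.
  rewrite [leLHS](_ : _ = t * (e * (`|z - y| / (`|z - y| + 1)))); last by ring.
  by rewrite ler_pM2l// ler_piMr ?ler_pdivrMr ?mul1r ?lerDl// ltW.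
move=> a b; rewrite -(ler_pM2l t0); lra.
Qed.

Lemma hess_psd y : Omega y -> psdmx (hess u y).
Proof. by move=> Oy; exact: (hess_min_psd oO Oy C2u (grad_subgradient Oy)). Qed.

(** At the midpoint the two supporting inequalities add up to the reverse of strict convexity. *)
Lemma subgradient_inj y z p : Omega y -> Omega z ->
  subgradient Omega u y p -> subgradient Omega u z p -> y = z.
Proof.
move=> Oy Oz yp zp; apply/eqP; apply: contraT => yz.
have := scu Oy Oz yz (t := 2^-1); rewrite invr_gt0 invf_lt1// ltr0n ltr1n => /(_ isT).
have Om : Omega (2^-1 *: y + (1 - 2^-1) *: z).
  by apply: cvxO; rewrite // invr_ge0 invf_le1// ler0n ler1n.
have := yp _ Om; have := zp _ Om; rewrite !dotBr dotDr !dotZr => ? ? ?; lra.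
Qed.

Lemma grad_inj y z : Omega y -> Omega z -> grad u y = grad u z -> y = z.
Proof.
move=> Oy Oz yz; apply: (subgradient_inj Oy Oz (grad_subgradient Oy)).
by rewrite yz; exact: grad_subgradient Oz.
Qed.

(** The gradient image of [E] sits inside the subgradient image, and [grad u] is injective with
    Jacobian determinant [f], so the lower area inequality applies. *)
Lemma solution_Aclass : Aclass Omega f u.
Proof.
split=> // [t y z /set_mem Oy /set_mem Oz|E mE EO].
  have [<-|yz] := eqVneq y z; first by rewrite !convmm.
  have -> : conv t y z = t%:num *: y + (1 - t%:num) *: z :> 'rV[R]_n.+1 by [].
  apply: (@le_trans _ _ (t%:num * u y + (1 - t%:num) * u z)); last by rewrite convRE.
  have [t_ge0 t_le1] : 0 <= t%:num /\ t%:num <= 1 by split.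
  have [->|t0] := eqVneq t%:num 0; first by rewrite subr0 !scale0r !scale1r !add0r mul0r mul1r add0r.
  have [->|t1] := eqVneq t%:num 1; first by rewrite subrr !scale0r !scale1r !addr0 mul0r mul1r addr0.
  by apply/ltW/scu => //; rewrite lt0r t0 t_ge0/= lt_neqAle t1.
apply: (@le_trans _ _ (lebesgueRn (grad u @` E))); last first.
  apply: le_lebesgueRn => _ [y Ey <-]; exists y => //.
  by apply: grad_subgradient; exact: EO.
apply: (area_lower (A := hess u)) => //.
- apply: measurable_funS (borel_measurable_continuous oO cf) => //.
  exact: borel_open.
- by move=> y z Ey Ez; apply: grad_inj; exact: EO.
- move=> E' mE' E'E; apply: borel_lebesgue.
  apply: image_borel_measurable oO _ grad_inj mE' (subset_trans E'E EO).
  by move=> y Oy; exact: strict_diff_continuous (strict_diff_grad oO Oy C2u).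
- move=> z /EO Oz; split; [exact: strict_diff_grad oO Oz C2u|exact: cf|exact: f0|].
  by rewrite detu// ger0_norm// ltW// f0.
Qed.

Lemma mxtrace_cofmx_mul (A : 'M[R]_n.+1) : A^T = A ->
  \tr (cofmx A *m A) = n.+1%:R * \det A.
Proof.
move=> As; rewrite cofmx_adj -[in X in _ *m X]As -trmx_mul mul_mx_adj.
by rewrite tr_scalar_mx mxtrace_scalar mulr_natl.
Qed.

Lemma hessE (h : 'rV[R]_n.+1 -> R) y i j : hess h y i j = pderiv [:: i; j] h y.
Proof. by rewrite mxE. Qed.

Lemma hessD h y : Ck_on 2 Omega h -> Omega y ->
  hess (fun y => u y + h y) y = hess u y + hess h y.
Proof.
move=> C2h Oy; apply/matrixP => i j.
apply: etrans (hessE _ _ _ _) _; apply: etrans (pderivD oO C2u C2h _ Oy) _ => //.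
by apply: esym; apply: etrans (mxE _ _ _ _) _; congr (_ + _); exact: hessE.
Qed.

Lemma det_hess_perturbed_le h y : Ck_on 2 Omega h -> Omega y -> linMA u h y = 0 ->
  psdmx (hess (fun y => u y + h y) y) ->
  `|\det (hess (fun y => u y + h y) y)| <= f y.
Proof.
move=> C2h Oy Lh psdk.
have C2k := Ck_onD oO C2u C2h.
have usym := hess_sym oO Oy C2u.
have /andP[d0 df] : 0 <= \det (hess (fun y => u y + h y) y) <= \det (hess u y).
  have d0 : 0 < \det (hess u y) by rewrite detu//; exact: f0.
  apply: (psdmx_det_le usym (hess_psd Oy) d0 (hess_sym oO Oy C2k) psdk).
  rewrite hessD// mulmxDr mxtraceD -[X in _ + X]/(linMA u h y) Lh addr0.
  exact: mxtrace_cofmx_mul.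
by rewrite (ger0_norm d0) -(detu Oy); exact: df.
Qed.

(** Positivity here and finiteness in [integral_f_lty] are what make [I <= (1 - d) ^+ n.+1 * I]
    contradictory in [comparison]. *)
Lemma integral_f_gt0 (D : set 'rV[R]_n.+1) x : open D -> D `<=` Omega -> D x ->
  (0 < \int[@leb_measure R n]_(y in D) (f y)%:E)%E.
Proof.
move=> oD DO Dx.
have fx := f0 (DO _ Dx).
have [|U xU fU] := @continuous_near_lt R n f x (f x / 2) (f x + 1) (cf (DO _ Dx)).
  by rewrite ltrDl ltr01 gtr_pMr// invf_lt1// ltr1n.
have [V [oV Vx] VU] : exists2 V, open_nbhs x V & V `<=` U by exists U°; [split; [exact: open_interior|]|exact: interior_subset].
have mD : measurable (D : set (leb_type R n)) by apply: borel_lebesgue; exact: borel_open.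
have oDV : open (D `&` V) by exact: openI.
have mDV : measurable (D `&` V : set (leb_type R n)) by apply: borel_lebesgue; exact: borel_open.
have mf : measurable_fun (D : set (leb_type R n)) (fun y => (f y)%:E).
  apply/measurable_EFinP; apply: borel_lebesgue_fun; first exact: borel_open.
  by apply: borel_measurable_continuous => // y /DO/cf.
have f0D y : D y -> (0 <= (f y)%:E)%E by move=> /DO/f0/ltW; rewrite lee_fin.
apply: lt_le_trans (ge0_subset_integral _ mDV mD mf f0D (@subIsetl _ _ _)).
have := @cst_le_integral_leb R n (D `&` V) (f x / 2) f mDV.
have f20 : 0 < f x / 2 by rewrite divr_gt0.
move=> /(_ (ltW f20) (measurable_funS mD (@subIsetl _ _ _) mf)) H.
apply: lt_le_trans (H _) => [|y [_ /VU/fU/andP[/ltW]]//].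
rewrite mule_gt0 ?lte_fin//; apply: (@lebesgueRn_open_gt0 R n _ x).
exact: open_nbhs_nbhs.
Qed.

Lemma integral_f_lty (D : set 'rV[R]_n.+1) : open D -> D `<=` Omega ->
  (\int[@leb_measure R n]_(y in D) (f y)%:E < +oo)%E.
Proof.
move=> oD DO; have [M fleM] := fM.
have mD : measurable (D : set (leb_type R n)) by apply: borel_lebesgue; exact: borel_open.
have mf : measurable_fun (D : set (leb_type R n)) (fun y => (f y)%:E).
  apply/measurable_EFinP; apply: borel_lebesgue_fun; first exact: borel_open.
  by apply: borel_measurable_continuous => // y /DO/cf.
apply: le_lt_trans (@integral_leb_le_cst R n D (Num.max 0 M) f mD mf _) _.
  by move=> y /DO Oy; rewrite le_max fleM// orbT andbT ltW// f0.
apply: lte_mul_pinfty; rewrite ?lee_fin ?le_max ?lexx//.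
by apply: le_lt_trans (lebesgueRn_bounded bO); exact: le_lebesgueRn.
Qed.

Lemma comparison h w : Ck_on 2 Omega h -> {within closure Omega, continuous h} ->
  (forall y, Omega y -> linMA u h y = 0) -> Aclass Omega f w ->
  (forall y, bdry Omega y -> w y <= u y + h y) ->
  forall x, Omega x -> w x <= u x + h x.
Proof.
move=> C2h ch Lh [cw _ MAw] bw x Ox; rewrite leNgt; apply/negP => wx.
pose k y := u y + h y.
have C2k : Ck_on 2 Omega k by exact: Ck_onD.
have ck : {within closure Omega, continuous k}.
  exact: within_continuousD.
have cO := compact_closure_bounded bO.
have Oc := @subset_closure _ Omega.
have Oint y : Omega y -> nbhs y (closure Omega).
  by move=> Oy; apply: filterS Oc _; exact: open_nbhs_nbhs.
have [b _ kb] := compact_EVT_max (ex_intro _ x (Oc _ Ox)) cO ck.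
pose M := k b.
have kM y : closure Omega y -> k y <= M by move=> Oy; apply: kb; exact: mem_set.
have kxM := kM x (Oc _ Ox).
(* The second bound keeps [v x < w x], as [v x - k x = d * (M - k x)]; the added 1 avoids a zero
   denominator when [k x = M]. *)
pose d := Num.min (1 / 2) ((w x - k x) / (M - k x + 1) / 2).
have c0 : 0 < M - k x + 1 by rewrite ltr_wpDl// subr_ge0.
have wk0 : 0 < w x - k x by rewrite subr_gt0.
have d0 : 0 < d by rewrite lt_min !divr_gt0.
have d1 : d < 1 by rewrite gt_min ltr_pdivrMr// mul1r ltr1n.
have dx : d * (M - k x) < w x - k x.
  have dle : d <= (w x - k x) / (M - k x + 1) / 2 by rewrite ge_min lexx orbT.
  apply: (@le_lt_trans _ _ (d * (M - k x + 1))); first by rewrite ler_pM2l// lerDl.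
  rewrite -ltr_pdivlMr//; apply: le_lt_trans dle _.
  by rewrite gtr_pMr ?divr_gt0// invf_lt1// ltr1n.
pose v y := (1 - d) * k y + d * M.
have kv y : closure Omega y -> k y <= v y.
  by move=> /kM yM; have := ler_wpM2l (ltW d0) yM; rewrite /v; lra.
pose D := Omega `&` (fun y => w y - v y) @^-1` [set t | 0 < t].
have cwv y : Omega y -> {for y, continuous (fun y => w y - v y)}.
  move=> Oy; apply: continuousB; first exact: within_continuous_interior cw (Oint _ Oy).
  apply: continuousD; last exact: cst_continuous.
  apply: continuousM; first exact: cst_continuous.
  exact: within_continuous_interior ck (Oint _ Oy).
have oD : open D by apply: open_setI_preimage => //; exact: open_gt.
have DO : D `<=` Omega by move=> y [].
have Dx : D x by split=> //=; rewrite /v; lra.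
pose S := [set z | D z /\ psdmx (hess k z)].
have key : \bigcup_(y in D) subgradient Omega w y `<=`
    (fun p => (1 - d) *: p) @` (grad k @` S).
  move=> p [y [Oy /= wvy] yp].
  (* The supporting affine function of [w] at [y], minus [v]. It is positive at [y] and, on the
     boundary, at most [w - k <= 0], so its maximum over the closure is attained inside. *)
  pose F z := w y + dot p (z - y) - v z.
  have cF : {within closure Omega, continuous F}.
    apply: within_continuousB.
      exact: (within_continuousD (@within_continuous_cst R n _ (w y)) (@within_continuous_dot R n _ p y)).
    exact: (within_continuousD (within_continuousZ (c := 1 - d) ck) (@within_continuous_cst R n _ (d * M))).
  have [c cOc cF_max] := compact_EVT_max (ex_intro _ x (Oc _ Ox)) cO cF.
  have {cF_max} Fc z : closure Omega z -> F z <= F c by move=> Oz; apply: cF_max; exact: mem_set.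
  move/set_mem: cOc => cOc.
  have Fc0 : 0 < F c.
    apply: lt_le_trans (Fc y (Oc _ Oy)).
    by rewrite /F subrr dot0r addr0.
  (* The subgradient inequality is given on [Omega] only; continuity carries it to the boundary. *)
  have lw z : closure Omega z -> w y + dot p (z - y) <= w z.
    move=> Oz; rewrite -subr_ge0.
    apply: (@within_closure_ge0 R n Omega (fun z => w z - (w y + dot p (z - y)))) => //.
      apply: within_continuousB cw _.
      exact: (within_continuousD (@within_continuous_cst R n _ (w y)) (@within_continuous_dot R n _ p y)).
    by move=> t Ot; rewrite subr_ge0; exact: yp.
  have Oc' : Omega c.
    apply: contrapT => nOc; have /bw wkc : bdry Omega c by rewrite bdryE.
    have := lw c cOc; have := kv c cOc; rewrite /k.
    by move: Fc0; rewrite /F; lra.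
  have d10 : 0 < 1 - d by rewrite subr_gt0.
  (* Maximality of [F] at [c], divided by [1 - d]: the slope [p / (1 - d)] supports [k] at [c]. *)
  have minc z : Omega z -> k c + dot ((1 - d)^-1 *: p) (z - c) <= k z.
    move=> Oz; have := Fc z (Oc _ Oz); rewrite /F /v.
    have -> : dot ((1 - d)^-1 *: p) (z - c) = (1 - d)^-1 * (dot p (z - y) - dot p (c - y)).
      by rewrite dotZl !dotBr; congr (_ * _); ring.
    move=> H; rewrite -(ler_pM2l d10) mulrDr mulrA divff ?gt_eqF// mul1r; lra.
  have gc := grad_min oO Oc' (Ck_on_leq (isT : (1 <= 2)%N) C2k) minc.
  exists (grad k c); last by rewrite gc scalerA divff ?gt_eqF// scale1r.
  exists c => //; split.
    by split=> //=; have := lw c cOc; move: Fc0; rewrite /F; lra.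
  by apply: (hess_min_psd oO Oc' C2k); rewrite gc.
have mDl : measurable (D : set (borelRn R n)) by exact: borel_open.
have IMA : (\int[@leb_measure R n]_(y in D) (f y)%:E <= MA Omega w D)%E.
  exact: MAw.
have MAI : (MA Omega w D <= ((1 - d) ^+ n.+1)%:E * \int[@leb_measure R n]_(y in D) (f y)%:E)%E.
  apply: (@le_trans _ _ (lebesgueRn ((fun p => (1 - d) *: p) @` (grad k @` S)))).
    exact: le_lebesgueRn.
  have d10 : 0 < 1 - d by rewrite subr_gt0.
  apply: (@le_trans _ _ (((1 - d) ^+ n.+1)%:E * lebesgueRn (grad k @` S))%E).
    have -> : (1 - d) ^+ n.+1 = \prod_(i < n.+1) (1 - d) by rewrite prodr_const card_ord.
    apply: lebesgueRn_lipschitz => [//|p q i _ _].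
    rewrite !mxE -mulrBr normrM gtr0_norm// ler_pM2l//.
    by have := rV_norm_coord (p - q) i; rewrite !mxE.
  apply: lee_wpmul2l; first by rewrite lee_fin exprn_ge0// ltW.
  apply: (area_upper (A := hess k)) => //.
  - by move=> y [].
  - by apply: borel_measurable_continuous => // y /DO/cf.
  - by move=> y /DO/f0/ltW.
  - move=> z [/DO Oz psdz]; split.
    + exact: strict_diff_grad oO Oz C2k.
    + exact: cf.
    + exact: f0.
    + exact: det_hess_perturbed_le (Lh _ Oz) psdz.
have I0 := integral_f_gt0 oD DO Dx.
have Iy := integral_f_lty oD DO.
move: (le_trans IMA MAI) I0 Iy.
case: (integral _ _ _) => [r| |]//.
rewrite -EFinM lee_fin lte_fin => H r0 _.
have : (1 - d) ^+ n.+1 < 1.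
  by rewrite exprn_ilt1// ?subr_ge0 ?ltW// gtrBl.
rewrite -(ltr_pM2r r0) mul1r => /(le_lt_trans H); by rewrite ltxx.
Qed.

End comparison_principle.

(** * Hahn-Banach *)

Section sublinear.
Context (R : realType) (V : lmodType R) (B : set V).
Hypothesis BD : forall g h, B g -> B h -> B (g + h).
Hypothesis BZ : forall (c : R) g, B g -> B (c *: g).
Implicit Types (p q : V -> R) (a g h : V).

(** Homogeneity is an inequality only, which is what an infimum readily gives; applying it to [c^-1]
    as well recovers equality. *)
Definition sublinear p :=
  (forall g h, B g -> B h -> p (g + h) <= p g + p h) /\
  (forall (c : R) g, 0 < c -> B g -> p (c *: g) <= c * p g).

Let B0 g : B g -> B 0. Proof. by move/(BZ 0); rewrite scale0r. Qed.
Let BN g : B g -> B (- g). Proof. by move/(BZ (-1)); rewrite scaleN1r. Qed.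

Lemma sublinearZ p (c : R) g : sublinear p -> 0 < c -> B g -> p (c *: g) = c * p g.
Proof.
move=> [_ pZ] c0 Bg; apply/eqP; rewrite eq_le pZ//=.
have := pZ c^-1 (c *: g); rewrite invr_gt0 => /(_ c0 (BZ _ Bg)).
by rewrite scalerA mulVf ?gt_eqF// scale1r -ler_pdivrMl ?invr_gt0// invrK.
Qed.

Lemma sublinear0 p g : sublinear p -> B g -> p 0 = 0.
Proof.
move=> sp /B0 B_0; have := sublinearZ sp (ltr0Sn _ 1) B_0; rewrite scaler0 => p0.
lra.
Qed.

Lemma sublinear_geN p g : sublinear p -> B g -> - p (- g) <= p g.
Proof.
move=> sp Bg; have := sp.1 _ _ Bg (BN Bg); rewrite subrr (sublinear0 sp Bg).
lra.
Qed.

(* The smallest sublinear functional below [p] that equals [- p a] at [- a]. *)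
Lemma sublinear_shift p a : sublinear p -> B a ->
  exists q, [/\ sublinear q, forall g, B g -> q g <= p g &
                forall g, B g -> q g <= p (g + a) - p a].
Proof.
move=> sp Ba.
pose S g := [set p (g + t *: a) - t * p a | t in [set t : R | 0 <= t]].
have S0 g : S g !=set0 by exists (p (g + 0 *: a) - 0 * p a), 0 => /=.
have lbS g : B g -> lbound (S g) (- p (- g)).
  move=> Bg _ [t /= t0 <-].
  have [->|tn0] := eqVneq t 0.
    by rewrite scale0r mul0r addr0 subr0; exact: sublinear_geN.
  have tp : 0 < t by rewrite lt0r tn0.
  (* [t *: a] is the sum of [g + t *: a] and [- g]; subadditivity then bounds the infimum from
     below. *)
  have := sp.1 _ _ (BD Bg (BZ t Ba)) (BN Bg); rewrite addrAC subrr add0r.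
  rewrite (sublinearZ sp tp Ba); lra.
have S_inf g : B g -> has_inf (S g) by move=> Bg; split; [exact: S0|exists (- p (- g)); exact: lbS].
have qle g (t : R) : B g -> 0 <= t -> inf (S g) <= p (g + t *: a) - t * p a.
  by move=> Bg t0; apply: ge_inf; [exact: (S_inf _ Bg).2|exists t].
exists (fun g => inf (S g)); split.
- split=> [g h Bg Bh|c g c0 Bg].
    apply/ler_addgt0Pr => e e0; have e20 : 0 < e / 2 by rewrite divr_gt0.
    have [_ [t /= t0 <-] tg] := inf_adherent e20 (S_inf _ Bg).
    have [_ [s /= s0 <-] sh] := inf_adherent e20 (S_inf _ Bh).
    have := qle (g + h) (t + s) (BD Bg Bh) (addr_ge0 t0 s0).
    have := sp.1 _ _ (BD Bg (BZ t Ba)) (BD Bh (BZ s Ba)).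
    rewrite addrACA -scalerDl; lra.
  rewrite -ler_pdivrMl//; apply: lb_le_inf; first exact: S0.
  move=> _ [t /= t0 <-]; rewrite ler_pdivrMl//.
  have := qle (c *: g) (c * t) (BZ c Bg) (mulr_ge0 (ltW c0) t0).
  rewrite -scalerA -scalerDr (sublinearZ sp c0 (BD Bg (BZ t Ba))); lra.
- by move=> g Bg; have := qle g 0 Bg (lexx 0); rewrite scale0r addr0 mul0r subr0.
- by move=> g Bg; have := qle g 1 Bg ler01; rewrite scale1r mul1r.
Qed.

(** Zorn's lemma for functionals below [p], smaller values on [B] counting as larger. Only values on
    [B] are compared, hence a preorder; a chain is bounded by its pointwise infimum. *)
Lemma sublinear_minimal p : sublinear p -> exists q,
  [/\ sublinear q, forall g, B g -> q g <= p g &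
      forall q', sublinear q' -> (forall g, B g -> q' g <= q g) ->
        forall g, B g -> q g <= q' g].
Proof.
move=> sp.
pose T := {q | sublinear q /\ forall g, B g -> q g <= p g}.
pose R' (q1 q2 : T) : bool := `[< forall g, B g -> sval q2 g <= sval q1 g >].
have t0 : T by exists p.
have [q qmin] : exists q : T, premaximal R' q.
  apply: ZL_preorder => [//|q|q1 q2 q3 /asboolP q12 /asboolP q23|A tA].
  - by apply/asboolP.
  - by apply/asboolP => g Bg; rewrite (le_trans (q23 _ Bg))// q12.
  have [A0|/set0P[q0 Aq0]] := eqVneq A set0; first by exists t0 => s; rewrite A0.
  pose S g := [set sval q g | q in A].
  have S_inf g : B g -> has_inf (S g).
    move=> Bg; split; first by exists (sval q0 g), q0.
    exists (- p (- g)) => _ [[q [sq qp]] _ <-] /=.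
    by have := sublinear_geN sq Bg; have := qp _ (BN Bg); lra.
  have qle (q : T) g : A q -> B g -> inf (S g) <= sval q g.
    by move=> Aq Bg; apply: ge_inf; [exact: (S_inf _ Bg).2|exists q].
  have sI : sublinear (fun g => inf (S g)).
    split=> [g h Bg Bh|c g c0 Bg].
      apply/ler_addgt0Pr => e e0; have e20 : 0 < e / 2 by rewrite divr_gt0.
      have [_ [q1 Aq1 <-] tg] := inf_adherent e20 (S_inf _ Bg).
      have [_ [q2 Aq2 <-] sh] := inf_adherent e20 (S_inf _ Bh).
      (* In a chain the smaller of the two approximants serves both [g] and [h]. *)
      have [/asboolP q12|/asboolP q21] := tA _ _ Aq1 Aq2.
        have := qle _ _ Aq2 (BD Bg Bh); have := (svalP q2).1.1 _ _ Bg Bh.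
        by have := q12 _ Bg; lra.
      have := qle _ _ Aq1 (BD Bg Bh); have := (svalP q1).1.1 _ _ Bg Bh.
      by have := q21 _ Bh; lra.
    rewrite -ler_pdivrMl//; apply: lb_le_inf; first by exists (sval q0 g), q0.
    move=> _ [q Aq <-]; rewrite ler_pdivrMl//.
    by rewrite -(sublinearZ (svalP q).1 c0 Bg); exact: qle Aq (BZ c Bg).
  have Ip g : B g -> inf (S g) <= p g.
    by move=> Bg; apply: le_trans (qle _ _ Aq0 Bg) _; exact: (svalP q0).2.
  exists (exist _ (fun g => inf (S g)) (conj sI Ip)) => q Aq.
  by apply/asboolP => g Bg /=; exact: qle.
exists (sval q); split; [exact: (svalP q).1|exact: (svalP q).2|].
move=> q' sq' q'q.
have q'p g : B g -> q' g <= p g.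
  by move=> Bg; rewrite (le_trans (q'q _ Bg))//; exact: (svalP q).2.
have := qmin (exist _ q' (conj sq' q'p)).
have -> : R' q (exist _ q' (conj sq' q'p)) by apply/asboolP.
by move=> /(_ isT)/asboolP.
Qed.

(** A minimal sublinear functional is additive, since shifting it by [h] cannot lower it. Shifting
    [p] by [v] beforehand forces a value at most [- p v] at [- v], so that [L] attains [p] at
    [v]. *)
Theorem hahn_banach_sublinear p v : sublinear p -> B v -> exists L : V -> R,
  [/\ forall g h, B g -> B h -> L (g + h) = L g + L h,
      forall (c : R) g, B g -> L (c *: g) = c * L g,
      forall g, B g -> L g <= p g & L v = p v].
Proof.
move=> sp Bv; have [p' [sp' p'p p'v]] := sublinear_shift sp Bv.
have [L [sL Lp' Lmin]] := sublinear_minimal sp'.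
have LD g h : B g -> B h -> L (g + h) = L g + L h.
  move=> Bg Bh; apply/eqP; rewrite eq_le sL.1//=.
  have [q [sq qL qh]] := sublinear_shift sL Bh.
  have := Lmin q sq qL g Bg; have := qh g Bg; lra.
have LN g : B g -> L (- g) = - L g.
  move=> Bg; have := LD _ _ Bg (BN Bg); rewrite subrr (sublinear0 sL Bg); lra.
exists L; split=> //.
- move=> c g Bg; have [c0|c0|->] := ltgtP c 0.
  + have := sublinearZ sL (_ : 0 < - c) (BN Bg); rewrite oppr_gt0 => /(_ c0).
    by rewrite scaleNr scalerN opprK LN// mulrNN.
  + exact: sublinearZ.
  + by rewrite scale0r mul0r (sublinear0 sL Bg).
- by move=> g Bg; rewrite (le_trans (Lp' _ Bg))// p'p.
- apply/eqP; rewrite eq_le (le_trans (Lp' _ Bv)) ?p'p//=.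
  have := Lp' _ (BN Bv); rewrite LN//; have := p'v _ (BN Bv).
  rewrite addNr (sublinear0 sp Bv); lra.
Qed.

End sublinear.

(** * Riesz representation on a compact set *)

Section uniform_continuity.
Context (R : realType) (n : nat).

Lemma compact_unif_continuous (K : set 'rV[R]_n.+1) (g : 'rV[R]_n.+1 -> R) (e : R) :
  compact K -> {within K, continuous g} -> 0 < e ->
  exists2 d : R, 0 < d &
    forall y z, K y -> K z -> `|y - z| < d -> `|g y - g z| <= e.
Proof.
move=> /compact_near_coveringP cK /subspace_continuousP gK e0.
pose P (d : R) y := K y -> forall z, K z -> `|y - z| < d -> `|g y - g z| <= e.
have [|d /= d0 dP] := cK R (nbhs (0 : R)) P _.
  move=> y Ky; have e20 : 0 < e / 2 by rewrite divr_gt0.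
  have /nbhs_rVP[r r0 rP] : nbhs y [set z | K z -> `|g y - g z| < e / 2].
    exact: (gK y Ky _ (nbhsx_ballx (g y) _ e20)).
  have r20 : 0 < r / 2 by rewrite divr_gt0.
  exists ([set z | `|y - z| < r / 2], [set d | `|d| < r / 2]).
    split=> /=; first exact: nbhs_rV_ball.
    by exists (r / 2) => //= d; rewrite /ball_ /= sub0r normrN.
  move=> [y' d] /= [yy' dr] Ky' z Kz y'z.
  rewrite (le_trans (ler_distD (g y) _ _))// (splitr e) lerD//.
    rewrite distrC; apply/ltW/rP => //; apply: lt_le_trans yy' _.
    by rewrite ler_pdivrMr// ler_peMr ?ler1n// ltW.
  apply/ltW/rP => //; rewrite (le_lt_trans (ler_distD y' _ _))// (splitr r) ltrD//.
  by rewrite (lt_trans y'z)// (le_lt_trans _ dr)// ler_norm.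
exists (d / 2); first by rewrite divr_gt0.
move=> y z Ky Kz yz; apply: dP yz => //=.
by rewrite /ball_ /= sub0r normrN gtr0_norm ?divr_gt0// gtr_pMr// invf_lt1// ltr1n.
Qed.

End uniform_continuity.

Section partition.
Context (R : realType) (n : nat) (K : set 'rV[R]_n.+1).

Lemma within_continuous_bounded (g : 'rV[R]_n.+1 -> R) : compact K ->
  {within K, continuous g} -> exists M, forall y, K y -> `|g y| <= M.
Proof.
move=> cK gK; have [->|/set0P K0] := eqVneq K set0; first by exists 0.
have cg : {within K, continuous (fun y => `|g y|)}.
  by move=> y; apply: continuous_comp; [exact: gK|exact: norm_continuous].
have [c _ cmax] := compact_EVT_max K0 cK cg.
by exists `|g c| => y Ky; apply: cmax; exact: mem_set.
Qed.

(** Take a finite cover by balls of radius [e / 2] and label a point by the first ball in the list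
    that contains it. *)
Lemma small_partition (e : R) : compact K -> 0 < e ->
  exists dN : ('rV[R]_n.+1 -> nat) * nat,
    (forall y, K y -> dN.1 y < dN.2)%N /\
    forall y z, K y -> K z -> dN.1 y = dN.1 z -> `|y - z| < e.
Proof.
rewrite compact_cover => cK e0; have e20 : 0 < e / 2 by rewrite divr_gt0.
have [y _|y Ky|D _ KD] := cK _ K (fun y => ball y (e / 2)).
- exact: ball_open.
- by exists y => //; exact: ballxx.
pose near (y c : 'rV[R]_n.+1) := `|c - y| < e / 2.
exists ((fun y => find (near y) (finmap.enum_fset D)), size (finmap.enum_fset D)).
have hasD y : K y -> has (near y) (finmap.enum_fset D).
  by move=> /KD[c cD yc]; apply/hasP; exists c => //; rewrite -ball_normE in yc.
split=> /= [y Ky|y z Ky Kz yz]; first by rewrite -has_find hasD.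
have := nth_find 0 (hasD _ Ky); have := nth_find 0 (hasD _ Kz).
rewrite -yz /near => cz; rewrite distrC => cy.
by rewrite (splitr e) (le_lt_trans (ler_distD _ _ _) (ltrD cy cz)).
Qed.

End partition.

(* The representing measure is the law of a random point: nested finite
   partitions of [K] into small cells are coded by integers in such a way that
   finer codes order the cells lexicographically, and [sample_lim s] is the limit
   of points in the cells of the [s]-quantiles of [L] for these codes. *)
Section riesz.
Context (R : realType) (n : nat) (K : set 'rV[R]_n.+1) (y0 : 'rV[R]_n.+1).
Hypotheses (cK : compact K) (Ky0 : K y0).
Implicit Types (g h : 'rV[R]_n.+1 -> R) (y z : 'rV[R]_n.+1) (s : R).
Variable L : ('rV[R]_n.+1 -> R) -> R.

(** Continuity is not imposed, so that [L] can be evaluated on indicators of cells. The cells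
    themselves are never measured: the measure lives on [[0, 1[] and is pushed forward. *)
Definition bounded_on g := exists M : R, forall y, K y -> `|g y| <= M.

Hypotheses
  (LD : forall g h, bounded_on g -> bounded_on h ->
     L (fun y => g y + h y) = L g + L h)
  (LZ : forall (c : R) g, bounded_on g -> L (fun y => c * g y) = c * L g)
  (Lle : forall g h, bounded_on g -> bounded_on h ->
     (forall y, K y -> g y <= h y) -> L g <= L h)
  (L1 : L (fun=> 1) = 1).

Variables (d : nat -> 'rV[R]_n.+1 -> nat) (N : nat -> nat).
Hypotheses (d_lt : forall j y, K y -> (d j y < N j)%N)
  (d_close : forall j y z, K y -> K z -> d j y = d j z -> `|y - z| < j.+1%:R^-1).

(** A mixed-radix number with digits [d j y < N j], the finest digit last; division by [N j] drops
    that digit. *)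
Fixpoint code j y : nat := if j is j'.+1 then code j' y * N j' + d j' y else 0.

Lemma code_lt j y : K y -> (code j y < \prod_(i < j) N i)%N.
Proof.
move=> Ky; elim: j => [|j IHj]; first by rewrite big_ord0.
rewrite big_ord_recr/=; apply: leq_trans (_ : (code j y).+1 * N j <= _)%N.
  by rewrite mulSn addnC ltn_add2r d_lt.
by rewrite leq_mul2r IHj orbT.
Qed.

Lemma code_div j y : K y -> code j y = (code j.+1 y %/ N j)%N.
Proof.
by move=> Ky /=; rewrite divnMDl ?(leq_ltn_trans (leq0n _) (d_lt j Ky))// divn_small ?addn0 ?d_lt.
Qed.

Lemma code_close j y z : K y -> K z -> code j.+1 y = code j.+1 z ->
  `|y - z| < j.+1%:R^-1.
Proof.
move=> Ky Kz yz; apply: d_close => //.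
have := yz => /=; rewrite (code_div j Ky) (code_div j Kz) yz.
by move/eqP; rewrite eqn_add2l => /eqP.
Qed.

Lemma bounded_on_bool (b : 'rV[R]_n.+1 -> bool) : bounded_on (fun y => (b y)%:R).
Proof. by exists 1 => y _; case: (b y); rewrite ?normr1 ?normr0. Qed.

Lemma bounded_onM g h : bounded_on g -> bounded_on h ->
  bounded_on (fun y => g y * h y).
Proof.
move=> [M gM] [M' hM]; exists (M * M') => y Ky.
by rewrite normrM ler_pM// ?gM ?hM.
Qed.

Lemma bounded_onD g h : bounded_on g -> bounded_on h ->
  bounded_on (fun y => g y + h y).
Proof.
move=> [M gM] [M' hM]; exists (M + M') => y Ky.
by rewrite (le_trans (ler_normD _ _))// lerD ?gM ?hM.
Qed.

Lemma bounded_on_cst (c : R) : bounded_on (fun=> c).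
Proof. by exists `|c|. Qed.

Lemma L_ext g h : bounded_on g -> bounded_on h -> (forall y, K y -> g y = h y) ->
  L g = L h.
Proof.
by move=> bg bh gh; apply/eqP; rewrite eq_le !Lle// => y Ky; rewrite gh.
Qed.

Lemma L_cst c : L (fun=> c) = c.
Proof.
rewrite -[RHS]mulr1 -[in RHS]L1 -LZ; last exact: bounded_on_cst.
by congr L; apply/funext => y; rewrite mulr1.
Qed.

(** The distribution function of the level [j] code under [L]. *)
Definition distr j c : R := L (fun y => (code j y < c)%:R).

Lemma le_distr i j a b : (forall y, K y -> code i y < a -> code j y < b)%N ->
  distr i a <= distr j b.
Proof.
move=> ab; apply: Lle; [exact: bounded_on_bool|exact: bounded_on_bool|].
by move=> y /ab; case: ltnP => // _ -> //.
Qed.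

Lemma distr_nd j a b : (a <= b)%N -> distr j a <= distr j b.
Proof. by move=> ab; apply: le_distr => y _ /leq_trans; apply. Qed.

Lemma distr0 j : distr j 0 = 0.
Proof.
rewrite -[RHS]L_cst; apply: L_ext; [exact: bounded_on_bool|exact: bounded_on_cst|by []].
Qed.

Lemma distr_prod j : distr j (\prod_(i < j) N i)%N = 1.
Proof.
rewrite -[RHS]L1; apply: L_ext; [exact: bounded_on_bool|exact: bounded_on_cst|].
by move=> y Ky; rewrite code_lt.
Qed.

Lemma distrS g j c : bounded_on g ->
  L (fun y => g y * (code j y < c.+1)%:R) =
  L (fun y => g y * (code j y < c)%:R) + L (fun y => g y * (code j y == c)%:R).
Proof.
move=> bg; rewrite -LD; [|by apply: bounded_onM => //; exact: bounded_on_bool..].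
congr L; apply/funext => y; rewrite ltnS leq_eqVlt.
by case: ltngtP => //=; rewrite ?(mulr0, addr0, add0r).
Qed.

(** The default 0 occurs only for [s] outside [[0, 1[]. *)
Definition quantile j s : nat := xget 0 [set c | distr j c <= s < distr j c.+1].

Lemma quantileP j s : 0 <= s < 1 ->
  distr j (quantile j s) <= s < distr j (quantile j s).+1.
Proof.
move=> /andP[s0 s1]; apply: (@xgetPex _ 0 [set c | distr j c <= s < distr j c.+1]).
have ex : exists c, s < distr j c by exists (\prod_(i < j) N i)%N; rewrite distr_prod.
case: (ex_minnP ex) => -[|c] sc cmin; first by move: sc; rewrite distr0 ltNge s0.
by exists c => /=; rewrite sc andbT leNgt; apply/negP => /cmin; rewrite ltnn.
Qed.

Lemma quantile_unique j s c : 0 <= s < 1 -> distr j c <= s < distr j c.+1 ->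
  quantile j s = c.
Proof.
move=> /(quantileP j)/andP[q1 q2] /andP[c1 c2]; apply/eqP; rewrite eqn_leq.
apply/andP; split; rewrite leqNgt; apply/negP => /(distr_nd j) le.
  by have := le_lt_trans q1 c2; rewrite ltNge le.
by have := le_lt_trans c1 q2; rewrite ltNge le.
Qed.

(** Division by [N j] is monotone, so the fine interval of values of [distr] lies inside the coarse
    one: quantile cells of successive levels are nested. *)
Lemma quantile_codeS j s y : 0 <= s < 1 -> K y ->
  code j.+1 y = quantile j.+1 s -> code j y = quantile j s.
Proof.
move=> s01 Ky yq; apply/esym/quantile_unique => //.
have /andP[q1 q2] := quantileP j.+1 s01; apply/andP; split.
  apply: le_trans q1; apply: le_distr => z Kz; rewrite -yq.
  by rewrite (code_div j Ky) (code_div j Kz) !ltnNge; apply: contra; exact: leq_div2r.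
apply: lt_le_trans q2 _; apply: le_distr => z Kz; rewrite -yq !ltnS.
by rewrite (code_div j Ky) (code_div j Kz); exact: leq_div2r.
Qed.

Definition cell_point j c : 'rV[R]_n.+1 := xget y0 [set y | K y /\ code j y = c].

Lemma cell_point_K j c : K (cell_point j c).
Proof. by rewrite /cell_point; case: xgetP => [y -> []|]. Qed.

Lemma code_cell_point j y : K y -> code j (cell_point j (code j y)) = code j y.
Proof.
by move=> Ky; apply: (xgetPex y0 (_ : exists z, K z /\ code j z = code j y)).2; exists y.
Qed.

(** [distr] jumps strictly at the quantile, so that cell has a point and [cell_point] does not fall
    back on [y0]. *)
Lemma code_quantile j s : 0 <= s < 1 ->
  code j (cell_point j (quantile j s)) = quantile j s.
Proof.
move=> s01; suff [y [Ky <-]] : exists y, K y /\ code j y = quantile j s.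
  exact: code_cell_point.
apply: contrapT => H; have := quantileP j s01 => /andP[] /le_lt_trans h /h.
rewrite ltNge => /negP; apply; apply: le_distr => y Ky.
by rewrite ltnS leq_eqVlt => /predU1P[yq|//]; case: H; exists y.
Qed.

Definition sample j s : 'rV[R]_n.+1 :=
  if 0 <= s < 1 then cell_point j (quantile j s) else y0.

Lemma sample_K j s : K (sample j s).
Proof. by rewrite /sample; case: ifP => // _; exact: cell_point_K. Qed.

(** Nesting of the quantile cells, descended level by level from [i] to [j]; it makes the samples a
    Cauchy sequence. *)
Lemma code_sample i j s : 0 <= s < 1 -> (j <= i)%N ->
  code j (sample i s) = quantile j s.
Proof.
move=> s01 /subnK <-; rewrite addnC; move: (i - j)%N => k.
suff H m l y : K y -> code (l + m) y = quantile (l + m) s -> code l y = quantile l s.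
  by apply: (H k j _ (sample_K _ s)); rewrite /sample s01 code_quantile.
elim: m l => [|m IHm] l Ky; first by rewrite addn0.
by rewrite addnS => /(quantile_codeS s01 Ky); exact: IHm.
Qed.

Lemma sample_close j i k s : (j < i)%N -> (j < k)%N ->
  `|sample i s - sample k s| < j.+1%:R^-1.
Proof.
move=> ji jk; have [s01|s01] := boolP (0 <= s < 1); last first.
  by rewrite /sample (negbTE s01) subrr normr0 invr_gt0.
by apply: code_close; [exact: sample_K|exact: sample_K|rewrite !code_sample].
Qed.

Definition sample_lim s : 'rV[R]_n.+1 := lim (sample ^~ s @ \oo).

Lemma small_inv (e : R) : 0 < e -> exists j : nat, j.+1%:R^-1 < e.
Proof.
by move=> e0; exists (Num.truncn e^-1); rewrite invf_plt ?posrE// Num.Theory.truncnS_gt.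
Qed.

Lemma cvg_sample s : sample ^~ s @ \oo --> sample_lim s.
Proof.
apply/cauchy_cvgP/cauchy_exP => e /small_inv[j je].
exists (sample j.+1 s), j.+1 => //= i ji; rewrite -ball_normE /=.
exact: lt_trans (sample_close s (ltnSn j) ji) je.
Qed.

Lemma sample_lim_close j s : `|sample j.+1 s - sample_lim s| <= j.+1%:R^-1.
Proof.
apply/ler_addgt0Pr => e e0.
have /cvg_ball/(_ e e0)[m _ mP] := @cvg_sample s.
have := mP (maxn m j.+1) (leq_maxl _ _); rewrite -ball_normE /= => lim_e.
rewrite (le_trans (ler_distD (sample (maxn m j.+1) s) _ _))// lerD//.
  by apply/ltW/sample_close => //; rewrite leq_max ltnSn orbT.
by rewrite distrC ltW.
Qed.

Lemma sample_lim_K s : K (sample_lim s).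
Proof.
apply: (@closed_cvg _ _ \oo _ (sample ^~ s) K _ _ _ (@cvg_sample s)).
  exact: compact_closed.
by exists 0%N => // j _; exact: sample_K.
Qed.

(** For fixed [j] this is a step function: constant on each interval of [distr] values, and given by
    [y0] outside [[0, 1[]. *)
Lemma measurable_sample_coord j i : measurable_fun setT (fun s => sample j s 0 i).
Proof.
have -> : (fun s => sample j s 0 i) = (fun s =>
    \sum_(c < \prod_(k < j) N k) cell_point j c 0 i * \1_(`[distr j c, distr j c.+1[%classic) s
    + y0 0 i * \1_(~` `[0, 1[%classic) s).
  apply/funext => s; rewrite !indicE in_setC.
  have -> : (s \in `[0, 1[%classic) = (0 <= s < 1).
    by rewrite mem_setE in_itv.
  rewrite /sample; have [s01|s01] := ifP; last first.
    rewrite mulr1 big1 ?add0r// => c _; rewrite indicE mem_setE in_itv/=.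
    case: andP => [[c1 c2]|_]; last by rewrite mulr0.
    move: s01; rewrite (le_trans _ c1) ?(lt_le_trans c2)// -?(distr0 j) -?(distr_prod j).
      exact: distr_nd.
    exact: distr_nd.
  have q_lt : (quantile j s < \prod_(k < j) N k)%N.
    rewrite ltnNge; apply/negP => /(distr_nd j); rewrite distr_prod leNgt.
    have /andP[q1 _] := quantileP j s01; rewrite (le_lt_trans q1)//.
    by case/andP: s01.
  rewrite mulr0 addr0 (bigD1 (Ordinal q_lt))//= big1 ?addr0 => [|c cq].
    by rewrite indicE mem_setE in_itv/= quantileP// mulr1.
  rewrite indicE mem_setE in_itv/=.
  have [cs|_] := boolP (distr j c <= s < distr j c.+1); last by rewrite mulr0.
  by case/eqP: cq; apply: val_inj => /=; rewrite (quantile_unique s01 cs).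
apply: measurable_funD; last first.
  by apply: measurable_funM => //; apply: measurable_indic; exact: measurableC.
by apply: measurable_sum => c; apply: measurable_funM.
Qed.

Lemma measurable_sample_lim :
  measurable_fun setT (sample_lim : R -> borelRn R n).
Proof.
have mcoord i : measurable_fun setT (fun s => sample_lim s 0 i).
  apply: (measurable_fun_cvg (h := fun j s => sample j s 0 i)).
    by move=> j; exact: measurable_sample_coord.
  move=> s _.
  apply: (cvg_comp (sample ^~ s) (fun y : 'rV[R]_n.+1 => y 0 i)).
    exact: cvg_sample.
  exact: coord_continuous.
apply: (measurability (@open 'rV[R]_n.+1 : set (set (borelRn R n)))) => //.
move=> _ [U oU <-]; rewrite setTI (openE_rational_box oU).
rewrite preimage_bigcup; apply: bigcup_measurable => k _; rewrite /rational_box.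
case: unpickle => [pq|]; last by rewrite preimage_set0.
rewrite (_ : _ @^-1` _ = \bigcap_(i in [set: 'I_n.+1])
    ((fun s => sample_lim s 0 i) @^-1`
       `](map_mx ratr pq.1 : 'rV[R]_n.+1) 0 i, (map_mx ratr pq.2 : 'rV[R]_n.+1) 0 i]%classic)).
  apply: fin_bigcap_measurable => [|i _]; first exact: finite_finset.
  by rewrite -[X in measurable X]setTI; apply: mcoord.
apply/seteqP; split=> [s sb i _|s sb i] /=; first by rewrite in_itv/= sb.
by have := sb i I; rewrite /= in_itv.
Qed.

Let mu : {measure set (measurableTypeR R) -> \bar R} :=
  mrestr lebesgue_measure (measurable_itv `[0 : R, 1[).

Lemma mu_itv (a b : R) : 0 <= a -> a <= b -> b <= 1 -> mu `[a, b[%classic = (b - a)%:E.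
Proof.
move=> a0 ab b1; rewrite /mu /= /mrestr setIidl.
  rewrite lebesgue_measure_itv/= lte_fin; move: ab; rewrite le_eqVlt.
  by case/predU1P => [->|->]; rewrite ?ltxx ?subrr// EFinN.
move=> s /=; rewrite !in_itv/= => /andP[as_ sb].
by rewrite (le_trans a0 as_) (lt_le_trans sb b1).
Qed.

Lemma mu_setT : mu [set: R] = 1%E.
Proof.
by rewrite /mu /= /mrestr setTI lebesgue_measure_itv/= lte_fin ltr01 oppr0 adde0.
Qed.

Lemma mu_setC : mu (~` `[0 : R, 1[%classic) = 0%E.
Proof. by rewrite /mu /= /mrestr setICl measure0. Qed.

Lemma integrable_sample_lim g A : measurable A -> {within K, continuous g} ->
  mu.-integrable A (EFin \o (g \o sample_lim)).
Proof.
move=> mA cg; have [M gM] := within_continuous_bounded cK cg.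
apply: measurable_bounded_integrable => //.
- apply: (@le_lt_trans _ _ (mu setT)); last by rewrite mu_setT ltry.
  by apply: le_measure => //; exact: mem_set.
- apply: (@measurable_comp _ _ _ _ _ _ (K : set (borelRn R n))).
  + exact: borel_closed (compact_closed _ cK).
  + by move=> _ [s _ <-]; exact: sample_lim_K.
  + exact: borel_measurable_within (compact_closed _ cK) cg.
  + exact: measurable_funTS measurable_sample_lim.
- exists M; split=> [|t /ltW Mt s _ /=]; first exact: num_real.
  by apply: le_trans Mt; apply: gM; exact: sample_lim_K.
Qed.

Lemma distr_sub j c : distr j c.+1 - distr j c = L (fun y => (code j y == c)%:R).
Proof.
apply/eqP; rewrite subr_eq addrC; apply/eqP.
have := distrS j c (bounded_on_cst 1).
by do 3!under [fun y => 1 * _]funext do rewrite mul1r.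
Qed.

(** On the interval of a cell with point [z], [g (sample_lim s)] is at most [g z + e / 2], while on
    the cell [g + e] is at least [g z + e / 2]; the length of the interval is [L] of the indicator
    of the cell. The cells are added one by one. The reverse bound will come from [- g]. *)
Lemma Rintegral_sample_lim_le g (e : R) : {within K, continuous g} -> 0 < e ->
  (\int[mu]_s g (sample_lim s) <= L g + e)%R.
Proof.
move=> cg e0; have e20 : 0 < e / 2 by rewrite divr_gt0.
have [r r0 gr] := compact_unif_continuous cK cg e20.
have [j jr] := small_inv r0.
have bg : bounded_on (fun y => g y + e).
  by apply: bounded_onD; [exact: within_continuous_bounded|exact: bounded_on_cst].
have d01 c : (c <= \prod_(i < j.+1) N i)%N -> 0 <= distr j.+1 c <= 1.
  move=> cP; rewrite -{1}(distr0 j.+1) distr_nd//=.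
  by rewrite -(distr_prod j.+1) distr_nd.
have step c : (c <= \prod_(i < j.+1) N i)%N ->
    \int[mu]_(s in `[0, distr j.+1 c[) g (sample_lim s) <=
    L (fun y => (g y + e) * (code j.+1 y < c)%:R).
  elim: c => [_|c IHc cP].
    rewrite distr0 set_itvco0 Rintegral_set0.
    rewrite (_ : (fun y => _) = fun=> 0) ?L_cst//.
    by apply/funext => y; rewrite mulr0.
  have c1 : distr j.+1 c <= distr j.+1 c.+1 by exact: distr_nd.
  have /andP[c0 _] := d01 c (ltnW cP); have /andP[_ c11] := d01 _ cP.
  have -> : `[0, distr j.+1 c.+1[%classic =
      `[0, distr j.+1 c[%classic `|` `[distr j.+1 c, distr j.+1 c.+1[%classic.
    apply/seteqP; split=> s /=; rewrite !in_itv/=.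
      by move=> /andP[s0 sc]; case: (ltP s (distr j.+1 c)) => sc'; [left; rewrite s0|right].
    by move=> [] /andP[s0 sc]; rewrite ?s0 ?sc ?(lt_le_trans sc c1) ?(le_trans c0 s0).
  rewrite distrS// Rintegral_setU//=; last 2 first.
  - by apply: integrable_sample_lim => //; exact: measurableU.
  - apply/disj_setPS => s /= []; rewrite !in_itv/= => /andP[_ /lt_le_trans h] /andP[/h].
    by rewrite ltxx.
  apply: lerD; first exact: IHc (ltnW cP).
  pose z := cell_point j.+1 c.
  apply: (@le_trans _ _ (\int[mu]_(s in `[distr j.+1 c, distr j.+1 c.+1[) (g z + e / 2))).
    apply: le_Rintegral => //; first exact: integrable_sample_lim.
      apply: measurable_bounded_integrable => //.
        by rewrite mu_itv// ltry.
      by exists `|g z + e / 2|; split=> [|t /ltW +  s _ //]; exact: num_real.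
    move=> s /=; rewrite in_itv/= => cs.
    have s01 : 0 <= s < 1.
      by case/andP: cs => cs sc; rewrite (le_trans c0 cs) (lt_le_trans sc c11).
    have zs : z = sample j.+1 s by rewrite /z /sample s01 (quantile_unique s01 cs).
    have := gr _ _ (sample_K j.+1 s) (sample_lim_K s)
      (le_lt_trans (sample_lim_close j s) jr).
    by rewrite -zs ler_norml => /andP[+ _]; lra.
  rewrite Rintegral_cst// mu_itv//= distr_sub -LZ; last exact: bounded_on_bool.
  apply: Lle => [||y Ky].
  - by apply: bounded_onM; [exact: bounded_on_cst|exact: bounded_on_bool].
  - by apply: bounded_onM => //; exact: bounded_on_bool.
  have [cy|_] := eqVneq (code j.+1 y) c; last by rewrite !mulr0.
  have yz : code j.+1 y = code j.+1 z by rewrite /z -cy code_cell_point.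
  have := gr _ _ Ky (cell_point_K _ _ : K z) (lt_trans (code_close Ky (cell_point_K _ _ : K z) yz) jr).
  by rewrite !mulr1 ler_norml => /andP[+ _]; lra.
have := step _ (leqnn _); rewrite distr_prod.
have -> : L (fun y => (g y + e) * (code j.+1 y < \prod_(i < j.+1) N i)%:R) = L g + e.
  rewrite -[in RHS](L_cst e) -LD; [|exact: within_continuous_bounded|exact: bounded_on_cst].
  apply: L_ext => // [|y Ky]; last by rewrite code_lt// mulr1.
  by apply: bounded_onM => //; exact: bounded_on_bool.
apply: le_trans; rewrite /Rintegral.
have mC : measurable (~` `[0 : R, 1[%classic) by exact: measurableC.
rewrite (@negligible_integral _ _ _ mu setT _ _ mC measurableT
  (integrable_sample_lim measurableT cg) mu_setC).
by rewrite setTD setCK.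
Qed.

Lemma Rintegral_sample_lim g : {within K, continuous g} ->
  (\int[mu]_s g (sample_lim s) = L g)%R.
Proof.
move=> cg; apply/eqP; rewrite eq_le; apply/andP; split; apply/ler_addgt0Pr => e e0.
  exact: Rintegral_sample_lim_le.
have := Rintegral_sample_lim_le (within_continuousZ (c := -1) cg) e0.
rewrite LZ; last exact: within_continuous_bounded.
rewrite RintegralZl//; last exact: integrable_sample_lim.
lra.
Qed.

Lemma sample_lim_measure : exists nu : {measure set (borelRn R n) -> \bar R},
  nu (~` K) = 0%E /\ forall g, {within K, continuous g} ->
    (\int[nu]_(y in K) (g y)%:E = (L g)%:E)%E.
Proof.
pose phi : measurableTypeR R -> borelRn R n := sample_lim.
have mphi : measurable_fun setT phi by exact: measurable_sample_lim.
pose nu : {measure set (borelRn R n) -> \bar R} :=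
  pushforward mu phi.
have phiK : phi @^-1` K = setT by apply/seteqP; split=> // s _; exact: sample_lim_K.
have mK : measurable (K : set (borelRn R n)) by exact: borel_closed (compact_closed _ cK).
exists (nu mphi); split.
  rewrite /nu /= /pushforward (_ : _ @^-1` _ = set0) ?measure0//.
  by apply/seteqP; split=> // s; apply; exact: sample_lim_K.
move=> g cg.
have mgK : measurable_fun (K : set (borelRn R n)) (g : borelRn R n -> R).
  exact: borel_measurable_within (compact_closed _ cK) cg.
have ig := integrable_sample_lim measurableT cg.
rewrite integralEpatch// integral_pushforward//.
- rewrite phiK -(Rintegral_sample_lim cg) /Rintegral fineK.
    apply: eq_integral => s _; rewrite /= patchE mem_set//; exact: sample_lim_K.
  exact: integrable_fin_num.
- by apply/(measurable_restrictT _ _).1 => //; exact/measurable_EFinP.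
- rewrite phiK; apply: eq_integrable ig => // s _.
  by rewrite /= patchE mem_set//; exact: sample_lim_K.
Qed.

End riesz.

Lemma riesz_compact (R : realType) (n : nat) (K : set 'rV[R]_n.+1)
    (L : ('rV[R]_n.+1 -> R) -> R) : compact K -> K !=set0 ->
  (forall g h, bounded_on K g -> bounded_on K h ->
     L (fun y => g y + h y) = L g + L h) ->
  (forall (c : R) g, bounded_on K g -> L (fun y => c * g y) = c * L g) ->
  (forall g h, bounded_on K g -> bounded_on K h ->
     (forall y, K y -> g y <= h y) -> L g <= L h) ->
  L (fun=> 1) = 1 ->
  exists nu : {measure set (borelRn R n) -> \bar R},
    nu (~` K) = 0%E /\ forall g, {within K, continuous g} ->
    (\int[nu]_(y in K) (g y)%:E = (L g)%:E)%E.
Proof.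
move=> cK [y0 Ky0] LD LZ Lle L1.
have /choice[dN dNP] : forall j : nat, exists dN : ('rV[R]_n.+1 -> nat) * nat,
    (forall y, K y -> dN.1 y < dN.2)%N /\
    forall y z, K y -> K z -> dN.1 y = dN.1 z -> `|y - z| < j.+1%:R^-1.
  by move=> j; apply: small_partition => //; rewrite invr_gt0.
apply: (@sample_lim_measure R n K y0 cK Ky0 L LD LZ Lle L1
  (fun j => (dN j).1) (fun j => (dN j).2)) => [j|j]; [exact: (dNP j).1|exact: (dNP j).2].
Qed.

(** * Harmonic measure *)

Section harmonic.
Context (R : realType) (n : nat) (Omega : set 'rV[R]_n.+1).
Context (u : 'rV[R]_n.+1 -> R).
Hypotheses (oO : open Omega).
Implicit Types (g h : 'rV[R]_n.+1 -> R) (x y p : 'rV[R]_n.+1).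

Lemma affine_quotient (c : R) p v y :
  t^-1 *: (((fun z => c + dot p z) \o shift y) (t *: v) - (c + dot p y))
    @[t --> (0 : R)^'] --> dot p v.
Proof.
apply: cvg_near_cst; near=> t.
have t0 : t != 0 by near: t; exact: nbhs_dnbhs_neq.
rewrite /= dotDr dotZr (_ : _ - _ = t * dot p v); last by ring.
by rewrite -[LHS]/(t^-1 * (t * _)) mulKf.
Unshelve. all: by end_near. Qed.

Lemma derive_affine (c : R) p v y : 'D_v (fun z => c + dot p z) y = dot p v.
Proof. by apply/cvg_lim => //; exact: affine_quotient. Qed.

Lemma derivable_affine (c : R) p v y : derivable (fun z => c + dot p z) y v.
Proof. by apply/cvg_ex; exists (dot p v); exact: affine_quotient. Qed.

Lemma Ck_on_affine k (c : R) p : Ck_on k Omega (fun z => c + dot p z).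
Proof.
have D s : exists c' p', pderiv s (fun z => c + dot p z) = (fun z => c' + dot p' z).
  elim: s => [|i s [c' [p' IHs]]]; first by exists c, p.
  exists (dot p' (delta_mx 0 i)), 0; apply/funext => y /=.
  by rewrite IHs derive_affine dot0l addr0.
split=> [s y _ _|s i y _ _]; have [c' [p' ->]] := D s.
  apply: continuousD; [exact: cst_continuous|exact: continuous_dot].
exact: derivable_affine.
Qed.

Lemma hess_affine (c : R) p y : hess (fun z => c + dot p z) y = 0.
Proof.
apply/matrixP => i j; rewrite hessE mxE /=.
have -> : 'D_(delta_mx 0 j) (fun z => c + dot p z) =
    (fun z => dot p (delta_mx 0 j) + dot 0 z).
  by apply/funext => z; rewrite derive_affine dot0l addr0.
by rewrite derive_affine dot0l.
Qed.

(** Exactly the test functions of [represents_linMA]. *)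
Definition linMA_harmonic h := [/\ Ck_on 2 Omega h,
  {within closure Omega, continuous h} & forall y, Omega y -> linMA u h y = 0].

(** Constants and coordinates are the cases that give a representing measure total mass 1 and
    barycentre [x]. *)
Lemma harmonic_affine (c : R) p : linMA_harmonic (fun z => c + dot p z).
Proof.
split; [exact: Ck_on_affine| |].
  by apply: continuous_subspaceT => y; apply: continuousD; [exact: cst_continuous|exact: continuous_dot].
by move=> y _; rewrite /linMA hess_affine mulmx0 mxtrace0.
Qed.

Lemma harmonicD g h : linMA_harmonic g -> linMA_harmonic h ->
  linMA_harmonic (fun y => g y + h y).
Proof.
move=> [Cg cg Lg] [Ch ch Lh]; split; [exact: Ck_onD|exact: within_continuousD|].
move=> y Oy; rewrite /linMA (hessD oO Cg Ch Oy) mulmxDr mxtraceD.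
by rewrite -[RHS]addr0; congr (_ + _); [exact: Lg|exact: Lh].
Qed.

Lemma harmonicZ (c : R) h : linMA_harmonic h -> linMA_harmonic (fun y => c * h y).
Proof.
move=> [Ch ch Lh]; split; [exact: Ck_onZ|exact: within_continuousZ|].
move=> y Oy; rewrite /linMA; have -> : hess (fun y => c * h y) y = c *: hess h y.
  apply/matrixP => i j; apply: etrans (hessE _ _ _ _) _.
  apply: etrans (pderivZ c oO Ch _ Oy) _ => //.
  by apply: esym; apply: etrans (mxE _ _ _ _) _; congr (_ * _); exact: hessE.
by rewrite -scalemxAr mxtraceZ -[RHS](mulr0 c); congr (_ * _); exact: Lh.
Qed.

Lemma harmonic_cst (c : R) : linMA_harmonic (fun=> c).
Proof.
rewrite (_ : (fun=> c) = fun z => c + dot 0 z); first exact: harmonic_affine.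
by apply/funext => z; rewrite dot0l addr0.
Qed.

Lemma harmonic_coord i : linMA_harmonic (fun y : 'rV[R]_n.+1 => y 0 i).
Proof.
rewrite (_ : (fun y : 'rV[R]_n.+1 => _) = fun z => 0 + dot (delta_mx 0 i) z).
  exact: harmonic_affine.
apply/funext => z; rewrite add0r /dot (bigD1 i)//= big1 => [|j ji].
  by rewrite !mxE !eqxx mul1r addr0.
by rewrite !mxE (negbTE ji) andbF mul0r.
Qed.

End harmonic.

(** * Integrals against the harmonic measure *)

Section boundary_integral.
Context (R : realType) (n : nat) (Omega : set 'rV[R]_n.+1).
Hypotheses (oO : open Omega) (bO : bounded_set Omega).
Implicit Types (g h w : 'rV[R]_n.+1 -> R) (x y : 'rV[R]_n.+1).
Implicit Types mu nu : {measure set (borelRn R n) -> \bar R}.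

Lemma bdry_sub : bdry Omega `<=` closure Omega.
Proof. by move=> y []. Qed.

Lemma bdry_compact : compact (bdry Omega).
Proof.
apply: (subclosed_compact (bdry_closed oO) (compact_closure_bounded bO)).
exact: bdry_sub.
Qed.

Lemma bdry_measurable : measurable (bdry Omega : set (borelRn R n)).
Proof. exact: borel_closed (bdry_closed oO). Qed.

Lemma within_bdry g : {within closure Omega, continuous g} ->
  {within bdry Omega, continuous g}.
Proof. by apply: continuous_subspaceW; exact: bdry_sub. Qed.

Lemma bdry_integrable mu g : (mu (bdry Omega) < +oo)%E ->
  {within closure Omega, continuous g} ->
  mu.-integrable (bdry Omega : set (borelRn R n)) (fun y => (g y)%:E).
Proof.
move=> mu1 /within_bdry cg.
have [M gM] := within_continuous_bounded bdry_compact cg.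
apply: measurable_bounded_integrable => //; first exact: bdry_measurable.
  exact: borel_measurable_within (bdry_closed oO) cg.
exists M; split=> [|t /ltW Mt y By /=]; first exact: num_real.
by apply: le_trans Mt; exact: gM.
Qed.

Lemma boundary_mass u x mu : represents_linMA Omega u x mu -> mu (bdry Omega) = 1%E.
Proof.
move=> [_ mur]; have [C c L] := @harmonic_cst R n Omega u 1.
have := mur _ _ C c L (fun _ _ => erefl).
by rewrite integral_cst ?mul1e//; exact: bdry_measurable.
Qed.

Lemma represents_Jbd u x mu : represents_linMA Omega u x mu -> Jbd Omega x mu.
Proof.
move=> mur; split; [exact: mur.1|exact: boundary_mass mur|move=> i].
by have [C c L] := @harmonic_coord R n Omega u i; have := mur.2 _ _ C c L (fun _ _ => erefl).
Qed.

(** A maximum principle at the single point [x], read off from the positivity of a representing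
    measure rather than from the operator. *)
Lemma represents_ge0 u x mu h : represents_linMA Omega u x mu ->
  linMA_harmonic Omega u h -> (forall y, bdry Omega y -> 0 <= h y) -> 0 <= h x.
Proof.
move=> [_ mur] [C c L] h0; rewrite -lee_fin (mur _ _ C c L (fun _ _ => erefl)).
by apply: integral_ge0 => y /h0; rewrite lee_fin.
Qed.

(* Uniqueness of harmonic measure forces the upper envelope of [v] by solutions
   of the Dirichlet problem to be the integral of [v]: a Hahn-Banach extension
   of evaluation at [x] which takes the envelope as its value at [v] is given by
   a representing measure. No solvability of the Dirichlet problem is needed. *)
Lemma harmonic_measure_envelope u x mu v (m : R) : is_harmonic_measure Omega u x mu ->
  {within closure Omega, continuous v} ->
  (forall h, linMA_harmonic Omega u h -> (forall y, bdry Omega y -> v y <= h y) ->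
    m <= h x) ->
  (m%:E <= \int[mu]_(y in bdry Omega) (v y)%:E)%E.
Proof.
move=> [mur muu] cv mle; have pos := represents_ge0 mur.
set K := bdry Omega.
have bv : bounded_on K v by exact: within_continuous_bounded bdry_compact (within_bdry cv).
have K0 : K !=set0.
  apply/set0P/eqP => K0; have := boundary_mass mur; rewrite -/K K0 measure0.
  by move/eqP; rewrite eq_sym onee_eq0.
(* The values at [x] of the solutions lying above [g] on the boundary; their infimum [p g] is the
   upper envelope. *)
pose S g := [set h x | h in
  [set h | linMA_harmonic Omega u h /\ forall y, K y -> g y <= h y]].
pose p g := inf (S g).
have S_inf g : bounded_on K g -> has_inf (S g).
  move=> [M gM]; split.
    exists M, (fun=> M) => //; split; first exact: harmonic_cst.
    by move=> y Ky; rewrite (le_trans (ler_norm _)) ?gM.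
  exists (- M) => _ [h [hh gh] <-].
  have := pos _ (harmonicD oO hh (@harmonic_cst _ _ Omega u M)).
  rewrite -lerBlDr sub0r; apply => y Ky.
  by have := gM _ Ky; rewrite ler_norml => /andP[+ _]; have := gh _ Ky; lra.
have p_le g h : bounded_on K g -> linMA_harmonic Omega u h ->
    (forall y, K y -> g y <= h y) -> p g <= h x.
  by move=> bg hh gh; apply: ge_inf; [exact: (S_inf _ bg).2|exists h].
have BD g h : bounded_on K g -> bounded_on K h -> bounded_on K (g + h).
  exact: bounded_onD.
have BZ (c : R) g : bounded_on K g -> bounded_on K (c *: g).
  by move=> bg; apply: bounded_onM => //; exact: bounded_on_cst.
have sp : sublinear (bounded_on K) p.
  split=> [g h bg bh|c g c0 bg].
    apply/ler_addgt0Pr => e e0; have e20 : 0 < e / 2 by rewrite divr_gt0.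
    have [_ [a [ha ga] <-] ag] := inf_adherent e20 (S_inf _ bg).
    have [_ [b [hb hb'] <-] bh'] := inf_adherent e20 (S_inf _ bh).
    have := p_le _ _ (BD _ _ bg bh) (harmonicD oO ha hb)
      (fun y Ky => lerD (ga y Ky) (hb' y Ky)).
    move: ag bh'; rewrite -/(p g) -/(p h); lra.
  rewrite -ler_pdivrMl//; apply: lb_le_inf; first exact: (S_inf _ bg).1.
  move=> _ [a [ha ga] <-]; rewrite ler_pdivrMl//.
  apply: (p_le _ _ (BZ c _ bg) (harmonicZ oO c ha)) => y Ky.
  by rewrite -[X in X <= _]/(c * g y) ler_pM2l// ga.
have [L [LD LZ Lp Lv]] := hahn_banach_sublinear BD BZ sp bv.
(* [L <= p] at [h] and at [- h] leaves no freedom on solutions, so [L] extends evaluation at [x]. *)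
have Lh h : linMA_harmonic Omega u h -> L h = h x.
  move=> hh; have bh : bounded_on K h.
    by case: hh => _ ch _; exact: within_continuous_bounded bdry_compact (within_bdry ch).
  apply/eqP; rewrite eq_le (le_trans (Lp _ bh)) ?p_le//=.
  have := p_le _ _ (BZ (-1) _ bh) (harmonicZ oO (-1) hh) (fun _ _ => lexx _).
  have := Lp _ (BZ (-1) _ bh); rewrite LZ//; lra.
(* On the boundary [g - h] lies below the solution 0, so [L (g - h) <= p (g - h) <= 0]. *)
have Lle g h : bounded_on K g -> bounded_on K h ->
    (forall y, K y -> g y <= h y) -> L g <= L h.
  move=> bg bh gh; have bN := BZ (-1) _ bh; rewrite -subr_le0 -mulN1r -LZ// -LD//.
  apply: le_trans (Lp _ (BD _ _ bg bN)) _.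
  apply: (p_le _ _ (BD _ _ bg bN) (@harmonic_cst _ _ Omega u 0)) => y Ky.
  by rewrite -[X in X <= _]/(g y + -1 * h y) mulN1r subr_le0 gh.
have L1 : L (fun=> 1) = 1 by rewrite Lh//; exact: harmonic_cst.
have [nu [nuC nuL]] := riesz_compact bdry_compact K0 LD LZ Lle L1.
have nur : represents_linMA Omega u x nu.
  split=> // g h C c H hg; have hh : linMA_harmonic Omega u h by split.
  rewrite -(Lh _ hh) -nuL; last exact: within_bdry c.
  by apply: eq_integral => y /set_mem /hg ->.
rewrite (eq_measure_integral nu); last by move=> A mA _; apply: esym; exact: muu.
rewrite nuL; last exact: within_bdry.
rewrite Lv lee_fin; apply: lb_le_inf; first exact: (S_inf _ bv).1.
by move=> _ [h [hh vh] <-]; exact: mle.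
Qed.

End boundary_integral.

(** * The values of [Penv] and [Bf] for the given data *)

Section smooth_data.
Context (R : realType) (n : nat) (Omega : set 'rV[R]_n.+1).
Context (f u phi : 'rV[R]_n.+1 -> R).
Hypotheses (bO : bounded_set Omega)
  (sO : smooth_uniformly_convex_domain Omega) (sf : smooth_closure Omega f)
  (f0 : forall y, closure Omega y -> 0 < f y) (su : smooth_closure Omega u)
  (scu : strictly_convex_on Omega u)
  (detu : forall y, Omega y -> \det (hess u y) = f y)
  (u_bdry : forall y, bdry Omega y -> u y = phi y).
Implicit Types (x y : 'rV[R]_n.+1) (w : 'rV[R]_n.+1 -> R).
Implicit Types mu : {measure set (borelRn R n) -> \bar R}.

Let oO : open Omega. Proof. by case: sO. Qed.

Let cvxO y z (t : R) : Omega y -> Omega z -> 0 <= t <= 1 ->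
  Omega (t *: y + (1 - t) *: z).
Proof.
move=> Oy Oz /andP[t0 t1]; have [_ _ cO _] := sO.
have := cO y z (Itv01 t0 t1) (mem_set Oy) (mem_set Oz).
by move=> /set_mem; exact.
Qed.

Let cf y : Omega y -> {for y, continuous f}.
Proof. by move=> Oy; have [sm _ _] := sf; exact: ((sm 0%N).1 [::] y). Qed.

Let f0O y : Omega y -> 0 < f y.
Proof. by move=> Oy; apply: f0; exact: subset_closure. Qed.

Let fM : exists M, forall y, Omega y -> f y <= M.
Proof.
have [_ cf' _] := sf.
have [M fM] := within_continuous_bounded (compact_closure_bounded bO) cf'.
by exists M => y Oy; rewrite (le_trans (ler_norm _)) ?fM//; exact: subset_closure.
Qed.

Let C2u : Ck_on 2 Omega u. Proof. by have [sm _ _] := su; exact: sm. Qed.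

Let cu : {within closure Omega, continuous u}. Proof. by case: su. Qed.

Let uA : Aclass Omega f u. Proof. exact: solution_Aclass. Qed.

(** The upper bound is comparison with the solution [h = 0]; for the lower bound [u] is itself a
    competitor. *)
Lemma Penv_solution x : Omega x -> Penv Omega f phi x = (u x)%:E.
Proof.
move=> Ox; apply/eqP; rewrite eq_le; apply/andP; split.
  apply: ge_ereal_sup => _ [w [wA wphi] <-]; rewrite lee_fin.
  have [C c L] := @harmonic_cst R n Omega u 0.
  rewrite -[leRHS]addr0; apply: (comparison oO bO cf f0O fM C2u cu scu detu C c L wA _ Ox).
  by move=> y By; rewrite addr0 u_bdry// wphi.
apply: ereal_sup_ubound; exists u => //; split=> // y By.
by rewrite /= u_bdry.
Qed.

Lemma Bf_le x mu : (Bf Omega f x mu <= \int[mu]_(y in bdry Omega) (u y)%:E - (u x)%:E)%E.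
Proof. by apply: ereal_inf_lbound; exists u. Qed.

(** The envelope inequality is used with [v = w - u] and [m = w x - u x]; its hypothesis is
    [comparison], for each solution [h] above [w - u] on the boundary. *)
Lemma Bf_harmonic_measure x mu : Omega x -> is_harmonic_measure Omega u x mu ->
  Bf Omega f x mu = (\int[mu]_(y in bdry Omega) (u y)%:E - (u x)%:E)%E.
Proof.
move=> Ox muH; apply/eqP; rewrite eq_le Bf_le/=.
apply: le_ereal_inf_tmp => _ [w wA <-]; have cw : {within closure Omega, continuous w} by case: wA.
have mu1 : (mu (bdry Omega) < +oo)%E by rewrite (boundary_mass oO muH.1) ltry.
have iu := bdry_integrable oO bO mu1 cu.
have iw := bdry_integrable oO bO mu1 cw.
have := harmonic_measure_envelope oO bO muH (m := w x - u x) (within_continuousB cw cu).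
have mB := bdry_measurable oO.
under eq_integral do rewrite EFinB.
rewrite (integralB_EFin mB iw iu).
have := integrable_fin_num mB iu; have := integrable_fin_num mB iw.
case: (integral _ _ _) => // a _; case: (integral _ _ _) => // b _.
rewrite -!EFinB !lee_fin => H.
suff : w x - u x <= a - b by lra.
apply: H => h [C c L] wuh; rewrite lerBlDl.
apply: (comparison oO bO cf f0O fM C2u cu scu detu C c L wA _ Ox) => y By.
by have := wuh _ By; rewrite lerBlDl.
Qed.

End smooth_data.

Theorem theorem6p1 (R : realType) (n : nat) (Omega : set 'rV[R]_n.+1)
    (f u phi : 'rV[R]_n.+1 -> R)
    (Omega_bounded : bounded_set Omega)
    (Omega_smooth_convex : smooth_uniformly_convex_domain Omega)
    (f_smooth : smooth_closure Omega f)
    (f_gt0 : forall y, closure Omega y -> 0 < f y)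
    (u_smooth : smooth_closure Omega u)
    (u_convex : strictly_convex_on Omega u)
    (det_hess_u : forall y, Omega y -> \det (hess u y) = f y)
    (u_bdry : forall y, bdry Omega y -> u y = phi y)
    (x : 'rV[R]_n.+1) (Omega_x : Omega x) :
  (u x)%:E = Penv Omega f phi x /\
  forall omega : {measure set (borelRn R n) -> \bar R},
    is_harmonic_measure Omega u x omega ->
    [/\ Jbd Omega x omega,
        Bf Omega f x omega
          = (\int[omega]_(y in bdry Omega) (phi y)%:E - (u x)%:E)%E,
        Penv Omega f phi x
          = ereal_inf [set (\int[mu]_(y in bdry Omega) (phi y)%:E
                            - Bf Omega f x mu)%E | mu in Jbd Omega x] &
        (\int[omega]_(y in bdry Omega) (phi y)%:E - Bf Omega f x omega)%E
          = ereal_inf [set (\int[mu]_(y in bdry Omega) (phi y)%:E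
                            - Bf Omega f x mu)%E | mu in Jbd Omega x]].
Proof.
have oO : open Omega by case: Omega_smooth_convex.
have Pu := Penv_solution Omega_bounded Omega_smooth_convex f_smooth f_gt0
  u_smooth u_convex det_hess_u u_bdry Omega_x.
have Bu := Bf_le Omega_smooth_convex f_smooth f_gt0 u_smooth u_convex det_hess_u x.
split=> // omega omegaH; have omegaJ := represents_Jbd oO omegaH.1.
have phiE (mu : {measure set (borelRn R n) -> \bar R}) :
    (\int[mu]_(y in bdry Omega) (phi y)%:E = \int[mu]_(y in bdry Omega) (u y)%:E)%E.
  by apply: eq_integral => y /set_mem By; rewrite u_bdry.
have Bomega := Bf_harmonic_measure Omega_bounded Omega_smooth_convex f_smooth
  f_gt0 u_smooth u_convex det_hess_u Omega_x omegaH.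
(* Finiteness is what allows cancellation in extended-real subtractions. *)
have fin (mu : {measure set (borelRn R n) -> \bar R}) : Jbd Omega x mu ->
    (\int[mu]_(y in bdry Omega) (u y)%:E)%E \is a fin_num.
  move=> [_ mu1 _]; apply: (integrable_fin_num (bdry_measurable oO)).
  apply: bdry_integrable => //; first by rewrite mu1 ltry.
  by case: u_smooth.
have omega_u : (\int[omega]_(y in bdry Omega) (phi y)%:E - Bf Omega f x omega)%E = (u x)%:E.
  rewrite phiE Bomega; have := fin _ omegaJ.
  by case: (integral _ _ _) => // a _; rewrite -!EFinB subKr.
have dual : ereal_inf [set (\int[mu]_(y in bdry Omega) (phi y)%:E
    - Bf Omega f x mu)%E | mu in Jbd Omega x] = (u x)%:E.
  apply/eqP; rewrite eq_le; apply/andP; split.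
    by rewrite -omega_u; apply: ereal_inf_lbound; exists omega.
  (* Weak duality: [Bf] is at most its value at the competitor [u]. This excludes [+oo], and if [Bf]
     is [-oo] the difference is [+oo]. *)
  apply: le_ereal_inf_tmp => _ [mu muJ <-]; rewrite phiE.
  have := Bu mu; have := fin _ muJ.
  case: (integral _ _ _) => // a _; case: (Bf _ _ _ _) => [b| |] //=.
    by rewrite -!EFinB !lee_fin; lra.
  by rewrite leey.
by split; rewrite ?dual// Bomega phiE.
Qed.
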